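(* Let $p>2$, let $h$ satisfy $\lim_{t\to\infty}\frac{h'(t)}{t^{p-1}h(t)}=0$, and let $\{(\lambda_n,\mu_n,u_n)\}$ be a sequence of solutions (in the sense of the context) with $\mu_n\to\infty$ as $n\to\infty$. Let $(\rho_{0,n})\subset(0,1)$ be a sequence as described in the context (the first concentration radius, along a subsequence). Then, up to a subsequence, for all $k\in\mathbb N$ there exist sequences $(r_{k,n}),(\rho_{k,n}),(\bar\rho_{k,n})\subset(0,1)$ such that, as $n\to\infty$, $u_n(r_{k,n})/\mu_n\to\delta_k$, \[ p\lambda_nr_{k,n}^2u_n(r_{k,n})^{p-1}f(u_n(r_{k,n}))\to\frac{a_k^2}{2}, \] $u_n(\rho_{k,n})/\mu_n\to\delta_k$, $u_n(\bar\rho_{k,n})/\mu_n\to\delta_k$, $\rho_{k-1,n}/\bar\rho_{k,n}\to0$, $\bar\rho_{k,n}/r_{k,n}\to0$, $r_{k,n}/\rho_{k,n}\to0$, and, if positive numbers $\gamma_{k,n}$ and functions $z_{k,n}$ are defined by \[ \gamma_{k,n}^2\,p\lambda_nu_n(r_{k,n})^{p-1}f(u_n(r_{k,n}))=1,\qquad z_{k,n}(r)=p\,u_n(r_{k,n})^{p-1}\big(u_n(\gamma_{k,n}r)-u_n(r_{k,n})\big)\quad(r\in[0,1/\gamma_{k,n}]), \] then $\gamma_{k,n}\to0$ and \[ \|z_{k,n}-z_k\|_{C^2([\bar\rho_{k,n}/\gamma_{k,n},\,\rho_{k,n}/\gamma_{k,n}])}\to0, \] where $z_k$ is the function on $(0,\infty)$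 given by \[ z_k(r)=\log\frac{2a_k^2b_k}{r^{2-a_k}(1+b_kr^{a_k})^2},\qquad b_k=\left(\frac{\sqrt2}{a_k}\right)^{a_k}, \] which satisfies $-z_k''-\frac1rz_k'=e^{z_k}$ in $(0,\infty)$, $z_k(a_k/\sqrt2)=0$, $-(a_k/\sqrt2)\,z_k'(a_k/\sqrt2)=2$, and $\int_0^\infty e^{z_k}r\,dr=2a_k$. Moreover, \[ p\mu_n^{p-1}\int_{\rho_{k-1,n}}^{\bar\rho_{k,n}}\lambda_nf(u_n)\,r\,dr\to0,\qquad p\mu_n^{p-1}\int_{\bar\rho_{k,n}}^{\rho_{k,n}}\lambda_nf(u_n)\,r\,dr\to\frac{2a_k}{\delta_k^{p-1}}, \] and \[ p\int_{\rho_{k-1,n}}^{\bar\rho_{k,n}}\lambda_nu_n^{p-1}f(u_n)\,r\,dr\to0,\qquad p\int_{\bar\rho_{k,n}}^{\rho_{k,n}}\lambda_nu_n^{p-1}f(u_n)\,r\,dr\to2a_k \] as $n\to\infty$.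
   Context: $h:[0,\infty)\to\mathbb{R}$ is a nonnegative $C^1$ function and there is $t_0>0$ with $h(t)>0$ for all $t\ge t_0$; $f(t)=h(t)e^{t^p}$. A sequence of solutions $\{(\lambda_n,\mu_n,u_n)\}$ means: for every $n\in\mathbb N$, $\lambda_n>0$, $\mu_n>0$, and $u_n$ is a classical solution on $[0,1]$ of $-u_n''-\frac1r u_n'=\lambda_nf(u_n)$, $u_n>0$ in $(0,1)$, $u_n(0)=\mu_n$, $u_n'(0)=0=u_n(1)$. ''Up to a subsequence'' means after passing to a subsequence in $n$, not relabelled. The numbers $a_k,\delta_k$ (depending only on $p>2$): $a_0=2$, $\delta_0=1$, and for $k\in\mathbb N$ the numbers $\delta_k\in(0,\delta_{k-1})$ and $a_k\in(0,2)$ are uniquely determined recursively by \[ \frac{2p}{2+a_{k-1}}\Big(1-\frac{\delta_k}{\delta_{k-1}}\Big)-1+\Big(\frac{\delta_k}{\delta_{k-1}}\Big)^p=0,\qquad a_k=2-\Big(\frac{\delta_k}{\delta_{k-1}}\Big)^{p-1}(2+a_{k-1}). \] The sequence $(\rho_{0,n})\subset(0,1)$: with $\gamma_{0,n}>0$ defined by $p\lambda_n\mu_n^{p-1}f(\mu_n)\gamma_{0,n}^2=1$, $z_{0,n}(r)=p\mu_n^{p-1}(u_n(\gamma_{0,n}r)-\mu_n)$ and $z_0(r)=\log\frac{64}{(8+r^2)^2}$, it satisfies (along a subsequence, to which one passes) $\gamma_{0,n}\to0$, $\rho_{0,n}\to0$, $\rho_{0,n}/\gamma_{0,n}\to\infty$,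 $u_n(\rho_{0,n})/\mu_n\to1$, $\|z_{0,n}-z_0\|_{C^1([0,\rho_{0,n}/\gamma_{0,n}])}\to0$, and $p\mu_n^{p-1}\int_0^{\rho_{0,n}}\lambda_nf(u_n)r\,dr\to4$. *)

(* Defs.v *)
(* Stdlib reals with Coquelicot. *)
From Stdlib Require Import Reals.
From Coquelicot Require Import Coquelicot.
Open Scope R_scope.

(* Real power of a nonnegative number, with 0 ^ y = 0.  (Stdlib's [Rpower 0 y]
   is 1, which would be wrong for t ^ p at t = 0.) *)
Definition rpow (x y : R) : R := if Rlt_dec 0 x then Rpower x y else 0.

Definition strictly_increasing (phi : nat -> nat) : Prop :=
  forall n, (phi n < phi (S n))%nat.

Definition subsequence_of (s psi : nat -> nat) : Prop :=
  exists theta, strictly_increasing theta /\ forall n, s n = psi (theta n).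

Definition icc (a b x : R) : Prop := a <= x <= b.

(* [f'] is the derivative of [f] on [D], computed inside [D]: one-sided at the
   end points of an interval, so that values of [f] outside [D] are irrelevant. *)
Definition derivative_on (D : R -> Prop) (f f' : R -> R) : Prop :=
  forall x, D x ->
    filterdiff f (within D (locally x)) (fun y => scal y (f' x)).

Definition C1_on (D : R -> Prop) (f : R -> R) : Prop :=
  exists f', derivative_on D f f' /\ continuous_on D f'.

Definition is_sup_norm (D : R -> Prop) (w : R -> R) (N : R) : Prop :=
  is_lub (fun y => exists x, D x /\ y = Rabs (w x)) N.

(* [w] is of class C^k on [D] and
   N = sup_D |w| + sup_D |w'| + ... + sup_D |w^(k)|. *)
Fixpoint is_Ck_norm (k : nat) (D : R -> Prop) (w : R -> R) (N : R) : Prop :=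
  match k with
  | O => continuous_on D w /\ is_sup_norm D w N
  | S k' => exists (w' : R -> R) (N0 N1 : R),
      derivative_on D w w' /\ is_sup_norm D w N0 /\
      is_Ck_norm k' D w' N1 /\ N = N0 + N1
  end.

(* || w n ||_{C^k(D n)} -> 0.  Only large n matter: for small n the interval
   [D n] may be empty. *)
Definition Ck_norm_to_0 (k : nat) (D : nat -> R -> Prop) (w : nat -> R -> R)
  : Prop :=
  exists N : nat -> R,
    eventually (fun n => is_Ck_norm k (D n) (w n) (N n)) /\ is_lim_seq N 0.

Definition nonlin (h : R -> R) (p t : R) : R := h t * exp (rpow t p).

Definition is_solution (f : R -> R) (lambda mu : R) (u : R -> R) : Prop :=
  0 < lambda /\ 0 < mu /\
  exists u' u'' : R -> R,
    derivative_on (icc 0 1) u u' /\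
    derivative_on (icc 0 1) u' u'' /\
    continuous_on (icc 0 1) u'' /\
    (forall r, 0 < r < 1 -> - u'' r - / r * u' r = lambda * f (u r)) /\
    (forall r, 0 < r < 1 -> 0 < u r) /\
    u 0 = mu /\ u' 0 = 0 /\ u 1 = 0.

Definition concentration_numbers (p : R) (a delta : nat -> R) : Prop :=
  a 0%nat = 2 /\ delta 0%nat = 1 /\
  forall k, (1 <= k)%nat ->
    0 < delta k < delta (pred k) /\
    0 < a k < 2 /\
    2 * p / (2 + a (pred k)) * (1 - delta k / delta (pred k)) - 1
      + rpow (delta k / delta (pred k)) p = 0 /\
    a k = 2 - rpow (delta k / delta (pred k)) (p - 1) * (2 + a (pred k)).

Definition profile0 (r : R) : R := ln (64 / (8 + r ^ 2) ^ 2).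

Definition first_concentration (p : R) (f : R -> R) (lambda mu : nat -> R)
  (u : nat -> R -> R) (rho0 : nat -> R) : Prop :=
  (forall n, 0 < rho0 n < 1) /\
  exists gamma0 : nat -> R,
    (forall n, 0 < gamma0 n /\
       p * lambda n * rpow (mu n) (p - 1) * f (mu n) * gamma0 n ^ 2 = 1) /\
    is_lim_seq gamma0 0 /\
    is_lim_seq rho0 0 /\
    is_lim_seq (fun n => rho0 n / gamma0 n) p_infty /\
    is_lim_seq (fun n => u n (rho0 n) / mu n) 1 /\
    Ck_norm_to_0 1 (fun n => icc 0 (rho0 n / gamma0 n))
      (fun n r => p * rpow (mu n) (p - 1) * (u n (gamma0 n * r) - mu n)
                  - profile0 r) /\
    is_lim_seq (fun n => p * rpow (mu n) (p - 1) *
      RInt (fun r => lambda n * f (u n r) * r) 0 (rho0 n)) 4.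

Definition profile (a r : R) : R :=
  let b := rpow (sqrt 2 / a) a in
  ln (2 * a ^ 2 * b / (rpow r (2 - a) * (1 + b * rpow r a) ^ 2)).

Definition solves_liouville (z : R -> R) : Prop :=
  forall r, 0 < r ->
    ex_derive z r /\ ex_derive (Derive z) r /\
    - Derive (Derive z) r - / r * Derive z r = exp (z r).

(* Main.v *)
Require Import Defs.
From Stdlib Require Import Reals Lra Lia Psatz Classical IndefiniteDescription.
From Coquelicot Require Import Coquelicot.
Open Scope R_scope.

(* In the variable s = log r, with V(s) = u(e^s), the equation reads V'' = - E with
   E = lambda e^(2s) f(V), so V is concave.  Rescale the slope and the source as
   P = - p mu^(p-1) V' and e = p mu^(p-1) E; then P' = e and
   e' = e (2 - P (V/mu)^(p-1) (1 + o(1))).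

   Drift.  After the (k-1)-st concentration e is negligible, so V follows its tangent
   line for a time of order mu^p.  Below a line the exponent of E is at most a convex
   function of s, which makes E exponentially small until this exponent returns to
   zero; the equations for delta_k and a_k say that this happens at height
   delta_k mu and with slope P delta_k^(p-1) = 2 - a_k.

   Concentration.  Near that time X = delta_k^(p-1) P and g = delta_k^(p-1) e almost
   solve X' = g, g' = g (2 - X), for which g + (X - 2)^2 / 2 is conserved.  Hence X must
   cross the value 2, and there g is close to a_k^2 / 2; this is the point r_k.  A
   Gronwall estimate around r_k gives the convergence to the Liouville profile on
   compact sets, along which X runs from 2 - a_k to 2 + a_k.  A diagonal argument
   provides rho_k and rhobar_k, and the integrals are differences of slopes. *)

(** * Real powers and nonlinearities of exponential type *)

(** The hypothesis on [h] controls [(log f)'] only up to a factor [1 + o(1)], so [log f] is known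
    only up to an error [o(mu^p)], which may be unbounded: expanding the exponent cannot tell where
    the source becomes of order one. Hence the drift is stopped a time [eta mu^p] too early, while
    the source is still exponentially small, and the rest of the way is covered by the energy. While
    [0 <= X <= 2] the energy changes by at most [2 e] times the increase of [X], however long the
    window is, because its derivative is bounded by [2 e g = 2 e X']. This makes a window of length
    of order [eta mu^p] harmless. The point [r_k] is then defined by [X = 2] exactly, an event that
    needs no finer knowledge of the exponent.

    The induction carries [plateau]. Besides height and slope it records that the source tends to 0
    but has a logarithm of size [o(mu^p)]: the former makes the change of slope during the drift
    vanish in the limit, the latter puts the exponent at 0 when the drift starts. The outgoing slope
    [(2 + a_k) / delta_k^(p-1)] is the incoming slope of the next step. *)

Lemma rpow_pos_eq (x y : R) : 0 < x -> rpow x y = Rpower x y.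
Proof. intros Hx; unfold rpow; destruct (Rlt_dec 0 x); [reflexivity | lra]. Qed.

Lemma Rpower_pos (x y : R) : 0 < Rpower x y.
Proof. apply exp_pos. Qed.

Lemma Rpower_pred (x p : R) : 0 < x -> Rpower x p = x * Rpower x (p - 1).
Proof.
  intros Hx. rewrite <- (Rpower_1 x) at 2 by assumption.
  rewrite <- Rpower_plus. f_equal; ring.
Qed.

Lemma Rpower_div (x y p : R) : 0 < x -> 0 < y ->
  Rpower (x / y) p = Rpower x p / Rpower y p.
Proof.
  intros Hx Hy. unfold Rpower. rewrite Rcomplements.ln_div by assumption.
  rewrite Rmult_minus_distr_l. unfold Rminus. rewrite exp_plus, exp_Ropp. reflexivity.
Qed.

Lemma Rpower_incr (x y p : R) : 0 <= p -> 0 < x <= y -> Rpower x p <= Rpower y p.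
Proof. intros Hp [Hx Hy]. apply Rle_Rpower_l; lra. Qed.

Lemma is_derive_Rpower (p x : R) : 0 < x ->
  is_derive (fun t => Rpower t p) x (p * Rpower x (p - 1)).
Proof.
  intros Hx. apply is_derive_Reals. apply derivable_pt_lim_power. exact Hx.
Qed.

(* Convexity of exp in the form e^z >= 1 + z, applied at both ends. *)
Lemma Rpower_tangent (p x y : R) : 1 <= p -> 0 < x -> 0 < y ->
  Rpower x p + p * Rpower x (p - 1) * (y - x) <= Rpower y p.
Proof.
  intros Hp Hx Hy.
  assert (H1 : forall z, 1 + z <= exp z).
  { intros z. destruct (Req_dec z 0) as [->|Hz].
    - rewrite exp_0; lra.
    - left; apply exp_ineq1; exact Hz. }
  set (q := y / x).
  assert (Hq : 0 < q) by (apply Rdiv_lt_0_compat; assumption).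
  assert (Hyq : y = x * q) by (unfold q; field; lra).
  assert (Hb : 1 + p * (q - 1) <= Rpower q p).
  { set (u := ln q).
    assert (E1 : q = exp u) by (unfold u; rewrite exp_ln; auto).
    assert (E2 : Rpower q p = q * exp ((p - 1) * u)).
    { rewrite (Rpower_pred q p Hq). reflexivity. }
    assert (H2 := H1 ((p - 1) * u)). assert (H3 := H1 (- u)).
    assert (E3 : exp (- u) * q = 1).
    { rewrite E1, <- exp_plus. replace (- u + u) with 0 by ring. apply exp_0. }
    rewrite E2.
    assert (q * (1 + (p - 1) * u) <= q * exp ((p - 1) * u)) by (apply Rmult_le_compat_l; lra).
    assert ((p - 1) * (q * (1 - u)) <= (p - 1) * 1).
    { apply Rmult_le_compat_l; [lra|]. rewrite <- E3, (Rmult_comm q).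
      apply Rmult_le_compat_r; lra. }
    lra. }
  rewrite Hyq.
  rewrite <- Rpower_mult_distr by assumption.
  rewrite (Rpower_pred x p Hx) at 1 2.
  assert (0 < x * Rpower x (p - 1)) by (apply Rmult_lt_0_compat; [assumption|apply Rpower_pos]).
  nra.
Qed.

Lemma locally_positive (x : R) : 0 < x -> locally x (fun y => 0 < y).
Proof.
  intros Hx. exists (mkposreal x Hx). intros y Hy. change (Rabs (y - x) < x) in Hy.
  apply Rabs_lt_between in Hy. lra.
Qed.

Lemma deriv_nonneg_le (g g' : R -> R) (a b : R) : a <= b ->
  (forall x, a <= x <= b -> is_derive g x (g' x)) ->
  (forall x, a <= x <= b -> 0 <= g' x) -> g a <= g b.
Proof.
  intros Hab Hd Hp.
  destruct (MVT_gen g a b g') as [c [Hc Heq]].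
  - intros x Hx. apply Hd. rewrite Rmin_left, Rmax_right in Hx; lra.
  - intros x Hx. apply continuity_pt_filterlim.
    apply (ex_derive_continuous g x). exists (g' x). apply Hd.
    rewrite Rmin_left, Rmax_right in Hx; lra.
  - rewrite Rmin_left, Rmax_right in Hc by lra.
    assert (0 <= g' c * (b - a)) by (apply Rmult_le_pos; [apply Hp|]; lra).
    lra.
Qed.

Lemma deriv_ge_le (g g' : R -> R) (m a b : R) : a <= b ->
  (forall x, a <= x <= b -> is_derive g x (g' x)) ->
  (forall x, a <= x <= b -> m <= g' x) -> m * (b - a) <= g b - g a.
Proof.
  intros Hab Hd Hp.
  assert (H : g a - m * a <= g b - m * b).
  { apply (deriv_nonneg_le (fun x => g x - m * x) (fun x => g' x - m)); auto.
    - intros x Hx. specialize (Hd x Hx).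
      apply (is_derive_minus g (fun x => m * x)); [exact Hd|].
      auto_derive; [auto|ring].
    - intros x Hx; specialize (Hp x Hx); lra. }
  lra.
Qed.

Lemma deriv_le_ge (g g' : R -> R) (m a b : R) : a <= b ->
  (forall x, a <= x <= b -> is_derive g x (g' x)) ->
  (forall x, a <= x <= b -> g' x <= m) -> g b - g a <= m * (b - a).
Proof.
  intros Hab Hd Hp.
  assert (H := deriv_ge_le (fun x => - g x) (fun x => - g' x) (- m) a b Hab).
  assert (- m * (b - a) <= - g b - - g a); [|lra].
  apply H.
  - intros x Hx. apply (is_derive_opp g). apply Hd; assumption.
  - intros x Hx; specialize (Hp x Hx); lra.
Qed.

Definition log_deriv (f : R -> R) (t : R) : R := Derive f t / f t.

(* The only properties of [f] that the argument uses: [(log f)'] is asymptotic to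
   [p t^(p-1)], and [f] is nonnegative and locally bounded. *)
Definition exp_type (p : R) (f : R -> R) : Prop :=
  (forall t, 0 <= t -> 0 <= f t) /\
  (forall T, exists M, forall t, 0 <= t <= T -> f t <= M) /\
  (forall eps, 0 < eps -> exists T, 0 < T /\ forall t, T <= t ->
     0 < f t /\ ex_derive f t /\
     Rabs (log_deriv f t - p * Rpower t (p - 1)) <= eps * (p * Rpower t (p - 1))).

Lemma is_derive_ln_comp (f : R -> R) (t : R) : 0 < f t -> ex_derive f t ->
  is_derive (fun x => ln (f x)) t (log_deriv f t).
Proof.
  intros H1 H2. unfold log_deriv. auto_derive; [auto|].
  change (fun x => f x) with f. field; lra.
Qed.

(** By the bound on [log_deriv], [ln f - (1 - eps) t^p] and [(1 + eps) t^p - ln f] are nondecreasing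
    beyond [T]. *)
Lemma exp_type_log (p : R) (f : R -> R) (eps : R) : exp_type p f -> 0 < eps ->
  exists T, 0 < T /\ (forall t, T <= t -> 0 < f t) /\
  forall x y, T <= x <= y ->
    (1 - eps) * (Rpower y p - Rpower x p) <= ln (f y) - ln (f x) <=
    (1 + eps) * (Rpower y p - Rpower x p).
Proof.
  intros (_ & _ & H) He. destruct (H eps He) as (T & HT & Hf).
  exists T; split; [assumption|]; split; [intros t Ht; apply Hf; assumption|].
  intros x y [Hx Hy].
  assert (Hd : forall c t, x <= t <= y ->
    is_derive (fun t => ln (f t) - c * Rpower t p) t
      (log_deriv f t - c * (p * Rpower t (p - 1)))).
  { intros c t Ht. destruct (Hf t) as (F1 & F2 & F3); [lra|].
    apply (is_derive_minus (fun t => ln (f t)) (fun t => c * Rpower t p)).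
    - apply is_derive_ln_comp; assumption.
    - apply is_derive_scal. apply is_derive_Rpower; lra. }
  split.
  - assert (K := deriv_nonneg_le _ _ x y Hy (Hd (1 - eps))). simpl in K.
    assert (ln (f x) - (1 - eps) * Rpower x p <= ln (f y) - (1 - eps) * Rpower y p); [|lra].
    apply K. intros t Ht. destruct (Hf t) as (F1 & F2 & F3); [lra|].
    apply Rabs_le_between in F3. lra.
  - assert (K := deriv_le_ge _ _ 0 x y Hy (Hd (1 + eps))). simpl in K.
    assert ((ln (f y) - (1 + eps) * Rpower y p) - (ln (f x) - (1 + eps) * Rpower x p)
            <= 0 * (y - x)); [|lra].
    apply K. intros t Ht. destruct (Hf t) as (F1 & F2 & F3); [lra|].
    apply Rabs_le_between in F3. lra.
Qed.

(** [f] need not be monotone on a bounded range, but it is bounded there, and beyond some point it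
    increases to infinity. This allows the source to be estimated through an upper bound of [V] even
    where [V] itself is too small for [ln f] to be controlled. *)
Lemma exp_type_dominates (p : R) (f : R -> R) : 1 <= p -> exp_type p f ->
  exists T, 0 < T /\ forall x, T <= x -> 0 < f x /\
    forall t, 0 <= t <= x -> f t <= f x.
Proof.
  intros Hp Hf. destruct (exp_type_log p f (1/2) Hf) as (T0 & HT0 & Hpos & Hlog); [lra|].
  assert (Hmon : forall x y, T0 <= x <= y -> f x <= f y).
  { intros x y Hxy. destruct (Hlog x y Hxy) as [H1 _].
    assert (Rpower x p <= Rpower y p) by (apply Rpower_incr; lra).
    destruct (Rle_or_lt (f x) (f y)) as [Hle|Hlt]; [exact Hle|].
    apply ln_increasing in Hlt; [lra|apply Hpos; lra]. }
  destruct Hf as (Hf0 & Hb & _). destruct (Hb T0) as (M & HM).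
  set (M' := Rmax M 1).
  (* Since [T0], [ln f] has gained at least [(x^p - T0^p) / 2], and [x <= x^p] for [x >= 1]; past
     this [T] the value of [f] therefore exceeds the bound [M'] valid on [[0, T0]]. *)
  set (T := Rmax (Rmax T0 1) (Rpower T0 p + 2 * (ln M' - ln (f T0)))).
  assert (HT1 : T0 <= T) by (unfold T; eapply Rle_trans; [apply Rmax_l|]; apply Rmax_l).
  assert (HT2 : 1 <= T) by (unfold T; eapply Rle_trans; [apply Rmax_r|]; apply Rmax_l).
  assert (HT3 : Rpower T0 p + 2 * (ln M' - ln (f T0)) <= T) by apply Rmax_r.
  exists T; split; [lra|]. intros x Hx.
  assert (Fx : 0 < f x) by (apply Hpos; lra).
  split; [exact Fx|].
  intros t Ht. destruct (Rle_or_lt T0 t) as [H|H]; [apply Hmon; lra|].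
  apply Rle_trans with M'; [apply Rle_trans with M; [apply HM; lra|apply Rmax_l]|].
  destruct (Hlog T0 x) as [H1 _]; [lra|].
  assert (Hxp : x <= Rpower x p).
  { rewrite <- (Rpower_1 x) at 1 by lra. apply Rle_Rpower; lra. }
  destruct (Rle_or_lt M' (f x)) as [Hle|Hlt]; [exact Hle|].
  apply ln_increasing in Hlt; [lra|exact Fx].
Qed.

Lemma continuous_Rpower (p x : R) : 0 < x -> continuous (fun t => Rpower t p) x.
Proof. intros Hx. apply (ex_derive_continuous (fun t => Rpower t p) x). eexists. apply is_derive_Rpower, Hx. Qed.

Lemma Rpower_near_1 (q eps : R) : 0 < eps -> exists w, 0 < w < 1 /\
  forall x, Rabs (x - 1) <= w -> Rabs (Rpower x q - 1) <= eps.
Proof.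
  intros He.
  assert (C := continuous_Rpower q 1 Rlt_0_1).
  assert (E : Rpower 1 q = 1) by (unfold Rpower; rewrite ln_1, Rmult_0_r; apply exp_0).
  destruct (proj1 (filterlim_locally _ _) C (mkposreal eps He)) as [d Hd].
  exists (Rmin (d / 2) (1/2)). assert (Hd0 := cond_pos d).
  split; [split; [apply Rmin_pos; lra|]|].
  - eapply Rle_lt_trans; [apply Rmin_r|]; lra.
  - intros x Hx. left.
    assert (Hb : ball 1 d x).
    { change (Rabs (x - 1) < d). eapply Rle_lt_trans; [exact Hx|].
      eapply Rle_lt_trans; [apply Rmin_l|]; lra. }
    specialize (Hd x Hb). change (Rabs (Rpower x q - Rpower 1 q) < eps) in Hd.
    rewrite E in Hd. exact Hd.
Qed.

(** Freezes the coefficient: at heights within relative distance [w] of [x], [(log f)'] may be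
    replaced by [p x^(p-1)], taken at the reference height. This is the origin of the factor [th]
    close to 1 in the equation for [g]. *)
Lemma exp_type_ratio (p : R) (f : R -> R) (eps : R) : 0 < p -> exp_type p f -> 0 < eps ->
  exists w T, 0 < w < 1 /\ 0 < T /\ forall x xi, T <= x -> Rabs (xi - x) <= w * x ->
    0 < xi /\ 0 < f xi /\ ex_derive f xi /\
    Rabs (log_deriv f xi / (p * Rpower x (p - 1)) - 1) <= eps.
Proof.
  intros Hp (_ & _ & H) He.
  (* Two factors within [e] of 1 are multiplied, and [(1 + e)^2 - 1 <= 3 e] for [e <= 1]. *)
  set (e := Rmin (eps / 3) 1).
  assert (He0 : 0 < e) by (apply Rmin_pos; lra).
  assert (He1 : e <= eps / 3) by apply Rmin_l.
  assert (He2 : e <= 1) by apply Rmin_r.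
  destruct (H e He0) as (T & HT & Hf).
  destruct (Rpower_near_1 (p - 1) e He0) as (w & Hw & Hpw).
  exists w, (T / (1 - w)).
  assert (0 < T / (1 - w)) by (apply Rdiv_lt_0_compat; lra).
  split; [exact Hw|]; split; [assumption|].
  intros x xi Hx Hxi.
  assert (Hxi2 := Hxi). apply Rabs_le_between in Hxi2.
  assert (HTx : T <= xi).
  { assert (T <= (1 - w) * x); [|lra].
    apply Rmult_le_compat_l with (r := 1 - w) in Hx; [|lra].
    replace ((1 - w) * (T / (1 - w))) with T in Hx by (field; lra). lra. }
  destruct (Hf xi HTx) as (F1 & F2 & F3).
  repeat (split; [assumption || lra|]).
  assert (Hq : Rabs (xi / x - 1) <= w).
  { replace (xi / x - 1) with ((xi - x) / x) by (field; lra).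
    unfold Rdiv. rewrite Rabs_mult, (Rabs_pos_eq (/ x)) by (left; apply Rinv_0_lt_compat; lra).
    apply Rmult_le_reg_r with x; [lra|]. rewrite Rmult_assoc, Rinv_l, Rmult_1_r by lra. lra. }
  specialize (Hpw _ Hq). rewrite Rpower_div in Hpw by lra.
  assert (Px := Rpower_pos x (p - 1)). assert (Pxi := Rpower_pos xi (p - 1)).
  set (A := Rpower x (p - 1)) in *. set (B := Rpower xi (p - 1)) in *.
  set (L := log_deriv f xi) in *.
  apply Rabs_le_between in Hpw. apply Rabs_le_between in F3.
  assert (HB : B = (B / A) * A) by (field; lra).
  set (s := B / A) in *.
  assert (HL : L = (L / (p * A)) * (p * A)) by (field; split; lra).
  set (m := L / (p * A)) in *.
  assert (Hm : (1 - e) * s <= m <= (1 + e) * s).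
  { rewrite HL, HB in F3.
    split; apply Rmult_le_reg_r with (p * A); try lra; nra. }
  apply Rabs_le_between. nra.
Qed.

(** * The limiting Liouville equation *)

(** The derivative of the energy is [g X (1 - th)], at most [2 e g = 2 e X'] in absolute value. So
    the error is paid by the increase of [X] and not by the length of the interval; in the proof,
    [2 e X] plus or minus the energy is nondecreasing. *)
Lemma bubble_energy (X g th : R -> R) (e a b : R) : a <= b -> 0 <= e ->
  (forall s, a <= s <= b -> is_derive X s (g s)) ->
  (forall s, a <= s <= b -> is_derive g s (g s * (2 - X s * th s))) ->
  (forall s, a <= s <= b -> 0 <= g s) ->
  (forall s, a <= s <= b -> 0 <= X s <= 2 /\ Rabs (th s - 1) <= e) ->
  Rabs ((g b + (X b - 2) ^ 2 / 2) - (g a + (X a - 2) ^ 2 / 2)) <= 2 * e * (X b - X a).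
Proof.
  intros Hab He HX Hg Hg0 Hth.
  assert (HH : forall s, a <= s <= b ->
    is_derive (fun s => g s + (X s - 2) ^ 2 / 2) s (g s * X s * (1 - th s))).
  { intros s Hs. specialize (HX s Hs). specialize (Hg s Hs).
    auto_derive; [repeat split; eexists; eassumption|].
    rewrite (is_derive_unique (fun x : R => X x) _ _ HX), (is_derive_unique (fun x : R => g x) _ _ Hg).
    field. }
  assert (Hb : forall s, a <= s <= b -> Rabs (g s * X s * (1 - th s)) <= 2 * e * g s).
  { intros s Hs. destruct (Hth s Hs) as [H1 H2]. specialize (Hg0 s Hs).
    rewrite <- Rabs_Ropp in H2. replace (- (th s - 1)) with (1 - th s) in H2 by ring.
    rewrite Rabs_mult, (Rabs_pos_eq (g s * X s)) by nra.
    assert (0 <= g s * X s <= 2 * g s) by nra.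
    assert (H3 := Rabs_pos (1 - th s)). nra. }
  apply Rabs_le_between'. split.
  - assert (K := deriv_nonneg_le (fun s => g s + (X s - 2) ^ 2 / 2 + 2 * e * X s)
      (fun s => g s * X s * (1 - th s) + 2 * e * g s) a b Hab).
    cbv beta in K.
    assert (g a + (X a - 2) ^ 2 / 2 + 2 * e * X a <= g b + (X b - 2) ^ 2 / 2 + 2 * e * X b); [|lra].
    apply K.
    + intros s Hs. apply (is_derive_plus (fun s => g s + (X s - 2) ^ 2 / 2) (fun s => 2 * e * X s));
        [apply HH; assumption|]. apply is_derive_scal. apply HX; assumption.
    + intros s Hs. assert (Q := Hb s Hs). apply Rabs_le_between in Q. lra.
  - assert (K := deriv_nonneg_le (fun s => 2 * e * X s - (g s + (X s - 2) ^ 2 / 2))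
      (fun s => 2 * e * g s - g s * X s * (1 - th s)) a b Hab).
    cbv beta in K.
    assert (2 * e * X a - (g a + (X a - 2) ^ 2 / 2) <= 2 * e * X b - (g b + (X b - 2) ^ 2 / 2)); [|lra].
    apply K.
    + intros s Hs. apply (is_derive_minus (fun s => 2 * e * X s) (fun s => g s + (X s - 2) ^ 2 / 2));
        [|apply HH; assumption]. apply is_derive_scal. apply HX; assumption.
    + intros s Hs. assert (Q := Hb s Hs). apply Rabs_le_between in Q. lra.
Qed.

Lemma deriv_ln_pos (g : R -> R) (s l : R) : 0 < g s -> is_derive g s l ->
  is_derive (fun t => ln (g t)) s (l / g s).
Proof.
  intros Hp Hd. auto_derive; [split; [eexists; exact Hd|auto]|].
  rewrite (is_derive_unique (fun x : R => g x) _ _ Hd). field; lra.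
Qed.

(** Starting near [X = 2 - al] with [ln g >= - A], [X] cannot stay below 2 for a time [L]. If
    [X <= 2 - al / 2] until [2 / al] before the end, then [ln g] grows at rate [al / 4] and exceeds
    the bound given by the energy. Otherwise [X] lies between [2 - al / 2] and 2 on the last
    stretch, where the energy forces [g >= al^2 / 4], and [X] rises by [al / 2] to 2. *)
Lemma bubble_escape (X g th : R -> R) (al e A b L : R) :
  0 < al <= 2 -> 0 <= e <= al ^ 2 / 64 -> 2 / al <= L ->
  (forall s, b <= s <= b + L -> is_derive X s (g s)) ->
  (forall s, b <= s <= b + L -> is_derive g s (g s * (2 - X s * th s))) ->
  (forall s, b <= s <= b + L -> 0 < g s) ->
  (forall s, b <= s <= b + L -> 0 <= X s < 2 /\ Rabs (th s - 1) <= e) ->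
  Rabs (X b - (2 - al)) <= e -> g b <= e -> - A <= ln (g b) ->
  2 < al / 4 * (L - 2 / al) - A -> False.
Proof.
  intros Hal He HL HX Hg Hg0 Hth HXb Hgb HA Hbig.
  assert (Ha2 : 0 < 2 / al) by (apply Rdiv_lt_0_compat; lra).
  assert (Hen : forall s, b <= s <= b + L ->
    Rabs ((g s + (X s - 2) ^ 2 / 2) - (g b + (X b - 2) ^ 2 / 2)) <= 4 * e).
  { intros s Hs.
    apply Rle_trans with (2 * e * (X s - X b)).
    - apply (bubble_energy X g th e b s); try lra; intros t Ht.
      + apply HX; lra.
      + apply Hg; lra.
      + left; apply Hg0; lra.
      + destruct (Hth t) as [K1 K2]; [lra|]. split; lra.
    - destruct (Hth s Hs) as [K1 _]. destruct (Hth b) as [K2 _]; [lra|].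
      assert (e * (X s - X b) <= e * 2) by (apply Rmult_le_compat_l; lra). lra. }
  apply Rabs_le_between in HXb.
  assert (Hgb0 := Hg0 b ltac:(lra)).
  assert (Hal2 : al ^ 2 <= 2 * al) by nra.
  assert (Hsq1 : al ^ 2 / 2 - 2 * e <= (X b - 2) ^ 2 / 2).
  { assert ((al - e) ^ 2 <= (2 - X b) ^ 2) by (apply pow_incr; lra). nra. }
  assert (Hsq2 : (X b - 2) ^ 2 / 2 <= al ^ 2 / 2 + 3 * e).
  { assert ((2 - X b) ^ 2 <= (al + e) ^ 2) by (apply pow_incr; lra). nra. }
  assert (Hlow : forall s, b <= s <= b + L -> al ^ 2 / 2 - 6 * e - (X s - 2) ^ 2 / 2 <= g s).
  { intros s Hs. assert (K := Hen s Hs). apply Rabs_le_between in K. lra. }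
  (* The energy at [b] plus its later change is at most [al^2 / 2 + 8 e], which is below
     [3 <= exp 2]. *)
  assert (Hup : forall s, b <= s <= b + L -> ln (g s) <= 2).
  { intros s Hs. assert (K := Hen s Hs). apply Rabs_le_between in K.
    assert (0 <= (X s - 2) ^ 2) by apply pow2_ge_0.
    assert (Hgs := Hg0 s Hs).
    assert (K2 := exp_ineq1_le 2).
    apply Rle_trans with (ln (exp 2)); [|rewrite ln_exp; lra].
    destruct (Rle_lt_or_eq_dec (g s) (exp 2)) as [K3|K3]; [lra| |].
    - left; apply ln_increasing; assumption.
    - rewrite K3; lra. }
  (* The reserved length [2 / al] is the time in which a derivative [al^2 / 4] raises [X] by
     [al / 2]. *)
  set (m := b + (L - 2 / al)).
  assert (Hm : b <= m <= b + L) by (unfold m; lra).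
  assert (Hmono : forall s t, b <= s <= t -> t <= b + L -> X s <= X t).
  { intros s t Hs Ht. apply (deriv_nonneg_le X g); [lra| |]; intros x Hx;
      [apply HX|left; apply Hg0]; lra. }
  destruct (Rle_or_lt (X m) (2 - al / 2)) as [HXm|HXm].
  - assert (K := deriv_ge_le (fun s => ln (g s)) (fun s => 2 - X s * th s) (al / 4) b m).
    cbv beta in K.
    assert (al / 4 * (m - b) <= ln (g m) - ln (g b)).
    { apply K; [lra| |].
      - intros s Hs. assert (Hgs := Hg0 s ltac:(lra)).
        replace (2 - X s * th s) with (g s * (2 - X s * th s) / g s) by (field; lra).
        apply deriv_ln_pos; [lra|]. apply Hg; lra.
      - intros s Hs. destruct (Hth s) as [K1 K2]; [lra|].
        assert (K3 : X s <= 2 - al / 2).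
        { eapply Rle_trans; [|exact HXm]. apply Hmono; lra. }
        apply Rabs_le_between in K2. nra. }
    assert (Hm2 := Hup m Hm). replace (m - b) with (L - 2 / al) in H by (unfold m; ring).
    lra.
  - assert (K := deriv_ge_le X g (al ^ 2 / 4) m (b + L)).
    assert (Hc : al ^ 2 / 4 * (b + L - m) <= X (b + L) - X m).
    { apply K; [lra| |].
      - intros s Hs. apply HX; lra.
      - intros s Hs. destruct (Hth s) as [K1 K2]; [lra|].
        assert (K3 : X m <= X s) by (apply Hmono; lra).
        assert (K4 := Hlow s ltac:(lra)). nra. }
    replace (b + L - m) with (2 / al) in Hc by (unfold m; ring).
    replace (al ^ 2 / 4 * (2 / al)) with (al / 2) in Hc by (field; lra).
    destruct (Hth (b + L)) as [K1 _]; lra.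
Qed.

(** Putting the inhomogeneity into [N = d^2 + d1^2 + eta^2] gives [|N'| <= (L + 2) N] with no
    additive term, so [N] times an exponential is monotone. Both directions of time are needed
    because [t0] lies inside the interval. *)
Lemma gronwall_second_order (d d1 d2 : R -> R) (L eta a b t0 : R) :
  0 <= L -> a <= t0 <= b ->
  (forall t, a <= t <= b -> is_derive d t (d1 t)) ->
  (forall t, a <= t <= b -> is_derive d1 t (d2 t)) ->
  (forall t, a <= t <= b -> Rabs (d2 t) <= L * Rabs (d t) + eta) ->
  forall t, a <= t <= b ->
    d t ^ 2 + d1 t ^ 2 + eta ^ 2 <=
    (d t0 ^ 2 + d1 t0 ^ 2 + eta ^ 2) * exp ((L + 2) * (b - a)).
Proof.
  intros HL Ht0 Hd Hd1 Hd2 t Ht.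
  set (N := fun t => d t ^ 2 + d1 t ^ 2 + eta ^ 2).
  set (N' := fun t => 2 * d t * d1 t + 2 * d1 t * d2 t).
  assert (HN : forall s, a <= s <= b -> is_derive N s (N' s)).
  { intros s Hs. assert (K1 := Hd s Hs). assert (K2 := Hd1 s Hs). unfold N, N'.
    auto_derive; [repeat split; eexists; eassumption|].
    rewrite (is_derive_unique (fun x : R => d x) _ _ K1), (is_derive_unique (fun x : R => d1 x) _ _ K2). ring. }
  assert (HN0 : forall s, 0 <= N s) by (intros s; unfold N; nra).
  assert (HNb : forall s, a <= s <= b -> Rabs (N' s) <= (L + 2) * N s).
  { intros s Hs. assert (K := Hd2 s Hs). unfold N', N.
    apply Rle_trans with (2 * Rabs (d s) * Rabs (d1 s) + 2 * Rabs (d1 s) * Rabs (d2 s)).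
    - eapply Rle_trans; [apply Rabs_triang|].
      rewrite !Rabs_mult, (Rabs_pos_eq 2) by lra. lra.
    - rewrite <- (pow2_abs (d s)), <- (pow2_abs (d1 s)).
      assert (P1 := Rabs_pos (d s)). assert (P2 := Rabs_pos (d1 s)). assert (P3 := Rabs_pos (d2 s)).
      set (x := Rabs (d s)) in *. set (y := Rabs (d1 s)) in *. set (z := Rabs (d2 s)) in *.
      assert (0 <= (x - y) ^ 2) by apply pow2_ge_0.
      assert (0 <= (y - eta) ^ 2) by apply pow2_ge_0.
      assert (0 <= eta ^ 2) by apply pow2_ge_0. nra. }
  assert (HE : forall x, 0 <= x <= b - a -> exp ((L + 2) * x) <= exp ((L + 2) * (b - a))).
  { intros x Hx.
    assert ((L + 2) * x <= (L + 2) * (b - a)) by (apply Rmult_le_compat_l; lra).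
    destruct (Rle_lt_or_eq_dec _ _ H) as [K|K]; [left; apply exp_increasing; exact K|rewrite K; lra]. }
  assert (Hprod : forall c s, a <= s <= b ->
    is_derive (fun s => N s * exp (c * s)) s ((N' s + c * N s) * exp (c * s))).
  { intros c s Hs. assert (K := HN s Hs). auto_derive; [eexists; exact K|].
    rewrite (is_derive_unique (fun x : R => N x) _ _ K). ring. }
  change (N t <= N t0 * exp ((L + 2) * (b - a))).
  destruct (Rle_or_lt t0 t) as [Hc|Hc].
  - assert (K := deriv_le_ge _ _ 0 t0 t Hc (fun s Hs => Hprod (- (L + 2)) s ltac:(lra))).
    cbv beta in K.
    assert (K1 : N t * exp (- (L + 2) * t) <= N t0 * exp (- (L + 2) * t0)).
    { apply Rminus_le. replace 0 with (0 * (t - t0)) by ring. apply K.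
      intros s Hs. assert (Q := HNb s ltac:(lra)). apply Rabs_le_between in Q.
      assert (Q2 := exp_pos (- (L + 2) * s)). nra. }
    assert (E : N t = N t * exp (- (L + 2) * t) * exp ((L + 2) * t)).
    { rewrite Rmult_assoc, <- exp_plus. replace (- (L + 2) * t + (L + 2) * t) with 0 by ring.
      rewrite exp_0; ring. }
    rewrite E. apply Rle_trans with (N t0 * exp (- (L + 2) * t0) * exp ((L + 2) * t)).
    + apply Rmult_le_compat_r; [left; apply exp_pos|exact K1].
    + rewrite Rmult_assoc, <- exp_plus. apply Rmult_le_compat_l; [apply HN0|].
      replace (- (L + 2) * t0 + (L + 2) * t) with ((L + 2) * (t - t0)) by ring. apply HE; lra.
  - assert (K := deriv_nonneg_le _ _ t t0 ltac:(lra) (fun s Hs => Hprod (L + 2) s ltac:(lra))).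
    cbv beta in K.
    assert (K1 : N t * exp ((L + 2) * t) <= N t0 * exp ((L + 2) * t0)).
    { apply K. intros s Hs. assert (Q := HNb s ltac:(lra)). apply Rabs_le_between in Q.
      assert (Q2 := exp_pos ((L + 2) * s)). nra. }
    assert (E : N t = N t * exp ((L + 2) * t) * exp (- (L + 2) * t)).
    { rewrite Rmult_assoc, <- exp_plus. replace ((L + 2) * t + - (L + 2) * t) with 0 by ring.
      rewrite exp_0; ring. }
    rewrite E. apply Rle_trans with (N t0 * exp ((L + 2) * t0) * exp (- (L + 2) * t)).
    + apply Rmult_le_compat_r; [left; apply exp_pos|exact K1].
    + rewrite Rmult_assoc, <- exp_plus. apply Rmult_le_compat_l; [apply HN0|].
      replace ((L + 2) * t0 + - (L + 2) * t) with ((L + 2) * (t0 - t)) by ring. apply HE; lra.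
Qed.

Lemma exp_le (x y : R) : x <= y -> exp x <= exp y.
Proof.
  intros H. destruct (Rle_lt_or_eq_dec _ _ H) as [K|K];
    [left; apply exp_increasing; exact K|rewrite K; lra].
Qed.

Lemma exp_lipschitz (B x y : R) : x <= B -> y <= B ->
  Rabs (exp x - exp y) <= exp B * Rabs (x - y).
Proof.
  assert (H : forall x y, y <= x -> x <= B -> Rabs (exp x - exp y) <= exp B * Rabs (x - y)).
  { clear x y. intros x y Hyx Hx.
    assert (K := exp_ineq1_le (y - x)).
    assert (E : exp y = exp x * exp (y - x)) by (rewrite <- exp_plus; f_equal; ring).
    assert (K2 := exp_pos x). assert (K3 := exp_le x B Hx). assert (K4 := exp_le y x Hyx).
    rewrite !Rabs_pos_eq by lra.
    nra. }
  intros Hx Hy. destruct (Rle_or_lt y x).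
  - apply H; assumption.
  - rewrite (Rabs_minus_sym (exp x)), (Rabs_minus_sym x). apply H; lra.
Qed.

(** The a priori bound [B] makes [y -> exp (2 t + y)] Lipschitz with constant [L], and Gronwall
    applies to [y - Y]. Since [eta] depends on [T], [B] and [eps] only, it can be fixed before the
    solution and before the base point [t0], both of which vary with [n]. *)
Lemma liouville_stability (T B eps : R) : 0 < T -> 0 < eps ->
  exists eta, 0 < eta /\ forall (y y1 y2 Y Y1 Y2 : R -> R) (t0 : R),
  - T <= t0 <= T ->
  (forall t, - T <= t <= T ->
     is_derive y t (y1 t) /\ is_derive y1 t (y2 t) /\ Rabs (y t) <= B /\
     Rabs (y2 t + exp (2 * t + y t)) <= eta) ->
  (forall t, - T <= t <= T ->
     is_derive Y t (Y1 t) /\ is_derive Y1 t (Y2 t) /\ Rabs (Y t) <= B /\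
     Y2 t = - exp (2 * t + Y t)) ->
  Rabs (y t0 - Y t0) <= eta -> Rabs (y1 t0 - Y1 t0) <= eta ->
  forall t, - T <= t <= T ->
    Rabs (y t - Y t) <= eps /\ Rabs (y1 t - Y1 t) <= eps /\ Rabs (y2 t - Y2 t) <= eps.
Proof.
  intros HT He.
  set (L := exp (2 * T + B)). assert (HL : 0 < L) by apply exp_pos.
  (* On an interval of length [2 T] the Gronwall factor is [(C / 2)^2]; the factor 2 absorbs the sum
     of three terms of size [eta^2]. *)
  set (C := 2 * exp ((L + 2) * T)).
  assert (HC : 2 <= C).
  { unfold C. assert (K := exp_ineq1_le ((L + 2) * T)).
    assert (0 <= (L + 2) * T) by (apply Rmult_le_pos; lra). lra. }
  (* Values and first derivatives will differ by at most [eta C], second derivatives by at most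
     [L eta C + eta]. *)
  set (eta := eps / (1 + (L + 1) * C)).
  assert (Hden : 0 < 1 + (L + 1) * C) by nra.
  assert (Heta : 0 < eta) by (apply Rdiv_lt_0_compat; lra).
  assert (Hee : eta * (1 + (L + 1) * C) = eps) by (unfold eta; field; lra).
  exists eta; split; [exact Heta|].
  intros y y1 y2 Y Y1 Y2 t0 Ht0 Hy HY H0 H1 t Ht.
  assert (H2 : forall t, - T <= t <= T -> Rabs (y2 t - Y2 t) <= L * Rabs (y t - Y t) + eta).
  { intros s Hs. destruct (Hy s Hs) as (_ & _ & B1 & B2). destruct (HY s Hs) as (_ & _ & B3 & B4).
    rewrite B4.
    replace (y2 s - - exp (2 * s + Y s)) with
      ((y2 s + exp (2 * s + y s)) + (exp (2 * s + Y s) - exp (2 * s + y s))) by ring.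
    eapply Rle_trans; [apply Rabs_triang|].
    apply Rabs_le_between in B1. apply Rabs_le_between in B3.
    assert (K := exp_lipschitz (2 * T + B) (2 * s + Y s) (2 * s + y s) ltac:(lra) ltac:(lra)).
    replace (2 * s + Y s - (2 * s + y s)) with (- (y s - Y s)) in K by ring.
    rewrite Rabs_Ropp in K. fold L in K. lra. }
  assert (G := gronwall_second_order (fun t => y t - Y t) (fun t => y1 t - Y1 t)
     (fun t => y2 t - Y2 t) L eta (- T) T t0 ltac:(lra) Ht0).
  cbv beta in G. specialize (G
    (fun s Hs => is_derive_minus y Y s _ _ (proj1 (Hy s Hs)) (proj1 (HY s Hs)))
    (fun s Hs => is_derive_minus y1 Y1 s _ _ (proj1 (proj2 (Hy s Hs))) (proj1 (proj2 (HY s Hs))))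
    H2 t Ht).
  replace ((L + 2) * (T - - T)) with ((L + 2) * T + (L + 2) * T) in G by ring.
  rewrite exp_plus in G.
  assert (HeC : exp ((L + 2) * T) = C / 2) by (unfold C; field).
  rewrite HeC in G.
  assert (Q0 : (y t0 - Y t0) ^ 2 <= eta ^ 2).
  { rewrite <- (pow2_abs (y t0 - Y t0)). apply pow_incr. split; [apply Rabs_pos|exact H0]. }
  assert (Q1 : (y1 t0 - Y1 t0) ^ 2 <= eta ^ 2).
  { rewrite <- (pow2_abs (y1 t0 - Y1 t0)). apply pow_incr. split; [apply Rabs_pos|exact H1]. }
  assert (HN : (y t - Y t) ^ 2 + (y1 t - Y1 t) ^ 2 + eta ^ 2 <= (eta * C) ^ 2).
  { eapply Rle_trans; [exact G|].
    apply Rle_trans with (3 * eta ^ 2 * (C / 2 * (C / 2))); [apply Rmult_le_compat_r; nra|].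
    assert (0 <= eta ^ 2 * C ^ 2) by (apply Rmult_le_pos; apply pow2_ge_0). nra. }
  assert (P0 : 0 <= eta * C) by nra.
  assert (R0 : Rabs (y t - Y t) <= eta * C).
  { rewrite <- (Rabs_pos_eq (eta * C)) by exact P0. apply Rsqr_le_abs_0. unfold Rsqr.
    assert (0 <= (y1 t - Y1 t) ^ 2) by apply pow2_ge_0. nra. }
  assert (R1 : Rabs (y1 t - Y1 t) <= eta * C).
  { rewrite <- (Rabs_pos_eq (eta * C)) by exact P0. apply Rsqr_le_abs_0. unfold Rsqr.
    assert (0 <= (y t - Y t) ^ 2) by apply pow2_ge_0. nra. }
  assert (R2 := H2 t Ht).
  assert (eta * C <= eps) by nra.
  split; [lra|]; split; [lra|].
  assert (L * Rabs (y t - Y t) <= L * (eta * C)) by (apply Rmult_le_compat_l; lra). nra.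
Qed.

(** [log_profile a t] is [z_k(e^t)] for [a = a_k], and [log_profile_coef] is [b_k]. The first
    derivative is [r z_k'(r)] at [r = e^t], running from [- (2 - a)] to [- (2 + a)], and the
    Liouville equation becomes [Y'' = - exp (2 t + Y)]. *)
Definition log_profile_coef (a : R) : R := Rpower (sqrt 2 / a) a.
Definition log_profile (a t : R) : R :=
  ln (2 * a ^ 2 * log_profile_coef a) - (2 - a) * t
  - 2 * ln (1 + log_profile_coef a * exp (a * t)).
Definition log_profile' (a t : R) : R :=
  - (2 - a) - 2 * a * (log_profile_coef a * exp (a * t))
                / (1 + log_profile_coef a * exp (a * t)).
Definition log_profile'' (a t : R) : R :=
  - (2 * a ^ 2 * (log_profile_coef a * exp (a * t)))
      / (1 + log_profile_coef a * exp (a * t)) ^ 2.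

Lemma log_profile_coef_pos (a : R) : 0 < log_profile_coef a.
Proof. apply Rpower_pos. Qed.

Lemma is_derive_log_profile (a t : R) : is_derive (log_profile a) t (log_profile' a t).
Proof.
  assert (Hb := log_profile_coef_pos a). unfold log_profile, log_profile'.
  set (b := log_profile_coef a) in *. assert (He := exp_pos (a * t)).
  assert (0 < b * exp (a * t)) by (apply Rmult_lt_0_compat; assumption).
  auto_derive; [lra|]. field. lra.
Qed.

Lemma is_derive_log_profile' (a t : R) : is_derive (log_profile' a) t (log_profile'' a t).
Proof.
  assert (Hb := log_profile_coef_pos a). unfold log_profile'', log_profile'.
  set (b := log_profile_coef a) in *. assert (He := exp_pos (a * t)).
  assert (0 < b * exp (a * t)) by (apply Rmult_lt_0_compat; assumption).
  auto_derive; [lra|]. field. lra.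
Qed.

Lemma exp_log_profile (a t : R) : 0 < a ->
  exp (2 * t + log_profile a t) =
  2 * a ^ 2 * (log_profile_coef a * exp (a * t)) / (1 + log_profile_coef a * exp (a * t)) ^ 2.
Proof.
  intros Ha.
  assert (Hb := log_profile_coef_pos a). unfold log_profile.
  set (b := log_profile_coef a) in *. assert (He := exp_pos (a * t)).
  assert (Hbe : 0 < b * exp (a * t)) by (apply Rmult_lt_0_compat; assumption).
  assert (Hab : 0 < 2 * a ^ 2 * b) by (apply Rmult_lt_0_compat; nra).
  replace (2 * t + (ln (2 * a ^ 2 * b) - (2 - a) * t - 2 * ln (1 + b * exp (a * t))))
    with (ln (2 * a ^ 2 * b) + a * t + - ln (1 + b * exp (a * t)) + - ln (1 + b * exp (a * t))) by ring.
  rewrite !exp_plus, exp_Ropp, !exp_ln by lra. field. lra.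
Qed.

Lemma log_profile''_eq (a t : R) : 0 < a ->
  log_profile'' a t = - exp (2 * t + log_profile a t).
Proof. intros Ha. rewrite exp_log_profile by exact Ha. unfold log_profile''. unfold Rdiv. ring. Qed.

Lemma sqrt2_div_pos (a : R) : 0 < a -> 0 < a / sqrt 2.
Proof. intros Ha. apply Rdiv_lt_0_compat; [exact Ha|apply sqrt_lt_R0; lra]. Qed.

(** This explains the value of [b_k]: [b_k r^a = 1] at [r = a / sqrt 2]. There the profile has value
    0 and logarithmic slope [- 2], the counterpart of [X = 2]. *)
Lemma log_profile_center (a : R) : 0 < a ->
  log_profile_coef a * exp (a * ln (a / sqrt 2)) = 1.
Proof.
  intros Ha. assert (Hs : 0 < sqrt 2) by (apply sqrt_lt_R0; lra).
  unfold log_profile_coef, Rpower. rewrite <- exp_plus, <- exp_0. f_equal.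
  rewrite !Rcomplements.ln_div by assumption. ring.
Qed.

Lemma log_profile_at_center (a : R) : 0 < a -> log_profile a (ln (a / sqrt 2)) = 0.
Proof.
  intros Ha. assert (Hs : 0 < sqrt 2) by (apply sqrt_lt_R0; lra).
  assert (K := exp_log_profile a (ln (a / sqrt 2)) Ha).
  rewrite log_profile_center in K by exact Ha.
  assert (E : exp (2 * ln (a / sqrt 2)) = a ^ 2 / 2).
  { replace (2 * ln (a / sqrt 2)) with (ln (a / sqrt 2) + ln (a / sqrt 2)) by ring.
    rewrite exp_plus, exp_ln by (apply sqrt2_div_pos; exact Ha).
    replace 2 with (sqrt 2 * sqrt 2) at 3 by (apply sqrt_sqrt; lra). field. lra. }
  rewrite exp_plus, E in K.
  apply exp_inv. rewrite exp_0. apply Rmult_eq_reg_l with (a ^ 2 / 2); [|nra].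
  rewrite K. field.
Qed.

Lemma log_profile'_at_center (a : R) : 0 < a -> log_profile' a (ln (a / sqrt 2)) = - 2.
Proof. intros Ha. unfold log_profile'. rewrite log_profile_center by exact Ha. field. Qed.

Lemma profile_log (a x : R) : 0 < a -> 0 < x -> profile a x = log_profile a (ln x).
Proof.
  intros Ha Hx. assert (Hs : 0 < sqrt 2) by (apply sqrt_lt_R0; lra).
  unfold profile. rewrite !rpow_pos_eq by (assumption || (apply Rdiv_lt_0_compat; assumption)).
  fold (log_profile_coef a). unfold log_profile. assert (Hb := log_profile_coef_pos a).
  set (b := log_profile_coef a) in *.
  change (exp (a * ln x)) with (Rpower x a).
  assert (H1 := Rpower_pos x a). assert (H2 := Rpower_pos x (2 - a)).
  assert (H3 : 0 < b * Rpower x a) by (apply Rmult_lt_0_compat; assumption).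
  assert (0 < 2 * a ^ 2 * b) by (apply Rmult_lt_0_compat; nra).
  rewrite Rcomplements.ln_div; [|assumption|apply Rmult_lt_0_compat; [assumption|apply pow_lt; lra]].
  rewrite (ln_mult (Rpower x (2 - a))); [|assumption|apply pow_lt; lra].
  replace (ln ((1 + b * Rpower x a) ^ 2)) with (2 * ln (1 + b * Rpower x a)).
  2:{ replace ((1 + b * Rpower x a) ^ 2) with ((1 + b * Rpower x a) * (1 + b * Rpower x a)) by ring.
      rewrite ln_mult by lra. ring. }
  unfold Rpower at 1. rewrite ln_exp. ring.
Qed.

(** For each [m] let [N m] be an index from which tolerance [1 / (m + 1)] can be met. At index [n]
    one takes a candidate for the finest tolerance with [m <= n] and [N m <= n]; by monotonicity in
    the tolerance it also meets the coarser ones. [base] supplies a value at the indices where no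
    tolerance is available yet, so the sequence is defined for every [n]. *)
Lemma diagonal_choice {A : Type} (base : nat -> A -> Prop) (good : nat -> R -> A -> Prop) :
  (forall n, exists x, base n x) ->
  (forall n e e' x, 0 < e <= e' -> good n e x -> good n e' x) ->
  (forall e, 0 < e -> eventually (fun n => exists x, base n x /\ good n e x)) ->
  exists x : nat -> A, (forall n, base n (x n)) /\
    forall e, 0 < e -> eventually (fun n => good n e (x n)).
Proof.
  intros Hbase Hmon Hgood.
  assert (Hpos : forall m, 0 < / INR (S m)) by (intros m; apply Rinv_0_lt_compat, lt_0_INR; lia).
  assert (HN := fun m => Hgood (/ INR (S m)) (Hpos m)).
  destruct (functional_choice (fun m N => forall n, (N <= n)%nat ->
     exists x, base n x /\ good n (/ INR (S m)) x) HN) as [N HNm].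
  (* Induction on [b] finds the last admissible [m <= b] without comparing the [N m] with each
     other. *)
  assert (Hb : forall n b, exists x, base n x /\
    forall m, (m <= b)%nat -> (N m <= n)%nat -> good n (/ INR (S m)) x).
  { intros n b. induction b as [|b IH].
    - destruct (Compare_dec.le_dec (N 0%nat) n) as [H|H].
      + destruct (HNm _ _ H) as (x & B & G). exists x; split; [exact B|].
        intros m Hm _. replace m with 0%nat by lia. exact G.
      + destruct (Hbase n) as [x B]. exists x; split; [exact B|].
        intros m Hm K. replace m with 0%nat in K by lia. contradiction.
    - destruct (Compare_dec.le_dec (N (S b)) n) as [H|H].
      + destruct (HNm _ _ H) as (x & B & G). exists x; split; [exact B|].
        intros m Hm _. apply Hmon with (/ INR (S (S b))); [|exact G].
        split; [apply Hpos|]. apply Rinv_le_contravar; [apply lt_0_INR; lia|apply le_INR; lia].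
      + destruct IH as (x & B & G). exists x; split; [exact B|].
        intros m Hm K. destruct (Nat.eq_dec m (S b)) as [->|Hne]; [contradiction|].
        apply G; [lia|exact K]. }
  destruct (functional_choice (fun n x => base n x /\
    forall m, (m <= n)%nat -> (N m <= n)%nat -> good n (/ INR (S m)) x) (fun n => Hb n n))
    as [x Hx].
  exists x; split; [intros n; apply Hx|].
  intros e He. destruct (archimed_cor1 e He) as (m & Hm & Hm0).
  exists (max m (N m)). intros n Hn. apply Hmon with (/ INR (S m)).
  - split; [apply Hpos|]. apply Rle_trans with (/ INR m); [|lra].
    apply Rinv_le_contravar; [apply lt_0_INR; lia|apply le_INR; lia].
  - apply Hx; lia.
Qed.

(** * Drift after a concentration *)

Lemma is_lim_seq_eps (u : nat -> R) (l : R) :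
  is_lim_seq u l <-> forall e, 0 < e -> eventually (fun n => Rabs (u n - l) <= e).
Proof.
  split.
  - intros H e He. apply is_lim_seq_spec in H. destruct (H (mkposreal e He)) as [N HN].
    exists N; intros n Hn; left; apply HN; exact Hn.
  - intros H. apply is_lim_seq_spec. intros [e He]. destruct (H (e / 2)) as [N HN]; [lra|].
    exists N; intros n Hn. simpl. specialize (HN n Hn). lra.
Qed.

Lemma lim_eventually_lt (u : nat -> R) (l b : R) :
  is_lim_seq u l -> l < b -> eventually (fun n => u n < b).
Proof.
  intros H Hl. destruct (proj1 (is_lim_seq_eps u l) H ((b - l) / 2)) as [N HN]; [lra|].
  exists N; intros n Hn. specialize (HN n Hn). apply Rabs_le_between in HN. lra.
Qed.

Lemma lim_eventually_gt (u : nat -> R) (l b : R) :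
  is_lim_seq u l -> b < l -> eventually (fun n => b < u n).
Proof.
  intros H Hl. destruct (proj1 (is_lim_seq_eps u l) H ((l - b) / 2)) as [N HN]; [lra|].
  exists N; intros n Hn. specialize (HN n Hn). apply Rabs_le_between in HN. lra.
Qed.

Lemma lim_infty_eventually (u : nat -> R) (b : R) :
  is_lim_seq u p_infty -> eventually (fun n => b < u n).
Proof. intros H. apply is_lim_seq_spec in H. exact (H b). Qed.

Lemma lim_infty_le (u v : nat -> R) :
  is_lim_seq u p_infty -> eventually (fun n => u n <= v n) -> is_lim_seq v p_infty.
Proof. intros H1 H2. exact (is_lim_seq_le_p_loc u v H2 H1). Qed.

Lemma lim_ext_ev (u v : nat -> R) (l : Rbar) :
  eventually (fun n => u n = v n) -> is_lim_seq u l -> is_lim_seq v l.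
Proof. intros H1 H2. exact (is_lim_seq_ext_loc u v l H1 H2). Qed.

Lemma lim_Rpower (u : nat -> R) (l q : R) : 0 < l ->
  is_lim_seq u l -> is_lim_seq (fun n => Rpower (u n) q) (Rpower l q).
Proof.
  intros Hl Hu. apply (is_lim_seq_continuous (fun x => Rpower x q) u l); [|exact Hu].
  apply continuity_pt_filterlim. apply continuous_Rpower, Hl.
Qed.

Lemma lim_mult (u v : nat -> R) (a b : R) : is_lim_seq u a -> is_lim_seq v b ->
  is_lim_seq (fun n => u n * v n) (a * b).
Proof. intros Hu Hv. exact (is_lim_seq_mult' u v a b Hu Hv). Qed.

Lemma lim_div (u v : nat -> R) (a b : R) : b <> 0 -> is_lim_seq u a -> is_lim_seq v b ->
  is_lim_seq (fun n => u n / v n) (a / b).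
Proof.
  intros Hb Hu Hv. apply (is_lim_seq_div u v a b (a / b)); auto.
  - intros E. apply Hb. injection E; auto.
  - unfold is_Rbar_div, is_Rbar_mult; simpl. reflexivity.
Qed.

Lemma lim_scal (c : R) (u : nat -> R) (a : R) : is_lim_seq u a ->
  is_lim_seq (fun n => c * u n) (c * a).
Proof. intros Hu. apply lim_mult; [apply is_lim_seq_const|exact Hu]. Qed.

Lemma lim_minus (u v : nat -> R) (a b : R) : is_lim_seq u a -> is_lim_seq v b ->
  is_lim_seq (fun n => u n - v n) (a - b).
Proof. intros Hu Hv. exact (is_lim_seq_minus' u v a b Hu Hv). Qed.

Lemma lim_plus (u v : nat -> R) (a b : R) : is_lim_seq u a -> is_lim_seq v b ->
  is_lim_seq (fun n => u n + v n) (a + b).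
Proof. intros Hu Hv. exact (is_lim_seq_plus' u v a b Hu Hv). Qed.

Lemma lim_squeeze (u v w : nat -> R) (l : R) :
  eventually (fun n => u n <= v n <= w n) -> is_lim_seq u l -> is_lim_seq w l ->
  is_lim_seq v l.
Proof. intros H Hu Hw. exact (is_lim_seq_le_le_loc u v w l H Hu Hw). Qed.

Lemma lim_Rpower_infty (u : nat -> R) (q : R) : 0 < q ->
  is_lim_seq u p_infty -> is_lim_seq (fun n => Rpower (u n) q) p_infty.
Proof.
  intros Hq Hu. apply is_lim_seq_spec. intros M.
  set (M' := Rmax M 1).
  assert (0 < M') by (unfold M'; assert (K := Rmax_r M 1); lra).
  generalize (lim_infty_eventually u (Rpower M' (/ q)) Hu). apply filter_imp. intros n Hn.
  apply Rle_lt_trans with M'; [apply Rmax_l|].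
  replace M' with (Rpower (Rpower M' (/ q)) q).
  - apply Rlt_Rpower_l; [exact Hq|]. split; [apply Rpower_pos|exact Hn].
  - rewrite Rpower_mult, Rinv_l, Rpower_1 by lra. reflexivity.
Qed.

Lemma log_ratio_bound (p : R) (f : R -> R) (eps : R) : exp_type p f -> 0 < eps -> 0 <= p ->
  exists T, 0 < T /\ (forall t, T <= t -> 0 < f t) /\
  forall x y, T <= x -> T <= y ->
    Rabs (ln (f x) - ln (f y) - (Rpower x p - Rpower y p)) <= eps * Rabs (Rpower x p - Rpower y p).
Proof.
  intros Hf He Hp. destruct (exp_type_log p f eps Hf He) as (T & HT & Hpos & H).
  exists T; split; [exact HT|]; split; [exact Hpos|].
  assert (K : forall x y, T <= y -> y <= x ->
    Rabs (ln (f x) - ln (f y) - (Rpower x p - Rpower y p)) <= eps * Rabs (Rpower x p - Rpower y p)).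
  { intros x y Hy Hxy. destruct (H y x) as [H1 H2]; [lra|].
    assert (Rpower y p <= Rpower x p) by (apply Rpower_incr; lra).
    rewrite (Rabs_pos_eq (Rpower x p - Rpower y p)) by lra.
    apply Rabs_le_between. lra. }
  intros x y Hx Hy. destruct (Rle_or_lt y x) as [Hc|Hc]; [apply K; assumption|].
  rewrite (Rabs_minus_sym (Rpower x p)).
  rewrite <- Rabs_Ropp.
  replace (- (ln (f x) - ln (f y) - (Rpower x p - Rpower y p))) with
    (ln (f y) - ln (f x) - (Rpower y p - Rpower x p)) by ring.
  apply K; lra.
Qed.

Lemma div_mult_cancel (x m : R) : 0 < m -> x / m * m = x.
Proof. intros H; field; lra. Qed.

(** At heights comparable to [mu] the error of replacing [f] by [exp (t^p)] is [o(mu^p)] in the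
    logarithm, so it disappears after division by [mu^p]. *)
Lemma log_ratio_lim (p : R) (f : R -> R) (mu x y : nat -> R) (lx ly : R) :
  0 < p -> exp_type p f -> is_lim_seq mu p_infty -> 0 < lx -> 0 < ly ->
  is_lim_seq (fun n => x n / mu n) lx -> is_lim_seq (fun n => y n / mu n) ly ->
  is_lim_seq (fun n => (ln (f (x n)) - ln (f (y n))) / Rpower (mu n) p)
    (Rpower lx p - Rpower ly p).
Proof.
  intros Hp Hf Hmu Hlx Hly Hx Hy.
  assert (HD : is_lim_seq (fun n => Rpower (x n / mu n) p - Rpower (y n / mu n) p)
                 (Rpower lx p - Rpower ly p)) by (apply lim_minus; apply lim_Rpower; assumption).
  apply is_lim_seq_eps. intros e He.
  set (D := Rabs (Rpower lx p - Rpower ly p) + 1).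
  assert (HDpos : 0 < D) by (unfold D; assert (K := Rabs_pos (Rpower lx p - Rpower ly p)); lra).
  (* [D] eventually bounds the difference of the [p]-th powers divided by [mu^p]; the relative error
     [eps] then costs at most [e / 2]. *)
  set (eps := e / (2 * D)).
  assert (Heps : 0 < eps) by (apply Rdiv_lt_0_compat; lra).
  destruct (log_ratio_bound p f eps Hf Heps) as (T & HT & Hpos & Hlog); [lra|].
  assert (HD1 := proj1 (is_lim_seq_eps _ _) HD (Rmin (e / 2) 1) ltac:(apply Rmin_pos; lra)).
  assert (Hbig : forall z lz, 0 < lz -> is_lim_seq (fun n => z n / mu n) lz ->
    eventually (fun n => T <= z n)).
  { intros z lz Hlz Hz.
    assert (K1 := lim_eventually_gt _ _ (lz / 2) Hz ltac:(lra)).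
    assert (K2 := lim_infty_eventually mu (Rmax 0 (T / (lz / 2))) Hmu).
    generalize (filter_and _ _ K1 K2). apply filter_imp. intros n [A B].
    assert (M0 : 0 < mu n) by (eapply Rle_lt_trans; [apply Rmax_l|exact B]).
    assert (M1 : T / (lz / 2) < mu n) by (eapply Rle_lt_trans; [apply Rmax_r|exact B]).
    rewrite <- (div_mult_cancel (z n) (mu n) M0).
    rewrite <- (div_mult_cancel T (lz / 2)) by lra.
    assert (0 < T / (lz / 2)) by (apply Rdiv_lt_0_compat; lra). nra. }
  assert (B1 := Hbig x lx Hlx Hx). assert (B2 := Hbig y ly Hly Hy).
  assert (B3 := lim_infty_eventually mu 0 Hmu).
  generalize (filter_and _ _ (filter_and _ _ B1 B2) (filter_and _ _ B3 HD1)).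
  apply filter_imp. intros n [[C1 C2] [C3 C4]].
  specialize (Hlog _ _ C1 C2).
  rewrite !Rpower_div in C4 by lra.
  assert (P0 := Rpower_pos (mu n) p).
  set (m := Rpower (mu n) p) in *. set (a := Rpower (x n) p) in *. set (b := Rpower (y n) p) in *.
  set (l := ln (f (x n)) - ln (f (y n))) in *. set (q := Rpower lx p - Rpower ly p) in *.
  replace (a / m - b / m) with ((a - b) / m) in C4 by (field; lra).
  assert (C5 : Rabs ((a - b) / m - q) <= e / 2) by (eapply Rle_trans; [exact C4|apply Rmin_l]).
  assert (C6 : Rabs ((a - b) / m - q) <= 1) by (eapply Rle_trans; [exact C4|apply Rmin_r]).
  assert (C7 : Rabs ((a - b) / m) <= D).
  { unfold D. fold q. replace ((a - b) / m) with (((a - b) / m - q) + q) by ring.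
    eapply Rle_trans; [apply Rabs_triang|]. lra. }
  assert (C8 : Rabs (l / m - (a - b) / m) <= eps * Rabs ((a - b) / m)).
  { replace (l / m - (a - b) / m) with ((l - (a - b)) * / m) by (field; lra).
    unfold Rdiv. rewrite !Rabs_mult, <- Rmult_assoc. apply Rmult_le_compat_r; [apply Rabs_pos|exact Hlog]. }
  assert (C9 : eps * Rabs ((a - b) / m) <= e / 2).
  { apply Rle_trans with (eps * D); [apply Rmult_le_compat_l; lra|].
    unfold eps. right; field; lra. }
  replace (l / m - q) with ((l / m - (a - b) / m) + ((a - b) / m - q)) by ring.
  eapply Rle_trans; [apply Rabs_triang|]. lra.
Qed.

Definition source (f : R -> R) (lam : R) (V : R -> R) (s : R) : R :=
  lam * exp (2 * s) * f (V s).

(* A radial solution in the variable [s = log r]: [V s = u (e^s)] and [V1 s = r u'(r)]. *)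
Record trajectory (f : R -> R) (lam mu : R) (V V1 : R -> R) : Prop := {
  traj_lam : 0 < lam;
  traj_mu : 0 < mu;
  traj_d1 : forall s, s < 0 -> is_derive V s (V1 s);
  traj_d2 : forall s, s < 0 -> is_derive V1 s (- source f lam V s);
  traj_range : forall s, s < 0 -> 0 < V s <= mu;
  traj_decr : forall s, s < 0 -> V1 s <= 0;
  traj_end : forall e, 0 < e -> exists d, d < 0 /\ forall s, d < s < 0 -> V s < e;
  traj_start : forall e, 0 < e -> exists d, d < 0 /\ forall s, s < d -> mu - e < V s
}.

(** Because [u(1) = 0], [V] falls below [m] before time 0. A lower bound on the height, proved only
    as long as time is negative, thus shows that the whole time window lies in the domain. *)
Lemma trajectory_lives (f : R -> R) (lam mu : R) (V V1 : R -> R) (sg tau m : R) :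
  trajectory f lam mu V V1 -> sg < 0 -> 0 < m ->
  (forall s, sg <= s <= tau -> s < 0 -> m <= V s) -> tau < 0.
Proof.
  intros Ht Hs Hm H. destruct (Rlt_or_le tau 0) as [Hc|Hc]; [exact Hc|exfalso].
  destruct (traj_end _ _ _ _ _ Ht m Hm) as (d & Hd & Hv).
  set (s := Rmax sg (d / 2)).
  assert (s < 0) by (apply Rmax_lub_lt; lra).
  assert (sg <= s) by apply Rmax_l.
  assert (d / 2 <= s) by apply Rmax_r.
  assert (K1 := Hv s ltac:(lra)). assert (K2 := H s ltac:(lra) ltac:(lra)). lra.
Qed.

Lemma source_nonneg (f : R -> R) (lam mu : R) (V V1 : R -> R) (s : R) :
  (forall t, 0 <= t -> 0 <= f t) -> trajectory f lam mu V V1 -> s < 0 -> 0 <= source f lam V s.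
Proof.
  intros Hf Ht Hs. unfold source. assert (L := traj_lam _ _ _ _ _ Ht).
  destruct (traj_range _ _ _ _ _ Ht s Hs) as [H1 _].
  apply Rmult_le_pos; [|apply Hf; lra]. apply Rmult_le_pos; [lra|left; apply exp_pos].
Qed.

Lemma trajectory_slope_mono (f : R -> R) (lam mu : R) (V V1 : R -> R) (s t : R) :
  (forall t, 0 <= t -> 0 <= f t) -> trajectory f lam mu V V1 ->
  s <= t < 0 -> V1 t <= V1 s.
Proof.
  intros Hf Ht Hst.
  assert (K := deriv_nonneg_le (fun s => - V1 s) (fun s => source f lam V s) s t).
  cbv beta in K. assert (- V1 s <= - V1 t); [|lra].
  apply K; [lra| |]; intros x Hx.
  - rewrite <- (Ropp_involutive (source f lam V x)). apply (is_derive_opp V1).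
    apply (traj_d2 _ _ _ _ _ Ht). lra.
  - apply source_nonneg with mu V1; auto; lra.
Qed.

Lemma trajectory_mono (f : R -> R) (lam mu : R) (V V1 : R -> R) (s t : R) :
  trajectory f lam mu V V1 -> s <= t < 0 -> V t <= V s.
Proof.
  intros Ht Hst. assert (K := deriv_le_ge V V1 0 s t).
  assert (V t - V s <= 0 * (t - s)); [|lra].
  apply K; [lra| |]; intros x Hx.
  - apply (traj_d1 _ _ _ _ _ Ht); lra.
  - apply (traj_decr _ _ _ _ _ Ht); lra.
Qed.

Lemma Rpower_convex (p x y w : R) : 1 <= p -> 0 < x -> 0 < y -> 0 <= w <= 1 ->
  Rpower ((1 - w) * x + w * y) p <= (1 - w) * Rpower x p + w * Rpower y p.
Proof.
  intros Hp Hx Hy Hw. set (z := (1 - w) * x + w * y).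
  assert (Hz : 0 < z).
  { unfold z. destruct (Rle_or_lt x y); nra. }
  assert (T1 := Rpower_tangent p z x Hp Hz Hx). assert (T2 := Rpower_tangent p z y Hp Hz Hy).
  assert (E : (1 - w) * (Rpower z p + p * Rpower z (p - 1) * (x - z))
    + w * (Rpower z p + p * Rpower z (p - 1) * (y - z)) = Rpower z p).
  { unfold z at 3 6. ring. }
  rewrite <- E. apply Rplus_le_compat; apply Rmult_le_compat_l; lra.
Qed.

(* Below its tangent line at [sg] the solution is so small that, by convexity of
   [x^p], the source decays exponentially up to the time when the tangent line
   would make it large again. *)
Lemma trajectory_drift (p : R) (f : R -> R) (lam mu : R) (V V1 : R -> R) (T eta sg S kap : R) :
  1 <= p -> (forall t, 0 <= t -> 0 <= f t) -> 0 < T -> eta <= 1 ->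
  (forall x, T <= x -> 0 < f x /\ forall t, 0 <= t <= x -> f t <= f x) ->
  (forall x y, T <= x <= y -> (1 - eta) * (Rpower y p - Rpower x p) <= ln (f y) - ln (f x)) ->
  trajectory f lam mu V V1 -> sg < 0 -> 0 < S -> 0 < kap ->
  T <= V sg + V1 sg * S ->
  (2 + kap) * S <= (1 - eta) * (Rpower (V sg) p - Rpower (V sg + V1 sg * S) p) ->
  forall s, sg <= s <= sg + S -> s < 0 ->
    source f lam V s <= source f lam V sg * exp (- kap * (s - sg)) /\
    V1 sg - source f lam V sg / kap <= V1 s /\
    V s <= V sg + V1 sg * (s - sg).
Proof.
  intros Hp Hf0 HT Heta Hdom Hlog Ht Hsg HS Hkap HTe Hend.
  assert (Hlam := traj_lam _ _ _ _ _ Ht).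
  assert (Hslope := traj_decr _ _ _ _ _ Ht sg Hsg).
  assert (HTs : T <= V sg) by nra.
  assert (Htan : forall s, sg <= s < 0 -> V s <= V sg + V1 sg * (s - sg)).
  { intros s Hs. assert (V s - V sg <= V1 sg * (s - sg)); [|lra].
    apply (deriv_le_ge V V1); [lra| |]; intros x Hx.
    - apply (traj_d1 _ _ _ _ _ Ht); lra.
    - apply trajectory_slope_mono with f lam mu V; auto; lra. }
  assert (Hsrc : forall s, sg <= s <= sg + S -> s < 0 ->
    source f lam V s <= source f lam V sg * exp (- kap * (s - sg))).
  { intros s Hs Hs0. set (l := V sg + V1 sg * (s - sg)).
    assert (Hl1 : T <= l).
    { apply Rle_trans with (1 := HTe). unfold l. nra. }
    assert (Hl2 : l <= V sg) by (unfold l; nra).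
    assert (HfV : f (V s) <= f l).
    { apply Hdom; [exact Hl1|]. destruct (traj_range _ _ _ _ _ Ht s Hs0).
      split; [lra|apply Htan; lra]. }
    (* [w] is the fraction of the tangent line already covered. By convexity the [p]-th power along
       the line is below its linear interpolation, so the average loss [2 + kap] per unit time,
       assumed over the whole window, holds up to every intermediate time. *)
    set (w := (s - sg) / S).
    assert (Hw : 0 <= w <= 1).
    { unfold w. split; [apply Rdiv_le_0_compat; lra|]. apply Rmult_le_reg_r with S; [lra|].
      rewrite div_mult_cancel by lra. lra. }
    assert (Hlw : l = (1 - w) * V sg + w * (V sg + V1 sg * S)).
    { unfold l, w. field. lra. }
    assert (Hc : Rpower l p <= (1 - w) * Rpower (V sg) p + w * Rpower (V sg + V1 sg * S) p).
    { rewrite Hlw. apply Rpower_convex; lra. }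
    assert (Hll := Hlog l (V sg) ltac:(lra)).
    assert (HwS : w * S = s - sg) by (unfold w; field; lra).
    assert (Hfin : ln (f l) <= ln (f (V sg)) - (2 + kap) * (s - sg)).
    { assert (w * ((2 + kap) * S) <= w * ((1 - eta) * (Rpower (V sg) p - Rpower (V sg + V1 sg * S) p)))
        by (apply Rmult_le_compat_l; lra).
      assert ((1 - eta) * (w * (Rpower (V sg) p - Rpower (V sg + V1 sg * S) p)) <=
              (1 - eta) * (Rpower (V sg) p - Rpower l p)) by (apply Rmult_le_compat_l; lra).
      replace (w * ((2 + kap) * S)) with ((2 + kap) * (w * S)) in H by ring. rewrite HwS in H. lra. }
    unfold source. destruct (Hdom l Hl1) as [Fl _]. destruct (Hdom (V sg) HTs) as [Fs _].
    apply Rle_trans with (lam * exp (2 * s) * f l).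
    { apply Rmult_le_compat_l; [|exact HfV]. apply Rmult_le_pos; [lra|left; apply exp_pos]. }
    rewrite <- (exp_ln (f l)), <- (exp_ln (f (V sg))) by assumption.
    rewrite !Rmult_assoc. apply Rmult_le_compat_l; [lra|].
    rewrite <- !exp_plus. apply exp_le. lra. }
  intros s Hs Hs0. split; [apply Hsrc; assumption|]. split; [|apply Htan; lra].
  set (E := source f lam V sg).
  (* The total change of slope is at most the integral of [E exp (- kap (t - sg))], hence at most
     [E / kap]. *)
  assert (K := deriv_nonneg_le (fun t => V1 t - E / kap * exp (- kap * (t - sg)))
    (fun t => - source f lam V t + E * exp (- kap * (t - sg))) sg s ltac:(lra)).
  cbv beta in K.
  assert (K2 : V1 sg - E / kap * exp (- kap * (sg - sg)) <= V1 s - E / kap * exp (- kap * (s - sg))).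
  { apply K.
    - intros x Hx.
      replace (- source f lam V x + E * exp (- kap * (x - sg))) with
       (- source f lam V x - (- E * exp (- kap * (x - sg)))) by ring.
      apply (is_derive_minus V1 (fun t => E / kap * exp (- kap * (t - sg)))).
      + apply (traj_d2 _ _ _ _ _ Ht); lra.
      + auto_derive; [auto|]. unfold Rminus; field; lra.
    - intros x Hx. assert (Q := Hsrc x ltac:(lra) ltac:(lra)). unfold E. lra. }
  replace (- kap * (sg - sg)) with 0 in K2 by ring. rewrite exp_0 in K2.
  assert (0 <= E / kap * exp (- kap * (s - sg))).
  { apply Rmult_le_pos; [|left; apply exp_pos]. apply Rdiv_le_0_compat; [|lra].
    apply source_nonneg with mu V1; auto. }
  lra.
Qed.

(** [flux] and [dens] are [P] and [e] of the overview. At [s = log r] the flux is [p mu^(p-1)] times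
    the integral of [lambda f(u) x] over [[0, r]]. *)
Definition flux (p mu : R) (V1 : R -> R) (s : R) : R := - (p * Rpower mu (p - 1) * V1 s).
Definition dens (p : R) (f : R -> R) (lam mu : R) (V : R -> R) (s : R) : R :=
  p * Rpower mu (p - 1) * source f lam V s.

(* The state after a concentration: height [d mu], slope [- A mu^(1-p) / p], and a
   source that is already negligible but not exponentially small in [mu^p]. *)
Record plateau (p : R) (f : R -> R) (lam mu : nat -> R) (V V1 : nat -> R -> R) (d A : R)
  (sg : nat -> R) : Prop := {
  pl_neg : eventually (fun n => sg n < 0);
  pl_height : is_lim_seq (fun n => V n (sg n) / mu n) d;
  pl_flux : is_lim_seq (fun n => flux p (mu n) (V1 n) (sg n)) A;
  pl_dens : is_lim_seq (fun n => dens p f (lam n) (mu n) (V n) (sg n)) 0;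
  pl_log : is_lim_seq (fun n => ln (dens p f (lam n) (mu n) (V n) (sg n)) / Rpower (mu n) p) 0
}.

Lemma lim_scaled_infty (x mu : nat -> R) (l b : R) : 0 < l ->
  is_lim_seq mu p_infty -> is_lim_seq (fun n => x n / mu n) l ->
  eventually (fun n => b < x n).
Proof.
  intros Hl Hmu Hx.
  assert (K1 := lim_eventually_gt _ _ (l / 2) Hx ltac:(lra)).
  assert (K2 := lim_infty_eventually mu (Rmax 0 (b / (l / 2))) Hmu).
  generalize (filter_and _ _ K1 K2). apply filter_imp. intros n [A B].
  assert (M0 : 0 < mu n) by (eapply Rle_lt_trans; [apply Rmax_l|exact B]).
  assert (M1 : b / (l / 2) < mu n) by (eapply Rle_lt_trans; [apply Rmax_r|exact B]).
  rewrite <- (div_mult_cancel (x n) (mu n) M0).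
  rewrite <- (div_mult_cancel b (l / 2)) by lra. nra.
Qed.

Lemma ln_dens (p : R) (f : R -> R) (lam mu : R) (V : R -> R) (s : R) :
  0 < p -> 0 < lam -> 0 < f (V s) ->
  ln (dens p f lam mu V s) = ln p + ln (Rpower mu (p - 1)) + ln lam + 2 * s + ln (f (V s)).
Proof.
  intros Hp Hl Hf. unfold dens, source. assert (K := Rpower_pos mu (p - 1)).
  assert (K2 := exp_pos (2 * s)).
  assert (0 < lam * exp (2 * s)) by (apply Rmult_lt_0_compat; assumption).
  assert (0 < p * Rpower mu (p - 1)) by (apply Rmult_lt_0_compat; assumption).
  assert (0 < lam * exp (2 * s) * f (V s)) by (apply Rmult_lt_0_compat; assumption).
  rewrite !ln_mult by assumption. rewrite ln_exp. ring.
Qed.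

(** Time is counted in units of [mu^p], since heights are of order [mu] and slopes of order
    [mu^(1-p)]. The quantity assumed negative is the exponent of the source at the end of the
    tangent line, divided by [mu^p]. With this sign the source decays exponentially along the way,
    and the slope changes by at most [source / kap], which is negligible because [pl_dens] holds at
    the start. *)
Lemma drift_end (p : R) (f : R -> R) (lam mu : nat -> R) (V V1 : nat -> R -> R)
  (d A : R) (sg : nat -> R) (tau : R) :
  1 <= p -> exp_type p f -> is_lim_seq mu p_infty ->
  (forall n, trajectory f (lam n) (mu n) (V n) (V1 n)) ->
  plateau p f lam mu V V1 d A sg ->
  0 < d -> 0 < tau -> 0 < d - A / p * tau ->
  2 * tau + Rpower (d - A / p * tau) p - Rpower d p < 0 ->
  let s1 n := sg n + tau * Rpower (mu n) p in
  eventually (fun n => s1 n < 0) /\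
  is_lim_seq (fun n => V n (s1 n) / mu n) (d - A / p * tau) /\
  is_lim_seq (fun n => flux p (mu n) (V1 n) (s1 n)) A /\
  is_lim_seq (fun n => dens p f (lam n) (mu n) (V n) (s1 n)) 0 /\
  is_lim_seq (fun n => ln (dens p f (lam n) (mu n) (V n) (s1 n)) / Rpower (mu n) p)
    (2 * tau + Rpower (d - A / p * tau) p - Rpower d p).
Proof.
  intros Hp Hf Hmu Htr Hpl Hd Htau Hdt HPhi s1.
  set (c := A / p) in *.
  set (W := Rpower d p - Rpower (d - c * tau) p).
  (* The margin by which the exponent is negative; the error [eta] in [ln f] and the decay rate
     [kap] spend a quarter of it each. *)
  set (m := W - 2 * tau).
  assert (Hm : 0 < m) by (unfold m, W; lra).
  assert (HW : 0 < W) by (unfold m in Hm; lra).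
  set (eta := m / (4 * W)). set (kap := m / (4 * tau)).
  assert (Heta : 0 < eta) by (apply Rdiv_lt_0_compat; lra).
  assert (Hkap : 0 < kap) by (apply Rdiv_lt_0_compat; lra).
  assert (Heta1 : eta <= 1).
  { unfold eta. apply Rmult_le_reg_r with (4 * W); [lra|]. rewrite div_mult_cancel by lra.
    unfold m. lra. }
  destruct (exp_type_log p f eta Hf Heta) as (T1 & HT1 & Hpos & Hlog).
  destruct (exp_type_dominates p f Hp Hf) as (T2 & HT2 & Hdom).
  set (T := Rmax T1 T2).
  assert (HT1' : T1 <= T) by apply Rmax_l. assert (HT2' : T2 <= T) by apply Rmax_r.
  set (v := fun n => V n (sg n) / mu n).
  set (k := fun n => flux p (mu n) (V1 n) (sg n) / p).
  assert (Lv : is_lim_seq v d) by exact (pl_height _ _ _ _ _ _ _ _ _ Hpl).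
  assert (Lk : is_lim_seq k c).
  { unfold k, c. apply lim_div; [lra|exact (pl_flux _ _ _ _ _ _ _ _ _ Hpl)|apply is_lim_seq_const]. }
  assert (Lvk : is_lim_seq (fun n => v n - k n * tau) (d - c * tau)).
  { apply lim_minus; [exact Lv|]. apply lim_mult; [exact Lk|apply is_lim_seq_const]. }
  set (S := fun n => tau * Rpower (mu n) p).
  assert (Hmu0 := lim_infty_eventually mu 0 Hmu).
  assert (Hline : forall n, 0 < mu n ->
    V n (sg n) + V1 n (sg n) * S n = (v n - k n * tau) * mu n).
  { intros n Hn. unfold v, k, S, flux. rewrite (Rpower_pred (mu n) p Hn). field. lra. }
  assert (Ev1 : eventually (fun n => T < V n (sg n) + V1 n (sg n) * S n)).
  { apply lim_scaled_infty with mu (d - c * tau); [exact Hdt|exact Hmu|].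
    apply lim_ext_ev with (2 := Lvk). revert Hmu0. apply filter_imp. intros n Hn.
    rewrite Hline by exact Hn. field. lra. }
  assert (Ev2 : eventually (fun n =>
    (2 + kap) * S n <= (1 - eta) * (Rpower (V n (sg n)) p - Rpower (V n (sg n) + V1 n (sg n) * S n) p))).
  { assert (L : is_lim_seq (fun n => (1 - eta) * (Rpower (v n) p - Rpower (v n - k n * tau) p))
      ((1 - eta) * W)).
    { apply lim_scal. apply lim_minus; apply lim_Rpower; assumption. }
    assert (G := lim_eventually_gt _ _ ((2 + kap) * tau) L).
    assert (Hlt : (2 + kap) * tau < (1 - eta) * W).
    { replace ((2 + kap) * tau) with (2 * tau + m / 4) by (unfold kap; field; lra).
      replace ((1 - eta) * W) with (W - m / 4) by (unfold eta; field; lra). unfold m in *; lra. }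
    specialize (G Hlt).
    assert (V0 := lim_eventually_gt _ _ 0 Lv ltac:(lra)).
    assert (VK0 := lim_eventually_gt _ _ 0 Lvk ltac:(lra)).
    generalize (filter_and _ _ (filter_and _ _ Hmu0 G) (filter_and _ _ V0 VK0)).
    apply filter_imp. intros n [[N1 N2] [N3 N4]].
    rewrite Hline by exact N1.
    rewrite <- (div_mult_cancel (V n (sg n)) (mu n) N1). fold (v n).
    rewrite <- !Rpower_mult_distr by assumption.
    unfold S. assert (K := Rpower_pos (mu n) p). nra. }
  assert (Ev : eventually (fun n => 0 < mu n /\ sg n < 0 /\
    T < V n (sg n) + V1 n (sg n) * S n /\ 0 < S n /\
    (forall s, sg n <= s <= s1 n -> s < 0 ->
      source f (lam n) (V n) s <= source f (lam n) (V n) (sg n) * exp (- kap * (s - sg n)) /\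
      V1 n (sg n) - source f (lam n) (V n) (sg n) / kap <= V1 n s /\
      V n s <= V n (sg n) + V1 n (sg n) * (s - sg n)))).
  { generalize (filter_and _ _ (filter_and _ _ Hmu0 (pl_neg _ _ _ _ _ _ _ _ _ Hpl)) (filter_and _ _ Ev1 Ev2)).
    apply filter_imp. intros n [[N1 N2] [N3 N4]].
    assert (HS : 0 < S n) by (apply Rmult_lt_0_compat; [exact Htau|apply Rpower_pos]).
    repeat (split; [assumption|]).
    intros s Hs Hs0.
    apply (trajectory_drift p f (lam n) (mu n) (V n) (V1 n) T eta (sg n) (S n) kap); auto; try lra.
    - exact (proj1 Hf).
    - intros x Hx. apply Hdom; lra.
    - intros x y Hxy. apply Hlog; lra. }
  (* The end of the tangent line in units of [mu], lowered by the largest possible change of slope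
     acting during the whole time. *)
  set (low := fun n => v n - k n * tau - dens p f (lam n) (mu n) (V n) (sg n) / (p * kap) * tau).
  assert (Llow : is_lim_seq low (d - c * tau)).
  { unfold low. replace (d - c * tau) with ((d - c * tau) - 0 / (p * kap) * tau) by (unfold Rdiv; ring).
    apply lim_minus; [exact Lvk|]. apply lim_mult; [|apply is_lim_seq_const].
    apply lim_div; [apply Rgt_not_eq; apply Rmult_lt_0_compat; lra|exact (pl_dens _ _ _ _ _ _ _ _ _ Hpl)|apply is_lim_seq_const]. }
  assert (Hlow : eventually (fun n => forall s, sg n <= s <= s1 n -> s < 0 ->
     low n * mu n <= V n s)).
  { revert Ev. apply filter_imp. intros n (N1 & N2 & N3 & N4 & N5) s Hs Hs0.
    assert (Esg := source_nonneg f _ _ _ _ _ (proj1 Hf) (Htr n) N2).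
    set (E := source f (lam n) (V n) (sg n)) in *.
    assert (Hsl := traj_decr _ _ _ _ _ (Htr n) _ N2).
    assert (0 <= E / kap) by (apply Rdiv_le_0_compat; lra).
    assert (D : (V1 n (sg n) - E / kap) * (s - sg n) <= V n s - V n (sg n)).
    { apply (deriv_ge_le (V n) (V1 n)); [lra| |]; intros x Hx.
      - apply (traj_d1 _ _ _ _ _ (Htr n)); lra.
      - apply N5; lra. }
    assert (D2 : (V1 n (sg n) - E / kap) * S n <= (V1 n (sg n) - E / kap) * (s - sg n)).
    { assert (s - sg n <= S n) by (unfold s1 in Hs; unfold S; lra). nra. }
    assert (HE : low n * mu n = V n (sg n) + (V1 n (sg n) - E / kap) * S n).
    { unfold low. rewrite Rmult_minus_distr_r, <- Hline by exact N1.
      unfold dens. fold E.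
      replace (S n) with (tau * (mu n * Rpower (mu n) (p - 1)))
        by (unfold S; rewrite (Rpower_pred (mu n) p N1); ring).
      field. lra. }
    lra. }
  (* The solution cannot reach [r = 1] during the drift, as its height stays above
     [low n * mu n]. *)
  assert (Hneg : eventually (fun n => s1 n < 0)).
  { assert (L0 := lim_eventually_gt _ _ 0 Llow ltac:(lra)).
    generalize (filter_and _ _ L0 (filter_and _ _ Ev Hlow)).
    apply filter_imp. intros n (N0 & (N1 & N2 & _) & N3).
    apply (trajectory_lives f (lam n) (mu n) (V n) (V1 n) (sg n) (s1 n) (low n * mu n)); auto.
    apply Rmult_lt_0_compat; assumption. }
  split; [exact Hneg|].
  assert (Ev3 := filter_and _ _ Hneg (filter_and _ _ Ev Hlow)).
  assert (LV : is_lim_seq (fun n => V n (s1 n) / mu n) (d - c * tau)).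
  { apply lim_squeeze with low (fun n => v n - k n * tau); [|exact Llow|exact Lvk].
    revert Ev3. apply filter_imp. intros n (N0 & (N1 & N2 & N3 & N4 & N5) & N6).
    assert (Hin : sg n <= s1 n <= s1 n) by (unfold s1; unfold S in N4; lra).
    split; apply Rmult_le_reg_r with (mu n); try assumption; rewrite div_mult_cancel by exact N1.
    - apply N6; assumption.
    - rewrite <- Hline by exact N1. destruct (N5 (s1 n) Hin N0) as (_ & _ & Q).
      replace (S n) with (s1 n - sg n) by (unfold s1, S; ring). exact Q. }
  split; [exact LV|].
  split; [|split].
  - apply lim_squeeze with (fun n => flux p (mu n) (V1 n) (sg n))
      (fun n => flux p (mu n) (V1 n) (sg n) + dens p f (lam n) (mu n) (V n) (sg n) / kap).
    + revert Ev3. apply filter_imp. intros n (N0 & (N1 & N2 & N3 & N4 & N5) & N6).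
      assert (Hin : sg n <= s1 n <= s1 n) by (unfold s1; unfold S in N4; lra).
      destruct (N5 (s1 n) Hin N0) as (_ & Q & _).
      assert (Q2 := trajectory_slope_mono f _ _ _ _ (sg n) (s1 n) (proj1 Hf) (Htr n) ltac:(lra)).
      assert (Hpm : 0 < p * Rpower (mu n) (p - 1)) by (apply Rmult_lt_0_compat; [lra|apply Rpower_pos]).
      unfold flux, dens. unfold Rdiv in *.
      split; [apply Ropp_le_contravar; apply Rmult_le_compat_l; lra|].
      apply Rmult_le_compat_l with (r := p * Rpower (mu n) (p - 1)) in Q; [|lra]. lra.
    + exact (pl_flux _ _ _ _ _ _ _ _ _ Hpl).
    + replace A with (A + 0 / kap) at 1 by (unfold Rdiv; ring).
      apply lim_plus; [exact (pl_flux _ _ _ _ _ _ _ _ _ Hpl)|].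
      apply lim_div; [lra|exact (pl_dens _ _ _ _ _ _ _ _ _ Hpl)|apply is_lim_seq_const].
  - apply lim_squeeze with (fun _ => 0) (fun n => dens p f (lam n) (mu n) (V n) (sg n));
      [|apply is_lim_seq_const|exact (pl_dens _ _ _ _ _ _ _ _ _ Hpl)].
    revert Ev3. apply filter_imp. intros n (N0 & (N1 & N2 & N3 & N4 & N5) & N6).
    assert (Hin : sg n <= s1 n <= s1 n) by (unfold s1; unfold S in N4; lra).
    destruct (N5 (s1 n) Hin N0) as (Q & _ & _).
    assert (Hpm : 0 < p * Rpower (mu n) (p - 1)) by (apply Rmult_lt_0_compat; [lra|apply Rpower_pos]).
    assert (E1 := source_nonneg f _ _ _ _ _ (proj1 Hf) (Htr n) N2).
    assert (E2 := source_nonneg f _ _ _ _ _ (proj1 Hf) (Htr n) N0).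
    unfold dens. split; [apply Rmult_le_pos; lra|].
    apply Rmult_le_compat_l; [lra|]. eapply Rle_trans; [exact Q|].
    rewrite <- (Rmult_1_r (source f (lam n) (V n) (sg n))) at 2.
    apply Rmult_le_compat_l; [exact E1|]. rewrite <- exp_0. apply exp_le.
    assert (0 <= kap * (s1 n - sg n)) by (apply Rmult_le_pos; lra). lra.
  (* The exponent at the end: 0 from [pl_log], [2 tau] from the factor [exp (2 s)], and the rest
     from the ratio of the two values of [f]. *)
  - assert (LL := log_ratio_lim p f mu (fun n => V n (s1 n)) (fun n => V n (sg n)) _ _
      ltac:(lra) Hf Hmu Hdt Hd LV Lv).
    assert (LS := lim_plus _ _ _ _ (pl_log _ _ _ _ _ _ _ _ _ Hpl)
      (lim_plus _ _ _ _ (is_lim_seq_const (2 * tau)) LL)).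
    cbv beta in LS.
    replace (0 + (2 * tau + (Rpower (d - c * tau) p - Rpower d p))) with
      (2 * tau + Rpower (d - c * tau) p - Rpower d p) in LS by ring.
    apply lim_ext_ev with (2 := LS).
    assert (B1 := lim_scaled_infty _ _ _ T1 Hdt Hmu LV).
    assert (B2 := lim_scaled_infty _ _ _ T1 Hd Hmu Lv).
    generalize (filter_and _ _ Ev3 (filter_and _ _ B1 B2)).
    apply filter_imp. intros n [(N0 & (N1 & N2 & N3 & N4 & N5) & N6) [N7 N8]].
    assert (Hl := traj_lam _ _ _ _ _ (Htr n)).
    rewrite !ln_dens by (auto; try lra; apply Hpos; lra).
    assert (K := Rpower_pos (mu n) p). unfold s1. field. lra.
Qed.

(** * The next concentration *)

Lemma flux_nonneg (p : R) (f : R -> R) (lam mu : R) (V V1 : R -> R) (s : R) :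
  0 < p -> trajectory f lam mu V V1 -> s < 0 -> 0 <= flux p mu V1 s.
Proof.
  intros Hp Ht Hs. assert (K := traj_decr _ _ _ _ _ Ht s Hs). unfold flux.
  assert (0 < p * Rpower mu (p - 1)) by (apply Rmult_lt_0_compat; [lra|apply Rpower_pos]). nra.
Qed.

Lemma is_derive_flux (p : R) (f : R -> R) (lam mu : R) (V V1 : R -> R) (s : R) :
  trajectory f lam mu V V1 -> s < 0 ->
  is_derive (flux p mu V1) s (dens p f lam mu V s).
Proof.
  intros Ht Hs. unfold flux, dens.
  replace (p * Rpower mu (p - 1) * source f lam V s) with
    (- (p * Rpower mu (p - 1) * - source f lam V s)) by ring.
  apply (is_derive_opp (fun s => p * Rpower mu (p - 1) * V1 s)).
  apply is_derive_scal. apply (traj_d2 _ _ _ _ _ Ht s Hs).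
Qed.

Lemma is_derive_dens (p : R) (f : R -> R) (lam mu : R) (V V1 : R -> R) (s : R) :
  trajectory f lam mu V V1 -> s < 0 -> 0 < f (V s) -> ex_derive f (V s) ->
  is_derive (dens p f lam mu V) s (dens p f lam mu V s * (2 + log_deriv f (V s) * V1 s)).
Proof.
  intros Ht Hs Hf Hd. unfold dens, source.
  assert (K := traj_d1 _ _ _ _ _ Ht s Hs).
  assert (Kc : is_derive (fun s => f (V s)) s (V1 s * Derive f (V s))).
  { apply (is_derive_comp f V); [apply Derive_correct; exact Hd|exact K]. }
  assert (Ke : is_derive (fun s => lam * exp (2 * s)) s (lam * (2 * exp (2 * s)))).
  { auto_derive; [auto|ring]. }
  assert (Km := is_derive_mult _ _ _ _ _ Ke Kc ltac:(intros; apply Rmult_comm)).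
  assert (Ks := is_derive_scal _ _ (p * Rpower mu (p - 1)) _ Km).
  evar_last; [exact Ks|].
  unfold log_deriv. simpl. unfold plus, mult; simpl. unfold mult; simpl. field. lra.
Qed.

Lemma IVT_le (X : R -> R) (a b y : R) : a <= b ->
  (forall s, a <= s <= b -> continuity_pt X s) -> X a < y -> y <= X b ->
  exists s, a <= s <= b /\ X s = y.
Proof.
  intros Hab Hc Ha Hb. destruct (Rle_lt_or_eq_dec _ _ Hb) as [Hlt|Heq].
  - destruct (Ranalysis5.IVT_interv (fun s => X s - y) a b) as [z [Hz1 Hz2]].
    + intros s Hs. apply continuity_pt_minus; [apply Hc; exact Hs|].
      apply continuity_pt_const. intros u v; reflexivity.
    + destruct (Rle_lt_or_eq_dec _ _ Hab) as [H|H]; [exact H|]. subst. lra.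
    + lra.
    + lra.
    + exists z; split; [exact Hz1|lra].
  - exists b; split; [lra|congruence].
Qed.

(* [d'] is the height at which the exponent of the source, negligible since the
   previous concentration, returns to zero. *)
Lemma bubble_exists (p : R) (f : R -> R) (lam mu : nat -> R) (V V1 : nat -> R -> R)
  (d A d' a' : R) (sg : nat -> R) :
  1 <= p -> exp_type p f -> is_lim_seq mu p_infty ->
  (forall n, trajectory f (lam n) (mu n) (V n) (V1 n)) ->
  plateau p f lam mu V V1 d A sg ->
  0 < d' < d -> 0 < A -> 0 < a' < 2 -> A * Rpower d' (p - 1) = 2 - a' ->
  2 * ((d - d') / (A / p)) + Rpower d' p - Rpower d p = 0 ->
  forall eps, 0 < eps -> eventually (fun n => exists s, (s < 0 /\ 0 < f (V n s)) /\
    / eps <= s - sg n /\ Rabs (V n s / mu n - d') <= eps /\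
    Rpower d' (p - 1) * flux p (mu n) (V1 n) s = 2 /\
    Rabs (Rpower d' (p - 1) * dens p f (lam n) (mu n) (V n) s - a' ^ 2 / 2) <= eps).
Proof.
  intros Hp Hf Hmu Htr Hpl Hd' HA Ha' HAD HPhi eps Heps.
  set (D := Rpower d' (p - 1)) in *.
  assert (HD : 0 < D) by apply Rpower_pos.
  set (c := A / p) in *.
  assert (Hc : 0 < c) by (apply Rdiv_lt_0_compat; lra).
  set (ts := (d - d') / c) in *.
  assert (Hts : 0 < ts) by (apply Rdiv_lt_0_compat; lra).
  assert (Htsd : d - c * ts = d') by (unfold ts; field; lra).
  (* [a'^2 / 64] is what [bubble_escape] requires; [eps / 16] leaves room for the change of the
     energy and for the deviations of [X] and [g] at the starting time. *)
  set (e0 := Rmin (eps / 16) (a' ^ 2 / 64)).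
  assert (He0 : 0 < e0) by (apply Rmin_pos; nra).
  assert (He1 : e0 <= eps / 16) by apply Rmin_l.
  assert (He2 : e0 <= a' ^ 2 / 64) by apply Rmin_r.
  destruct (exp_type_ratio p f e0 ltac:(lra) Hf He0) as (w & T & Hw & HT & Hratio).
  (* Relative window for the heights: inside it [exp_type_ratio] applies, and the height bound of
     the conclusion holds. *)
  set (om := Rmin (w * d') eps).
  assert (Hom : 0 < om) by (apply Rmin_pos; [apply Rmult_lt_0_compat; lra|lra]).
  assert (Hom1 : om <= w * d') by apply Rmin_l.
  assert (Hom2 : om <= eps) by apply Rmin_r.
  assert (Homd : om < d') by nra.
  (* The tolerance [a' / 2] is used through [(2 - a') (1 + a' / 2) = 2 - a'^2 / 2 < 2], which makes
     the exponent [Phi1] negative. *)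
  destruct (Rpower_near_1 (p - 1) (a' / 2) ltac:(lra)) as (w1 & Hw1 & Hnear).
  (* The starting height exceeds [d' mu] by [c eta mu], up to an error [eta mu]; a window of length
     [12 eta mu^p] with [X <= 2] lowers it by at most [24 / (p D) eta mu]. *)
  set (Kc := c + 1 + 24 / (p * D)).
  assert (HpD : 0 < p * D) by (apply Rmult_lt_0_compat; lra).
  assert (H24 : 0 < 24 / (p * D)) by (apply Rdiv_lt_0_compat; lra).
  assert (HKc : 0 < Kc) by (unfold Kc; lra).
  set (eta := Rmin (ts / 2) (Rmin (om / Kc) (w1 * d' / c))).
  assert (Hwd : 0 < w1 * d' / c) by (apply Rdiv_lt_0_compat; [apply Rmult_lt_0_compat|]; lra).
  assert (HoK : 0 < om / Kc) by (apply Rdiv_lt_0_compat; lra).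
  assert (Heta : 0 < eta) by (repeat apply Rmin_pos; lra).
  assert (Het1 : eta <= ts / 2) by apply Rmin_l.
  assert (Het2 : Kc * eta <= om).
  { assert (eta <= om / Kc) by (eapply Rle_trans; [apply Rmin_r|apply Rmin_l]).
    rewrite <- (div_mult_cancel om Kc HKc). nra. }
  assert (Het3 : c * eta <= w1 * d').
  { assert (eta <= w1 * d' / c) by (eapply Rle_trans; [apply Rmin_r|apply Rmin_r]).
    rewrite <- (div_mult_cancel (w1 * d') c Hc). nra. }
  set (t1 := ts - eta).
  assert (Ht1 : 0 < t1) by (unfold t1; lra).
  assert (Hh1 : d - c * t1 = d' + c * eta) by (unfold t1; lra).
  assert (Hceta : 0 < c * eta) by (apply Rmult_lt_0_compat; lra).
  assert (HpcD : p * D * (c * eta) = (2 - a') * eta).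
  { rewrite <- HAD. unfold c. field. lra. }
  set (Phi1 := 2 * t1 + Rpower (d - c * t1) p - Rpower d p).
  (* As a function of time the exponent is convex, vanishes at [ts] and has slope [2 - A D = a']
     there; hence it lies above its tangent. *)
  assert (HPhi_lo : - a' * eta <= Phi1).
  { assert (K := Rpower_tangent p d' (d' + c * eta) Hp ltac:(lra) ltac:(lra)). fold D in K.
    replace (d' + c * eta - d') with (c * eta) in K by ring.
    unfold Phi1. rewrite Hh1. unfold t1. lra. }
  assert (HPhi_up : Phi1 < 0).
  { assert (K := Rpower_tangent p (d' + c * eta) d' Hp ltac:(lra) ltac:(lra)).
    assert (Hq : Rpower (d' + c * eta) (p - 1) <= D * (1 + a' / 2)).
    { assert (Hb : Rabs ((d' + c * eta) / d' - 1) <= w1).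
      { replace ((d' + c * eta) / d' - 1) with (c * eta / d') by (field; lra).
        rewrite Rabs_pos_eq by (apply Rdiv_le_0_compat; lra).
        apply Rmult_le_reg_r with d'; [lra|]. rewrite div_mult_cancel; lra. }
      specialize (Hnear _ Hb). rewrite Rpower_div in Hnear by lra. fold D in Hnear.
      apply Rabs_le_between in Hnear.
      rewrite <- (div_mult_cancel (Rpower (d' + c * eta) (p - 1)) D HD). nra. }
    assert (Hm : p * Rpower (d' + c * eta) (p - 1) * (c * eta) <= (2 - a') * (1 + a' / 2) * eta).
    { replace ((2 - a') * (1 + a' / 2) * eta) with (p * (D * (1 + a' / 2)) * (c * eta)) by
        (replace (p * (D * (1 + a' / 2)) * (c * eta)) with (p * D * (c * eta) * (1 + a' / 2)) by ring;
         rewrite HpcD; ring).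
      apply Rmult_le_compat_r; [lra|]. apply Rmult_le_compat_l; lra. }
    replace (d' - (d' + c * eta)) with (- (c * eta)) in K by ring.
    unfold Phi1. rewrite Hh1. unfold t1.
    assert ((2 - a') * (1 + a' / 2) * eta < 2 * eta) by nra. lra. }
  destruct (drift_end p f lam mu V V1 d A sg t1 Hp Hf Hmu Htr Hpl ltac:(lra) Ht1
    ltac:(fold c; lra) HPhi_up) as (G1 & G2 & G3 & G4 & G5).
  fold c Phi1 in G2, G3, G4, G5. cbv zeta in G1. rewrite Hh1 in G2.
  set (s1 := fun n => sg n + t1 * Rpower (mu n) p).
  set (X := fun n s => D * flux p (mu n) (V1 n) s).
  set (g := fun n s => D * dens p f (lam n) (mu n) (V n) s).
  set (th := fun n s => log_deriv f (V n s) / (p * Rpower (d' * mu n) (p - 1))).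
  assert (GX : is_lim_seq (fun n => X n (s1 n)) (2 - a')).
  { rewrite <- HAD, Rmult_comm. apply lim_scal. exact G3. }
  assert (Gg : is_lim_seq (fun n => g n (s1 n)) 0).
  { replace 0 with (D * 0) by ring. apply lim_scal. exact G4. }
  assert (Hmup := lim_Rpower_infty mu p ltac:(lra) Hmu).
  assert (Glog : is_lim_seq (fun n => (ln D + ln (dens p f (lam n) (mu n) (V n) (s1 n))) / Rpower (mu n) p) Phi1).
  { replace Phi1 with (0 + Phi1) by ring.
    apply is_lim_seq_ext with (fun n => ln D / Rpower (mu n) p +
      ln (dens p f (lam n) (mu n) (V n) (s1 n)) / Rpower (mu n) p).
    { intros n. unfold Rdiv. ring. }
    apply lim_plus; [|exact G5].
    apply (is_lim_seq_div (fun _ => ln D) (fun n => Rpower (mu n) p) (ln D) p_infty 0);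
      [apply is_lim_seq_const|exact Hmup|discriminate|].
    unfold is_Rbar_div, is_Rbar_mult; simpl. f_equal. f_equal. ring. }
  (* Growth of [ln g] at rate [a' / 4] over this length yields [3 a' eta mu^p], which beats the
     initial deficit of at most [2 a' eta mu^p]. *)
  set (L := fun n => 12 * eta * Rpower (mu n) p).
  assert (Q1 := lim_infty_eventually mu (Rmax 0 (T / d')) Hmu).
  assert (Q2 := proj1 (is_lim_seq_eps _ _) G2 eta Heta).
  assert (Q3 := proj1 (is_lim_seq_eps _ _) GX e0 He0).
  assert (Q4 := proj1 (is_lim_seq_eps _ _) Gg e0 He0).
  assert (Q5 := lim_eventually_gt _ _ (- 2 * a' * eta) Glog ltac:(nra)).
  assert (Q6 := lim_infty_eventually _ (Rmax (/ eps / t1) (Rmax (3 / (a' * eta)) (2 / a' / (12 * eta)))) Hmup).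
  generalize (filter_and _ _ (filter_and _ _ G1 (filter_and _ _ Q1 Q2))
    (filter_and _ _ (filter_and _ _ Q3 Q4) (filter_and _ _ Q5 Q6))).
  apply filter_imp. intros n [(N0 & N1 & N2) [(N3 & N4) (N5 & N6)]].
  clear Q1 Q2 Q3 Q4 Q5 Q6 Hmup Glog Gg GX G1 G2 G3 G4 G5.
  fold (s1 n) in N0, N2.
  assert (Hm0 : 0 < mu n) by (eapply Rle_lt_trans; [apply Rmax_l|exact N1]).
  assert (HmT : T <= d' * mu n).
  { assert (T / d' < mu n) by (eapply Rle_lt_trans; [apply Rmax_r|exact N1]).
    rewrite <- (div_mult_cancel T d') by lra. nra. }
  assert (Hmp := Rpower_pos (mu n) p).
  assert (Z1 : / eps <= t1 * Rpower (mu n) p).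
  { assert (/ eps / t1 < Rpower (mu n) p) by (eapply Rle_lt_trans; [apply Rmax_l|exact N6]).
    rewrite <- (div_mult_cancel (/ eps) t1) by lra. nra. }
  assert (Hae : 0 < a' * eta) by (apply Rmult_lt_0_compat; lra).
  assert (Z2 : 3 <= a' * eta * Rpower (mu n) p).
  { assert (3 / (a' * eta) < Rpower (mu n) p).
    { eapply Rle_lt_trans; [|exact N6]. eapply Rle_trans; [|apply Rmax_r]. apply Rmax_l. }
    rewrite <- (div_mult_cancel 3 (a' * eta)) by lra. nra. }
  assert (Z3 : 2 / a' <= L n).
  { assert (2 / a' / (12 * eta) < Rpower (mu n) p).
    { eapply Rle_lt_trans; [|exact N6]. eapply Rle_trans; [|apply Rmax_r]. apply Rmax_r. }
    rewrite <- (div_mult_cancel (2 / a') (12 * eta)) by lra. unfold L. nra. }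
  assert (HL0 : 0 < 2 / a') by (apply Rdiv_lt_0_compat; lra).
  specialize (Htr n).
  assert (Hlam := traj_lam _ _ _ _ _ Htr).
  assert (HXd : forall s, s < 0 -> is_derive (X n) s (g n s)).
  { intros s Hs. unfold X, g. apply is_derive_scal. apply (is_derive_flux p f (lam n) (mu n) (V n)); assumption. }
  assert (HX0 : forall s, s < 0 -> 0 <= X n s).
  { intros s Hs. apply Rmult_le_pos; [lra|]. apply flux_nonneg with f (lam n) (V n); auto; lra. }
  assert (HV1 : forall s, V1 n s = - X n s / (p * Rpower (d' * mu n) (p - 1))).
  { intros s. unfold X, flux. rewrite <- Rpower_mult_distr by lra. fold D.
    assert (K := Rpower_pos (mu n) (p - 1)). field. repeat split; lra. }
  assert (HXmono : forall s t, s <= t < 0 -> X n s <= X n t).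
  { intros s t Hst. unfold X, flux. apply Rmult_le_compat_l; [lra|].
    apply Ropp_le_contravar. apply Rmult_le_compat_l.
    - apply Rmult_le_pos; [lra|left; apply Rpower_pos].
    - apply trajectory_slope_mono with f (lam n) (mu n) (V n); auto. exact (proj1 Hf). }
  apply Rabs_le_between in N2.
  assert (Hwin : forall s, s1 n <= s <= s1 n + L n -> s < 0 -> X n s <= 2 ->
     Rabs (V n s - d' * mu n) <= om * mu n).
  { intros s Hs Hs0 HXs.
    assert (U1 : V n s <= V n (s1 n)) by (apply trajectory_mono with f (lam n) (mu n) (V1 n); auto; lra).
    assert (U2 : V1 n s * (s - s1 n) <= V n s - V n (s1 n)).
    { apply (deriv_ge_le (V n) (V1 n)); [lra| |]; intros x Hx.
      - apply (traj_d1 _ _ _ _ _ Htr); lra.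
      - apply trajectory_slope_mono with f (lam n) (mu n) (V n); auto; [exact (proj1 Hf)|lra]. }
    assert (U3 : - (24 / (p * D) * eta) * mu n <= V1 n s * (s - s1 n)).
    { rewrite HV1. rewrite <- Rpower_mult_distr by lra. fold D.
      assert (K := Rpower_pos (mu n) (p - 1)).
      assert (K2 : s - s1 n <= 12 * eta * (mu n * Rpower (mu n) (p - 1))).
      { rewrite <- Rpower_pred by exact Hm0. unfold L in Hs. lra. }
      set (M := Rpower (mu n) (p - 1)) in *.
      assert (HpDM : 0 < p * D * M) by (apply Rmult_lt_0_compat; lra).
      replace (- X n s / (p * (D * M)) * (s - s1 n)) with (- (X n s * (s - s1 n)) / (p * D * M))
        by (field; repeat split; lra).
      replace (- (24 / (p * D) * eta) * mu n) with (- (2 * (12 * eta * (mu n * M))) / (p * D * M))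
        by (field; repeat split; lra).
      unfold Rdiv. apply Rmult_le_compat_r; [left; apply Rinv_0_lt_compat; exact HpDM|].
      apply Ropp_le_contravar. apply Rmult_le_compat; try lra. apply HX0; exact Hs0. }
    assert (U4 : V n (s1 n) = V n (s1 n) / mu n * mu n) by (field; lra).
    set (v1 := V n (s1 n) / mu n) in *.
    assert (U5 : (d' + c * eta - eta) * mu n <= v1 * mu n <= (d' + c * eta + eta) * mu n)
      by (split; apply Rmult_le_compat_r; lra).
    assert (U6 : (c + 1 + 24 / (p * D)) * eta * mu n <= om * mu n)
      by (apply Rmult_le_compat_r; [lra|exact Het2]).
    assert (U7 : 0 <= 24 / (p * D) * eta * mu n) by (apply Rmult_le_pos; [apply Rmult_le_pos|]; lra).
    assert (U8 : 0 <= c * eta * mu n) by (apply Rmult_le_pos; [apply Rmult_le_pos|]; lra).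
    assert (U9 : 0 <= eta * mu n) by (apply Rmult_le_pos; lra).
    apply Rabs_le_between. lra. }
  assert (Hgood : forall s, s1 n <= s <= s1 n + L n -> s < 0 -> X n s <= 2 ->
     0 < g n s /\ is_derive (g n) s (g n s * (2 - X n s * th n s)) /\ Rabs (th n s - 1) <= e0).
  { intros s Hs Hs0 HXs. assert (W := Hwin s Hs Hs0 HXs).
    destruct (Hratio (d' * mu n) (V n s) HmT) as (R1 & R2 & R3 & R4).
    { eapply Rle_trans; [exact W|]. rewrite <- Rmult_assoc. apply Rmult_le_compat_r; lra. }
    split; [|split; [|exact R4]].
    - unfold g, dens, source. repeat apply Rmult_lt_0_compat; try lra; try apply Rpower_pos. apply exp_pos.
    - unfold g at 1. evar_last.
      + apply is_derive_scal. apply is_derive_dens with (V1 := V1 n); assumption.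
      + unfold g, th. rewrite HV1. field.
        split; [apply Rgt_not_eq, Rpower_pos|lra]. }
  assert (Hs1 : s1 n < 0) by exact N0.
  apply Rabs_le_between in N4.
  assert (N3' := N3). apply Rabs_le_between in N3'.
  assert (Ha2 : a' ^ 2 <= 2 * a') by nra.
  assert (HX1 : X n (s1 n) < 2) by lra.
  assert (Hg1 : 0 < g n (s1 n)) by (apply Hgood; lra).
  (* If [X] stayed below 2, the height would stay near [d' mu], so the window would lie in the
     domain and [bubble_escape] would apply to it. *)
  assert (Hreach : exists s, s1 n <= s <= s1 n + L n /\ s < 0 /\ 2 <= X n s).
  { apply NNPP. intros Hno.
    assert (Hlt : forall s, s1 n <= s <= s1 n + L n -> s < 0 -> X n s < 2).
    { intros s Hs Hs0. apply Rnot_le_lt. intros Hle. apply Hno. exists s; auto. }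
    assert (Hend : s1 n + L n < 0).
    { apply (trajectory_lives f (lam n) (mu n) (V n) (V1 n) (s1 n) _ ((d' - om) * mu n)); auto.
      - apply Rmult_lt_0_compat; lra.
      - intros s Hs Hs0. assert (W := Hwin s Hs Hs0 ltac:(left; apply Hlt; assumption)).
        apply Rabs_le_between in W. lra. }
    apply (bubble_escape (X n) (g n) (th n) a' e0 (2 * a' * eta * Rpower (mu n) p) (s1 n) (L n)).
    - lra.
    - lra.
    - exact Z3.
    - intros s Hs. apply HXd; lra.
    - intros s Hs. apply Hgood; [exact Hs|lra|left; apply Hlt; lra].
    - intros s Hs. apply Hgood; [exact Hs|lra|left; apply Hlt; lra].
    - intros s Hs. split; [split; [apply HX0; lra|apply Hlt; lra]|].
      apply Hgood; [exact Hs|lra|left; apply Hlt; lra].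
    - exact N3.
    - lra.
    - assert (Hds : 0 < dens p f (lam n) (mu n) (V n) (s1 n)).
      { unfold g in Hg1. apply Rmult_lt_reg_l with D; lra. }
      unfold g. rewrite ln_mult by lra.
      set (l := ln D + ln (dens p f (lam n) (mu n) (V n) (s1 n))) in *.
      apply Rmult_lt_compat_r with (r := Rpower (mu n) p) in N5; [|exact Hmp].
      rewrite div_mult_cancel in N5 by exact Hmp. lra.
    - unfold L. replace (a' / 4 * (12 * eta * Rpower (mu n) p - 2 / a')) with
        (3 * (a' * eta * Rpower (mu n) p) - 1 / 2) by (field; lra). lra. }
  destruct Hreach as (s2 & Hs2 & Hs20 & HX2).
  destruct (IVT_le (X n) (s1 n) s2 2) as (s & Hs & HXs); try lra.
  { intros x Hx. apply continuity_pt_filterlim. apply (ex_derive_continuous (X n) x).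
    eexists. apply HXd; lra. }
  assert (Hgs : 0 < g n s) by (apply Hgood; lra).
  assert (HfV : 0 < f (V n s)).
  { destruct (traj_range _ _ _ _ _ Htr s ltac:(lra)) as [R1 _].
    destruct (Rle_lt_or_eq_dec _ _ (proj1 Hf (V n s) ltac:(lra))) as [F|F]; [exact F|].
    unfold g, dens, source in Hgs. rewrite <- F in Hgs. lra. }
  exists s. split; [split; [lra|exact HfV]|]. split; [|split; [|split; [exact HXs|]]].
  - unfold s1 in Hs. lra.
  - assert (W := Hwin s ltac:(lra) ltac:(lra) ltac:(lra)).
    replace (V n s / mu n - d') with ((V n s - d' * mu n) / mu n) by (field; lra).
    unfold Rdiv. rewrite Rabs_mult, (Rabs_pos_eq (/ mu n)) by (left; apply Rinv_0_lt_compat; lra).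
    apply Rmult_le_reg_r with (mu n); [lra|]. rewrite Rmult_assoc, Rinv_l, Rmult_1_r by lra.
    eapply Rle_trans; [exact W|]. apply Rmult_le_compat_r; lra.
  - assert (HXle : forall x, s1 n <= x <= s -> X n x <= 2).
    { intros x Hx. rewrite <- HXs. apply HXmono. lra. }
    (* At [s] the energy is [g] alone, because [X = 2]; at [s1] it is close to [a'^2 / 2], because
       [g] is small and [X] is close to [2 - a']. *)
    assert (En := bubble_energy (X n) (g n) (th n) e0 (s1 n) s ltac:(lra) ltac:(lra)
      (fun x Hx => HXd x ltac:(lra))
      (fun x Hx => proj1 (proj2 (Hgood x ltac:(lra) ltac:(lra) (HXle x Hx))))
      (fun x Hx => Rlt_le _ _ (proj1 (Hgood x ltac:(lra) ltac:(lra) (HXle x Hx))))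
      (fun x Hx => conj (conj (HX0 x ltac:(lra)) (HXle x Hx))
         (proj2 (proj2 (Hgood x ltac:(lra) ltac:(lra) (HXle x Hx)))))).
    rewrite HXs in En. change (D * dens p f (lam n) (mu n) (V n) s) with (g n s).
    apply Rabs_le_between in En.
    assert (HX1p := HX0 (s1 n) Hs1).
    assert (Hb : e0 * (2 - X n (s1 n)) <= e0 * 2) by (apply Rmult_le_compat_l; lra).
    assert (Heal : e0 * a' <= e0 * 2) by (apply Rmult_le_compat_l; lra).
    assert (Hee : e0 * e0 <= e0 * 1) by (apply Rmult_le_compat_l; lra).
    assert (Hea : e0 <= a') by lra.
    assert (Hsq1 : (a' - e0) ^ 2 <= (2 - X n (s1 n)) ^ 2) by (apply pow_incr; lra).
    assert (Hsq2 : (2 - X n (s1 n)) ^ 2 <= (a' + e0) ^ 2) by (apply pow_incr; lra).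
    apply Rabs_le_between. nra.
Qed.

(** * Convergence to the Liouville profile on compact sets *)

Lemma is_derive_shift (F : R -> R) (b t l : R) :
  is_derive F (b + t) l -> is_derive (fun t => F (b + t)) t l.
Proof.
  intros H. evar_last.
  - apply (is_derive_comp F (fun t => b + t)); [exact H|].
    auto_derive; [auto|reflexivity].
  - simpl. unfold scal; simpl. unfold mult; simpl. ring.
Qed.

Lemma log_profile'_bound (a t : R) : 0 < a -> - (2 + a) <= log_profile' a t <= - (2 - a).
Proof.
  intros Ha. unfold log_profile'. assert (Hb := log_profile_coef_pos a).
  assert (He := exp_pos (a * t)).
  assert (Hx : 0 < log_profile_coef a * exp (a * t)) by (apply Rmult_lt_0_compat; assumption).
  set (x := log_profile_coef a * exp (a * t)) in *.
  assert (0 <= 2 * a * x / (1 + x) <= 2 * a); [|lra].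
  split.
  - apply Rdiv_le_0_compat; nra.
  - apply Rmult_le_reg_r with (1 + x); [lra|]. rewrite div_mult_cancel by lra. nra.
Qed.

(** The slope of the profile lies in [[-4, 0]], and its zero [ln (a / sqrt 2)] is at distance at
    most [2 T] from [t]. *)
Lemma log_profile_bound (a T t : R) : 0 < a <= 2 -> - T <= t <= T ->
  - T <= ln (a / sqrt 2) <= T -> Rabs (log_profile a t) <= 8 * T.
Proof.
  intros Ha Ht Ht0. set (t0 := ln (a / sqrt 2)) in *.
  assert (H0 : log_profile a t0 = 0) by (apply log_profile_at_center; lra).
  assert (K : forall x y, x <= y -> - 4 * (y - x) <= log_profile a y - log_profile a x <= 0 * (y - x)).
  { intros x y Hxy. split.
    - apply (deriv_ge_le (log_profile a) (log_profile' a)); [lra| |]; intros s _;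
        [apply is_derive_log_profile|]. assert (B := log_profile'_bound a s ltac:(lra)). lra.
    - apply (deriv_le_ge (log_profile a) (log_profile' a)); [lra| |]; intros s _;
        [apply is_derive_log_profile|]. assert (B := log_profile'_bound a s ltac:(lra)). lra. }
  apply Rabs_le_between. destruct (Rle_or_lt t t0) as [H|H].
  - assert (B := K t t0 H). lra.
  - assert (B := K t0 t ltac:(lra)). lra.
Qed.

Lemma MVT_log (f : R -> R) (m e U W : R) :
  0 < m ->
  (forall xi, Rabs (xi - U) <= Rabs (W - U) ->
     0 < f xi /\ ex_derive f xi /\ Rabs (log_deriv f xi / m - 1) <= e) ->
  Rabs (ln (f W) - ln (f U) - m * (W - U)) <= e * Rabs (m * (W - U)).
Proof.
  intros Hm H.
  destruct (MVT_gen (fun x => ln (f x)) U W (log_deriv f)) as [xi [Hxi Heq]].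
  - intros x Hx. assert (Rabs (x - U) <= Rabs (W - U)).
    { unfold Rmin, Rmax in Hx. destruct (Rle_dec U W);
        [rewrite !Rabs_pos_eq by lra|rewrite !Rabs_left1 by lra]; lra. }
    apply is_derive_ln_comp; apply H; assumption.
  - intros x Hx. assert (Rabs (x - U) <= Rabs (W - U)).
    { unfold Rmin, Rmax in Hx. destruct (Rle_dec U W);
        [rewrite !Rabs_pos_eq by lra|rewrite !Rabs_left1 by lra]; lra. }
    apply continuity_pt_filterlim. apply (ex_derive_continuous (fun x => ln (f x)) x).
    eexists. apply is_derive_ln_comp; apply H; assumption.
  - assert (Hb : Rabs (xi - U) <= Rabs (W - U)).
    { unfold Rmin, Rmax in Hxi. destruct (Rle_dec U W);
        [rewrite !Rabs_pos_eq by lra|rewrite !Rabs_left1 by lra]; lra. }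
    destruct (H xi Hb) as (_ & _ & K). rewrite Heq.
    replace (log_deriv f xi * (W - U) - m * (W - U)) with
      ((log_deriv f xi / m - 1) * (m * (W - U))) by (field; lra).
    rewrite Rabs_mult. apply Rmult_le_compat_r; [apply Rabs_pos|exact K].
Qed.

(* [sc n] is the logarithm of the scale gamma, chosen so that the rescaled equation
   has coefficient exactly 1. *)
Lemma liouville_convergence (p : R) (f : R -> R) (lam mu : nat -> R) (V V1 : nat -> R -> R)
  (a : R) (st : nat -> R) (m G sc : nat -> R) :
  1 <= p -> exp_type p f -> 0 < a <= 2 ->
  (forall n, trajectory f (lam n) (mu n) (V n) (V1 n)) ->
  eventually (fun n => st n < 0) ->
  is_lim_seq (fun n => V n (st n)) p_infty ->
  (forall n, m n = p * Rpower (V n (st n)) (p - 1)) ->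
  (forall n, G n = m n * source f (lam n) (V n) (st n)) ->
  (forall n, sc n = st n - ln (G n) / 2) ->
  is_lim_seq (fun n => - (m n * V1 n (st n))) 2 ->
  is_lim_seq G (a ^ 2 / 2) ->
  forall T eps, 0 < T -> 0 < eps -> eventually (fun n => forall t, - T <= t <= T ->
    sc n + t < 0 /\
    Rabs (m n * (V n (sc n + t) - V n (st n)) - log_profile a t) <= eps /\
    Rabs (m n * V1 n (sc n + t) - log_profile' a t) <= eps /\
    Rabs (- (m n * source f (lam n) (V n) (sc n + t)) - log_profile'' a t) <= eps).
Proof.
  intros Hp Hf Ha Htr Hst HU Hm HG Hsc HQ HGl T0 eps HT0 Heps.
  set (t0 := ln (a / sqrt 2)).
  (* The window is enlarged to contain [t0] with a margin 1, because the initial data are compared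
     at [tn n], which tends to [t0]. *)
  set (T := Rmax T0 (Rabs t0 + 1)).
  assert (HT0T : T0 <= T) by apply Rmax_l.
  assert (HtT : Rabs t0 + 1 <= T) by apply Rmax_r.
  assert (HTpos : 0 < T) by lra.
  assert (Ht0abs := Rle_abs t0). assert (Ht0abs' := Rle_abs (- t0)). rewrite Rabs_Ropp in Ht0abs'.
  (* A bound for the slope: its size at the center is below 3 for large [n], and after the center
     [y2 >= - exp (2 T)], since [f(V) <= f(U)] there. *)
  set (B1 := 4 + 2 * T * exp (2 * T)).
  assert (HE := exp_pos (2 * T)).
  assert (HB1 : 4 <= B1) by (unfold B1; nra).
  set (B := 2 * T * B1).
  assert (HB : 8 * T <= B) by (unfold B; nra).
  destruct (liouville_stability T B eps HTpos Heps) as (eta & Heta & Hstab).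
  (* Cost of replacing [f(V) / f(U)] by [exp y]: the weight [exp (2 t)], the Lipschitz constant of
     [exp] below [2 B], and the bound [B] on [y], to which the error is relative. *)
  set (Den := exp (2 * T) * exp (B + B) * B).
  assert (HDen : 0 < Den).
  { unfold Den. repeat apply Rmult_lt_0_compat; try apply exp_pos; lra. }
  set (e1 := Rmin 1 (eta / Den)).
  assert (He1 : 0 < e1) by (apply Rmin_pos; [lra|apply Rdiv_lt_0_compat; lra]).
  assert (He11 : e1 <= 1) by apply Rmin_l.
  assert (He1d : e1 * Den <= eta).
  { rewrite <- (div_mult_cancel eta Den HDen). apply Rmult_le_compat_r; [lra|apply Rmin_r]. }
  destruct (exp_type_ratio p f e1 ltac:(lra) Hf He1) as (w & T1 & Hw & HT1 & Hratio).
  destruct (exp_type_dominates p f Hp Hf) as (T2 & HT2 & Hdom).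
  (* The center in rescaled time, since [sc n + tn n = st n]. Its limit is the center
     [ln (a / sqrt 2)] of the profile, because [G] tends to [a^2 / 2]. *)
  set (tn := fun n => ln (G n) / 2).
  assert (Ha2 : 0 < a ^ 2 / 2) by nra.
  assert (Ltn : is_lim_seq tn t0).
  { unfold tn. replace t0 with (ln (a ^ 2 / 2) / 2).
    - apply lim_div; [lra| |apply is_lim_seq_const].
      apply (is_lim_seq_continuous ln G (a ^ 2 / 2)); [|exact HGl].
      apply continuity_pt_filterlim. apply (ex_derive_continuous ln).
      eexists. apply is_derive_ln. exact Ha2.
    - unfold t0. replace (a ^ 2 / 2) with (a / sqrt 2 * (a / sqrt 2)).
      + rewrite ln_mult by (apply sqrt2_div_pos; lra). field.
      + assert (Hs : 0 < sqrt 2) by (apply sqrt_lt_R0; lra).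
        replace 2 with (sqrt 2 * sqrt 2) at 3 by (apply sqrt_sqrt; lra). field. lra. }
  assert (LY : is_lim_seq (fun n => log_profile a (tn n)) 0).
  { rewrite <- (log_profile_at_center a) by lra.
    apply (is_lim_seq_continuous (log_profile a) tn t0); [|exact Ltn].
    apply continuity_pt_filterlim. apply (ex_derive_continuous (log_profile a)).
    eexists. apply is_derive_log_profile. }
  assert (LY1 : is_lim_seq (fun n => log_profile' a (tn n)) (- 2)).
  { rewrite <- (log_profile'_at_center a) by lra.
    apply (is_lim_seq_continuous (log_profile' a) tn t0); [|exact Ltn].
    apply continuity_pt_filterlim. apply (ex_derive_continuous (log_profile' a)).
    eexists. apply is_derive_log_profile'. }
  assert (LQ := lim_plus _ _ _ _ HQ LY1). cbv beta in LQ. replace (2 + - 2) with 0 in LQ by ring.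
  assert (E1 := proj1 (is_lim_seq_eps _ _) Ltn 1 Rlt_0_1).
  assert (E2 := proj1 (is_lim_seq_eps _ _) LY eta Heta).
  assert (E3 := proj1 (is_lim_seq_eps _ _) LQ eta Heta).
  assert (E4 := lim_eventually_lt _ _ 3 HQ ltac:(lra)).
  assert (E5 := lim_eventually_gt _ _ 0 HGl ltac:(lra)).
  assert (E6 := lim_infty_eventually _ (Rmax (Rmax T1 T2) (Rmax 1 (2 * B / w))) HU).
  generalize (filter_and _ _ (filter_and _ _ E1 (filter_and _ _ E2 E3))
    (filter_and _ _ (filter_and _ _ E4 E5) (filter_and _ _ E6 Hst))).
  apply filter_imp. intros n [(N1 & N2 & N3) [(N4 & N5) (N6 & N7)]].
  clear E1 E2 E3 E4 E5 E6 LQ LY LY1 Ltn Hst.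
  specialize (Htr n). specialize (Hm n). specialize (HG n). specialize (Hsc n).
  set (U := V n (st n)) in *.
  assert (U1 : T1 <= U).
  { left. eapply Rle_lt_trans; [|exact N6]. eapply Rle_trans; [|apply Rmax_l]. apply Rmax_l. }
  assert (U2 : T2 <= U).
  { left. eapply Rle_lt_trans; [|exact N6]. eapply Rle_trans; [|apply Rmax_l]. apply Rmax_r. }
  assert (U3 : 1 <= U).
  { left. eapply Rle_lt_trans; [|exact N6]. eapply Rle_trans; [|apply Rmax_r]. apply Rmax_l. }
  assert (U4 : 2 * B <= w * U).
  { assert (2 * B / w < U).
    { eapply Rle_lt_trans; [|exact N6]. eapply Rle_trans; [|apply Rmax_r]. apply Rmax_r. }
    rewrite <- (div_mult_cancel (2 * B) w) by lra. nra. }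
  destruct (Hdom U U2) as [FU HdomU].
  assert (Hm1 : 1 <= m n).
  { rewrite Hm. assert (HR : 1 <= Rpower U (p - 1)).
    2:{ apply Rle_trans with (p * 1); [lra|]. apply Rmult_le_compat_l; lra. }
    rewrite <- (Rpower_O U) at 1 by lra. apply Rle_Rpower; lra. }
  assert (Hlam := traj_lam _ _ _ _ _ Htr).
  change (ln (G n) / 2) with (tn n) in Hsc.
  set (b := sc n) in *.
  assert (Hbt : b + tn n = st n) by lra.
  apply Rabs_le_between in N1.
  assert (Htn : - T <= tn n <= T) by lra.
  set (y := fun t => m n * (V n (b + t) - U)).
  set (y1 := fun t => m n * V1 n (b + t)).
  set (y2 := fun t => - (m n * source f (lam n) (V n) (b + t))).
  assert (Hy2 : forall t, y2 t = - (exp (2 * t) * (f (V n (b + t)) / f U))).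
  { intros t. unfold y2. f_equal.
    assert (HGe : G n = m n * (lam n * exp (2 * st n)) * f U) by (rewrite HG; unfold source; fold U; ring).
    assert (Hle : m n * lam n * exp (2 * (b + t)) = exp (2 * t) / f U).
    { assert (Heq : exp (2 * (b + t)) = exp (2 * t) * exp (2 * st n) / G n).
      { rewrite Hsc. replace (2 * (st n - tn n + t)) with (2 * t + 2 * st n + - ln (G n)) by (unfold tn; field).
        rewrite !exp_plus, exp_Ropp, exp_ln by exact N5. unfold Rdiv; ring. }
      rewrite Heq, HGe. assert (Q := exp_pos (2 * st n)). field. repeat split; lra. }
    unfold source. transitivity (m n * lam n * exp (2 * (b + t)) * f (V n (b + t))); [ring|].
    rewrite Hle. field. lra. }
  assert (Hy0 : y (tn n) = 0) by (unfold y; rewrite Hbt; fold U; ring).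
  assert (Hy10 : y1 (tn n) = m n * V1 n (st n)) by (unfold y1; rewrite Hbt; reflexivity).
  assert (Hdy : forall t, b + t < 0 -> is_derive y t (y1 t)).
  { intros t Ht. unfold y, y1. apply is_derive_scal.
    apply (is_derive_shift (fun s => V n s - U)). rewrite <- (Rminus_0_r (V1 n (b + t))).
    apply (is_derive_minus (V n) (fun _ => U)); [|apply (is_derive_const U)].
    apply (traj_d1 _ _ _ _ _ Htr). exact Ht. }
  assert (Hdy1 : forall t, b + t < 0 -> is_derive y1 t (y2 t)).
  { intros t Ht. unfold y1, y2.
    replace (- (m n * source f (lam n) (V n) (b + t))) with (m n * (- source f (lam n) (V n) (b + t))) by ring.
    apply is_derive_scal. apply (is_derive_shift (V1 n)).
    apply (traj_d2 _ _ _ _ _ Htr). exact Ht. }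
  assert (Hy1neg : forall t, b + t < 0 -> y1 t <= 0).
  { intros t Ht. assert (Q := traj_decr _ _ _ _ _ Htr _ Ht). unfold y1. nra. }
  assert (Hy1mono : forall s t, s <= t -> b + t < 0 -> y1 t <= y1 s).
  { intros s t Hs Ht. unfold y1. apply Rmult_le_compat_l; [lra|].
    apply trajectory_slope_mono with f (lam n) (mu n) (V n); auto; [exact (proj1 Hf)|lra]. }
  (* Backwards from the center the slope only becomes flatter; forwards it is bounded by integrating
     [y2]. The bound is proved while [b + t < 0], and then shows that the entire window lies in the
     domain. *)
  assert (Hbound : forall t, - T <= t <= T -> b + t < 0 -> - B <= y t <= B).
  { intros t Ht Hbt0. destruct (Rle_or_lt (tn n) t) as [Hc|Hc].
    - assert (Hy1 : forall x, tn n <= x <= t -> - B1 <= y1 x).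
      { intros x Hx.
        assert (Q : - exp (2 * T) * (x - tn n) <= y1 x - y1 (tn n)).
        { apply (deriv_ge_le y1 y2); [lra| |]; intros z Hz.
          - apply Hdy1. lra.
          - rewrite Hy2.
            assert (Hr : 0 <= f (V n (b + z)) / f U <= 1).
            { destruct (traj_range _ _ _ _ _ Htr (b + z) ltac:(lra)) as [R1 _].
              assert (R2 : V n (b + z) <= U).
              { unfold U. apply trajectory_mono with f (lam n) (mu n) (V1 n); auto. lra. }
              split.
              - apply Rdiv_le_0_compat; [apply (proj1 Hf); lra|lra].
              - apply Rmult_le_reg_r with (f U); [lra|]. rewrite div_mult_cancel by lra.
                rewrite Rmult_1_l. apply HdomU. lra. }
            assert (He2 : exp (2 * z) <= exp (2 * T)) by (apply exp_le; lra).
            assert (He3 := exp_pos (2 * z)). nra. }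
        assert (exp (2 * T) * (x - tn n) <= exp (2 * T) * (2 * T)) by (apply Rmult_le_compat_l; lra).
        rewrite Hy10 in Q. unfold B1. lra. }
      assert (Q1 : - B1 * (t - tn n) <= y t - y (tn n)).
      { apply (deriv_ge_le y y1); [lra| |]; intros x Hx; [apply Hdy; lra|apply Hy1; lra]. }
      assert (Q2 : y t - y (tn n) <= 0 * (t - tn n)).
      { apply (deriv_le_ge y y1); [lra| |]; intros x Hx; [apply Hdy; lra|apply Hy1neg; lra]. }
      assert (B1 * (t - tn n) <= B1 * (2 * T)) by (apply Rmult_le_compat_l; lra).
      unfold B. lra.
    - assert (Q1 : - B1 * (tn n - t) <= y (tn n) - y t).
      { apply (deriv_ge_le y y1); [lra| |]; intros x Hx; [apply Hdy; lra|].
        apply Rle_trans with (y1 (tn n)); [lra|]. apply Hy1mono; lra. }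
      assert (Q2 : y (tn n) - y t <= 0 * (tn n - t)).
      { apply (deriv_le_ge y y1); [lra| |]; intros x Hx; [apply Hdy; lra|apply Hy1neg; lra]. }
      assert (B1 * (tn n - t) <= B1 * (2 * T)) by (apply Rmult_le_compat_l; lra).
      unfold B. lra. }
  assert (HVU : forall t, - T <= t <= T -> b + t < 0 -> Rabs (V n (b + t) - U) <= B).
  { intros t Ht Hbt0. assert (Q := Hbound t Ht Hbt0). apply Rabs_le_between in Q. unfold y in Q.
    rewrite Rabs_mult, (Rabs_pos_eq (m n)) in Q by lra.
    assert (R0 := Rabs_pos (V n (b + t) - U)). nra. }
  assert (Hend : b + T < 0).
  { apply (trajectory_lives f (lam n) (mu n) (V n) (V1 n) (st n) (b + T) B); auto; [lra|].
    intros s Hs Hs0. assert (Q := HVU (s - b) ltac:(lra) ltac:(lra)).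
    replace (b + (s - b)) with s in Q by ring. apply Rabs_le_between in Q.
    assert (w * U <= 1 * U) by (apply Rmult_le_compat_r; lra). lra. }
  intros t Ht. split; [lra|].
  apply (Hstab y y1 y2 (log_profile a) (log_profile' a) (log_profile'' a) (tn n) Htn).
  - intros s Hs. split; [apply Hdy; lra|]. split; [apply Hdy1; lra|].
    split; [apply Rabs_le_between; apply Hbound; lra|].
    rewrite Hy2. set (W := V n (b + s)).
    assert (HW := HVU s Hs ltac:(lra)). fold W in HW.
    assert (ML := MVT_log f (m n) e1 U W ltac:(lra)).
    assert (HML : Rabs (ln (f W) - ln (f U) - m n * (W - U)) <= e1 * Rabs (m n * (W - U))).
    { apply ML. intros xi Hxi. destruct (Hratio U xi U1) as (R1 & R2 & R3 & R4); [lra|].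
      rewrite Hm. auto. }
    assert (FW : 0 < f W) by (apply (Hratio U W U1); lra).
    assert (Hys : Rabs (m n * (W - U)) <= B) by (apply Rabs_le_between; apply (Hbound s); lra).
    assert (Hfr : f W / f U = exp (ln (f W) - ln (f U))).
    { unfold Rminus. rewrite exp_plus, exp_Ropp, !exp_ln by assumption. reflexivity. }
    rewrite Hfr, exp_plus. change (y s) with (m n * (W - U)).
    set (yy := m n * (W - U)) in *. set (l := ln (f W) - ln (f U)) in *.
    replace (- (exp (2 * s) * exp l) + exp (2 * s) * exp yy) with (exp (2 * s) * (exp yy - exp l)) by ring.
    rewrite Rabs_mult, (Rabs_pos_eq (exp (2 * s))) by (left; apply exp_pos).
    assert (He1B : e1 * Rabs yy <= e1 * B) by (apply Rmult_le_compat_l; lra).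
    assert (He1B' : e1 * B <= 1 * B) by (apply Rmult_le_compat_r; lra).
    assert (Hly : Rabs (l - yy) <= e1 * B) by lra.
    assert (Hly' := Hly). apply Rabs_le_between in Hly'. apply Rabs_le_between in Hys.
    assert (Lip := exp_lipschitz (B + B) yy l ltac:(lra) ltac:(lra)).
    rewrite (Rabs_minus_sym yy) in Lip.
    assert (HE2 : exp (2 * s) <= exp (2 * T)) by (apply exp_le; lra).
    assert (HE3 := exp_pos (2 * s)). assert (HE4 := exp_pos (B + B)).
    apply Rle_trans with (exp (2 * T) * (exp (B + B) * (e1 * B))).
    + apply Rmult_le_compat; [lra|apply Rabs_pos|exact HE2|].
      eapply Rle_trans; [exact Lip|]. apply Rmult_le_compat_l; lra.
    + unfold Den in He1d. lra.
  - intros s Hs. split; [apply is_derive_log_profile|]. split; [apply is_derive_log_profile'|].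
    split; [|apply log_profile''_eq; lra].
    eapply Rle_trans; [apply (log_profile_bound a T); auto; fold t0; lra|lra].
  - rewrite Hy0. rewrite Rabs_minus_sym. exact N2.
  - rewrite Hy10. rewrite Rabs_minus_sym.
    replace (log_profile' a (tn n) - m n * V1 n (st n)) with
      (- (m n * V1 n (st n)) + log_profile' a (tn n) - 0) by ring. exact N3.
  - lra.
Qed.

(** * Radial solutions in logarithmic time *)

Lemma derivative_on_interior (D : R -> Prop) (f f' : R -> R) (x : R) :
  derivative_on D f f' -> D x -> locally x D -> is_derive f x (f' x).
Proof.
  intros H Dx Hloc. destruct (H x Dx) as [Hlin Hdom]. split; [exact Hlin|].
  intros x' Hx' eps.
  assert (L : is_filter_lim (within D (locally x)) x').
  { intros P HP. specialize (Hx' P HP). unfold within. revert Hx'. apply filter_imp. auto. }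
  specialize (Hdom x' L eps). unfold within in Hdom.
  generalize (filter_and _ _ Hdom Hloc). apply filter_imp. intros y [Hy1 Hy2]. apply Hy1, Hy2.
Qed.

Lemma derivative_on_continuous (D : R -> Prop) (f f' : R -> R) (x : R) :
  derivative_on D f f' -> D x -> filterlim f (within D (locally x)) (locally (f x)).
Proof.
  intros H Dx. apply (filterdiff_continuous_aux (K := R_AbsRing) (U := R_NormedModule) (V := R_NormedModule) f).
  - eexists. apply H, Dx.
  - intros P HP. unfold within. revert HP. apply filter_imp. auto.
Qed.

Lemma within_eps (D : R -> Prop) (f : R -> R) (x e : R) :
  filterlim f (within D (locally x)) (locally (f x)) -> 0 < e ->
  exists d, 0 < d /\ forall y, D y -> Rabs (y - x) < d -> Rabs (f y - f x) < e.
Proof.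
  intros H He. destruct (proj1 (filterlim_locally _ _) H (mkposreal e He)) as [d Hd].
  exists d. split; [apply cond_pos|]. intros y Dy Hy. apply (Hd y); assumption.
Qed.

Lemma icc_locally (a b x : R) : a < x < b -> locally x (icc a b).
Proof.
  intros H. assert (Hd : 0 < Rmin (x - a) (b - x)) by (apply Rmin_pos; lra).
  exists (mkposreal _ Hd). intros y Hy. change (Rabs (y - x) < Rmin (x - a) (b - x)) in Hy.
  assert (M1 := Rmin_l (x - a) (b - x)). assert (M2 := Rmin_r (x - a) (b - x)).
  apply Rabs_lt_between in Hy. unfold icc. lra.
Qed.

Lemma derivative_on_icc (a b : R) (f f' : R -> R) (x : R) :
  derivative_on (icc a b) f f' -> a < x < b -> is_derive f x (f' x).
Proof.
  intros H Hx. apply derivative_on_interior with (icc a b); [exact H|unfold icc; lra|].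
  apply icc_locally, Hx.
Qed.

Lemma derivative_on_halfline (h h' : R -> R) (t : R) :
  derivative_on (fun t => 0 <= t) h h' -> 0 < t -> is_derive h t (h' t).
Proof.
  intros H Ht. apply derivative_on_interior with (fun t => 0 <= t); [exact H|lra|].
  generalize (locally_positive t Ht). apply filter_imp. intros y Hy. lra.
Qed.

Lemma is_derive_nonlin (h h' : R -> R) (p t : R) :
  derivative_on (fun t => 0 <= t) h h' -> 0 < t ->
  is_derive (nonlin h p) t
    (h' t * exp (Rpower t p) + h t * (p * Rpower t (p - 1) * exp (Rpower t p))).
Proof.
  intros H Ht.
  apply is_derive_ext_loc with (fun t => h t * exp (Rpower t p)).
  - generalize (locally_positive t Ht). apply filter_imp. intros y Hy. unfold nonlin. rewrite rpow_pos_eq by lra. reflexivity.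
  - assert (K := derivative_on_halfline h h' t H Ht).
    assert (K2 : is_derive (fun t => exp (Rpower t p)) t (p * Rpower t (p - 1) * exp (Rpower t p))).
    { apply (is_derive_comp exp (fun t => Rpower t p)).
      - apply is_derive_exp.
      - apply is_derive_Rpower, Ht. }
    exact (is_derive_mult _ _ _ _ _ K K2 Rmult_comm).
Qed.

(** For large [t], [(log f)' = h' / h + p t^(p-1)], and the hypothesis says that the first term is
    [o(t^(p-1))]. Local boundedness follows from the continuity of [h] on compact intervals. *)
Lemma nonlin_exp_type (p : R) (h : R -> R) : 2 < p ->
  C1_on (fun t => 0 <= t) h -> (forall t, 0 <= t -> 0 <= h t) ->
  (exists t0, 0 < t0 /\ forall t, t0 <= t -> 0 < h t) ->
  is_lim (fun t => Derive h t / (rpow t (p - 1) * h t)) p_infty 0 ->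
  exp_type p (nonlin h p).
Proof.
  intros Hp (h' & Hh & _) Hnn (t0 & Ht0 & Hpos) Hlim. split; [|split].
  - intros t Ht. unfold nonlin. apply Rmult_le_pos; [apply Hnn, Ht|left; apply exp_pos].
  - intros T0. set (T := Rmax T0 1).
    assert (HT : 1 <= T) by apply Rmax_r. assert (HT0 : T0 <= T) by apply Rmax_l.
    (* [h] is continuous only from the right at 0; the constant extension to negative [t] makes it
       continuous there in the two-sided sense. *)
    set (hh := fun t => h (Rmax 0 t)).
    assert (Hc : forall t, 0 <= t <= T -> continuity_pt hh t).
    { intros t Ht. apply continuity_pt_filterlim. unfold hh.
      apply (filterlim_comp _ _ _ (Rmax 0) h (locally t) (within (fun t => 0 <= t) (locally (Rmax 0 t)))).
      - intros P [d Hd]. exists d. intros y Hy. apply Hd; [|apply Rmax_l].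
        change (Rabs (Rmax 0 y - Rmax 0 t) < d). change (Rabs (y - t) < d) in Hy.
        eapply Rle_lt_trans; [|exact Hy]. rewrite (Rmax_right 0 t) by lra.
        unfold Rmax. destruct (Rle_dec 0 y); [apply Rle_refl|].
        rewrite !Rabs_left1 by lra. lra.
      - apply derivative_on_continuous with h'; [exact Hh|apply Rmax_l]. }
    destruct (continuity_ab_maj hh 0 T ltac:(lra) Hc) as (mx & Hmx & _).
    exists (hh mx * exp (Rpower T p)). intros t Ht. unfold nonlin.
    assert (Hht : h t <= hh mx).
    { replace (h t) with (hh t) by (unfold hh; rewrite Rmax_right by lra; reflexivity).
      apply Hmx. lra. }
    assert (Hr : rpow t p <= Rpower T p).
    { unfold rpow. destruct (Rlt_dec 0 t) as [H|H].
      - apply Rpower_incr; lra.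
      - left; apply Rpower_pos. }
    apply Rmult_le_compat; [apply Hnn; lra|left; apply exp_pos|exact Hht|apply exp_le, Hr].
  - intros eps Heps.
    apply is_lim_spec in Hlim.
    destruct (Hlim (mkposreal (eps * p) ltac:(apply Rmult_lt_0_compat; lra))) as [M HM]. simpl in HM.
    set (T := Rmax t0 (M + 1)).
    assert (HT1 : t0 <= T) by apply Rmax_l. assert (HT2 : M + 1 <= T) by apply Rmax_r.
    exists T. split; [lra|]. intros t Ht.
    assert (Hht := Hpos t ltac:(lra)).
    assert (Hd := is_derive_nonlin h h' p t Hh ltac:(lra)).
    assert (Hdh := derivative_on_halfline h h' t Hh ltac:(lra)).
    assert (Hexp := exp_pos (Rpower t p)).
    assert (Hfe : nonlin h p t = h t * exp (Rpower t p)) by (unfold nonlin; rewrite rpow_pos_eq by lra; reflexivity).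
    split; [rewrite Hfe; apply Rmult_lt_0_compat; assumption|].
    split; [eexists; exact Hd|].
    unfold log_deriv. rewrite (is_derive_unique _ _ _ Hd), Hfe.
    specialize (HM t ltac:(lra)). rewrite (is_derive_unique _ _ _ Hdh), rpow_pos_eq in HM by lra.
    assert (Hr := Rpower_pos t (p - 1)). set (r := Rpower t (p - 1)) in *.
    replace ((h' t * exp (Rpower t p) + h t * (p * r * exp (Rpower t p))) / (h t * exp (Rpower t p)) - p * r)
      with ((h' t / (r * h t) - 0) * r) by (field; repeat split; lra).
    rewrite Rabs_mult, (Rabs_pos_eq r) by lra. nra.
Qed.

(** In [s = log r] the radial operator becomes a plain second derivative, because
    [(r u')' = - lambda f(u) r]. The integral formula needs this identity up to [r = 0], where the
    equation is not assumed; [u'(0) = 0] and the continuity of [u''] supply what is needed. *)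
Lemma solution_trajectory (f : R -> R) (lam mu : R) (u : R -> R) :
  (forall t, 0 <= t -> 0 <= f t) ->
  is_solution f lam mu u ->
  trajectory f lam mu (fun s => u (exp s)) (Derive (fun s => u (exp s))) /\
  (forall b, 0 < b < 1 ->
    RInt (fun x => lam * f (u x) * x) 0 b = - Derive (fun s => u (exp s)) (ln b)).
Proof.
  intros Hf (Hlam & Hmu & u1 & u2 & Hu & Hu1 & Hu2c & Heq & Hpos & H0 & H10 & H11).
  set (V := fun s => u (exp s)).
  assert (Hexp : forall s, s < 0 -> 0 < exp s < 1).
  { intros s Hs. split; [apply exp_pos|]. rewrite <- exp_0. apply exp_increasing, Hs. }
  assert (HdV : forall s, s < 0 -> is_derive V s (exp s * u1 (exp s))).
  { intros s Hs. apply (is_derive_comp u exp); [|apply is_derive_exp].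
    apply (derivative_on_icc 0 1); auto. }
  assert (HDV : forall s, s < 0 -> Derive V s = exp s * u1 (exp s)).
  { intros s Hs. apply is_derive_unique, HdV, Hs. }
  (* r u'(r), extended by 0 to negative r, is of class C^1 near 0 *)
  set (A := fun r => if Rle_dec r 0 then 0 else r * u1 r).
  set (A' := fun r => if Rle_dec r 0 then 0 else u1 r + r * u2 r).
  assert (C1 : forall x, icc 0 1 x -> filterlim u1 (within (icc 0 1) (locally x)) (locally (u1 x)))
    by (intros x Hx; apply derivative_on_continuous with u2; assumption).
  assert (C0 : forall x, icc 0 1 x -> filterlim u (within (icc 0 1) (locally x)) (locally (u x)))
    by (intros x Hx; apply derivative_on_continuous with u1; assumption).
  assert (I0 : icc 0 1 0) by (unfold icc; lra).
  assert (I1 : icc 0 1 1) by (unfold icc; lra).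
  assert (HAp : forall r, 0 < r < 1 -> is_derive A r (A' r)).
  { intros r Hr. apply is_derive_ext_loc with (fun r => r * u1 r).
    - generalize (locally_positive r (proj1 Hr)). apply filter_imp. intros y Hy. unfold A. destruct (Rle_dec y 0); [lra|reflexivity].
    - unfold A'. destruct (Rle_dec r 0); [lra|].
      assert (K := derivative_on_icc 0 1 u1 u2 r Hu1 Hr).
      assert (Km := is_derive_mult (fun r => r) u1 r 1 (u2 r) (is_derive_id r) K Rmult_comm).
      evar_last; [exact Km|]. unfold plus, mult; simpl. unfold mult; simpl. ring. }
  (* For positive [r] the difference quotient of [r u'(r)] at 0 is [u'(r)], which tends to
     [u'(0) = 0]. *)
  assert (HA0 : is_derive A 0 0).
  { apply is_derive_Reals. intros e He.
    destruct (within_eps _ _ _ e (C1 0 I0) He) as (d & Hd & Hdd).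
    assert (Hd1 : 0 < Rmin d 1) by (apply Rmin_pos; lra).
    exists (mkposreal _ Hd1). intros z Hz Hzd. simpl in Hzd.
    assert (M1 := Rmin_l d 1). assert (M2 := Rmin_r d 1).
    assert (EA0 : A 0 = 0) by (unfold A; destruct (Rle_dec 0 0); lra).
    rewrite Rplus_0_l, EA0. unfold A. destruct (Rle_dec z 0) as [Hle|Hle].
    - replace ((0 - 0) / z - 0) with 0 by (field; lra). rewrite Rabs_R0. exact He.
    - replace ((z * u1 z - 0) / z - 0) with (u1 z - u1 0) by (rewrite H10; field; lra).
      rewrite Rabs_pos_eq in Hzd by lra. apply Hdd; [unfold icc; lra|].
      rewrite Rminus_0_r, Rabs_pos_eq; lra. }
  assert (EA'0 : A' 0 = 0) by (unfold A'; destruct (Rle_dec 0 0); lra).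
  assert (HAd : forall r, 0 <= r < 1 -> is_derive A r (A' r)).
  { intros r Hr. destruct (Rle_lt_or_eq_dec 0 r (proj1 Hr)) as [Hlt|<-].
    - apply HAp; lra.
    - rewrite EA'0. exact HA0. }
  assert (HA'eq : forall r, 0 < r < 1 -> A' r = - (lam * f (u r) * r)).
  { intros r Hr. unfold A'. destruct (Rle_dec r 0); [lra|].
    assert (E := Heq r Hr).
    replace (lam * f (u r) * r) with ((lam * f (u r)) * r) by ring. rewrite <- E. field. lra. }
  assert (HA'c : forall r, 0 <= r < 1 -> continuous A' r).
  { intros r Hr. destruct (Rle_lt_or_eq_dec 0 r (proj1 Hr)) as [Hlt|<-].
    - apply continuous_ext_loc with (fun r => u1 r + r * u2 r).
      + generalize (locally_positive r Hlt). apply filter_imp. intros y Hy. unfold A'. destruct (Rle_dec y 0); [lra|reflexivity].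
      + apply (continuous_plus u1 (fun r => r * u2 r)).
        * apply (ex_derive_continuous u1). eexists. apply (derivative_on_icc 0 1 u1 u2); [exact Hu1|lra].
        * apply (continuous_mult (fun r => r) u2); [apply continuous_id|].
          apply (continuous_continuous_on (icc 0 1)); [apply icc_locally; lra|exact Hu2c].
    - apply filterlim_locally. intros [e He]. rewrite EA'0. simpl.
      destruct (within_eps _ _ _ (e / 2) (C1 0 I0) ltac:(lra)) as (d1 & Hd1 & Hdd1).
      destruct (within_eps _ _ _ 1 (Hu2c 0 I0) ltac:(lra)) as (d2 & Hd2 & Hdd2).
      set (Mb := Rabs (u2 0) + 1).
      assert (HMb : 0 < Mb) by (unfold Mb; assert (K := Rabs_pos (u2 0)); lra).
      set (d := Rmin (Rmin d1 d2) (Rmin 1 (e / 2 / Mb))).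
      assert (Hd : 0 < d).
      { apply Rmin_pos; apply Rmin_pos; try lra. apply Rdiv_lt_0_compat; lra. }
      assert (D1 : d <= d1) by (eapply Rle_trans; apply Rmin_l).
      assert (D2 : d <= d2) by (eapply Rle_trans; [apply Rmin_l|apply Rmin_r]).
      assert (D3 : d <= 1) by (eapply Rle_trans; [apply Rmin_r|apply Rmin_l]).
      assert (D4 : d <= e / 2 / Mb) by (eapply Rle_trans; [apply Rmin_r|apply Rmin_r]).
      exists (mkposreal d Hd). intros y Hy. change (Rabs (y - 0) < d) in Hy.
      change (Rabs (A' y - 0) < e). unfold A'. destruct (Rle_dec y 0) as [Hle|Hle].
      + rewrite Rminus_0_r, Rabs_R0. exact He.
      + assert (Hy' := Hy). rewrite Rminus_0_r, Rabs_pos_eq in Hy' by lra.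
        assert (Iy : icc 0 1 y) by (unfold icc; lra).
        assert (K1 := Hdd1 y Iy ltac:(lra)). assert (K2 := Hdd2 y Iy ltac:(lra)).
        rewrite H10, Rminus_0_r in K1.
        assert (K3 : Rabs (u2 y) <= Mb).
        { unfold Mb. replace (u2 y) with ((u2 y - u2 0) + u2 0) by ring.
          eapply Rle_trans; [apply Rabs_triang|]. lra. }
        rewrite Rminus_0_r. eapply Rle_lt_trans; [apply Rabs_triang|].
        rewrite Rabs_mult, (Rabs_pos_eq y) by lra.
        assert (y * Rabs (u2 y) <= e / 2 / Mb * Mb).
        { apply Rmult_le_compat; [lra|apply Rabs_pos|lra|exact K3]. }
        rewrite div_mult_cancel in H by exact HMb. lra. }
  assert (EA0 : A 0 = 0) by (unfold A; destruct (Rle_dec 0 0); lra).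
  assert (HAneg : forall r, 0 < r < 1 -> A r <= 0).
  { intros r Hr. assert (K := deriv_le_ge A A' 0 0 r ltac:(lra)).
    assert (A r - A 0 <= 0 * (r - 0)); [|lra].
    apply K; intros x Hx; [apply HAd; lra|].
    destruct (Rle_lt_or_eq_dec 0 x (proj1 Hx)) as [Hlt|<-]; [|lra].
    rewrite HA'eq by lra.
    assert (0 <= lam * f (u x) * x); [|lra].
    apply Rmult_le_pos; [|lra]. apply Rmult_le_pos; [lra|]. apply Hf. left; apply Hpos; lra. }
  assert (HVA : forall s, s < 0 -> Derive V s = A (exp s)).
  { intros s Hs. rewrite HDV by exact Hs. unfold A.
    destruct (Rle_dec (exp s) 0); [assert (K := exp_pos s); lra|reflexivity]. }
  assert (Hloc0 : forall s, s < 0 -> locally s (fun t => t < 0)).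
  { intros s Hs. assert (Hs' : 0 < - s) by lra. exists (mkposreal _ Hs'). intros y Hy.
    change (Rabs (y - s) < - s) in Hy. apply Rabs_lt_between in Hy. lra. }
  assert (Hdecr : forall s, s < 0 -> Derive V s <= 0).
  { intros s Hs. rewrite HVA by exact Hs. apply HAneg, Hexp, Hs. }
  assert (Hstart : forall e, 0 < e -> exists d, d < 0 /\ forall s, s < d -> Rabs (V s - mu) < e).
  { intros e He. destruct (within_eps _ _ _ e (C0 0 I0) He) as (d & Hd & Hdd).
    assert (Hd1 : 0 < Rmin d (1/2)) by (apply Rmin_pos; lra).
    assert (M1 := Rmin_l d (1/2)). assert (M2 := Rmin_r d (1/2)).
    exists (ln (Rmin d (1/2))). split.
    - rewrite <- ln_1. apply ln_increasing; lra.
    - intros s Hs. apply exp_increasing in Hs. rewrite exp_ln in Hs by exact Hd1.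
      assert (K := exp_pos s). rewrite <- H0. apply Hdd; [unfold icc; lra|].
      rewrite Rminus_0_r, Rabs_pos_eq; lra. }
  split.
  - constructor; auto.
    + intros s Hs. fold V. rewrite HDV by exact Hs. apply HdV, Hs.
    + intros s Hs. fold V.
      apply is_derive_ext_loc with (fun s => A (exp s)).
      * generalize (Hloc0 s Hs). apply filter_imp. intros t Ht. symmetry. apply HVA, Ht.
      * evar_last.
        -- apply (is_derive_comp A exp); [apply HAp, Hexp, Hs|apply is_derive_exp].
        -- rewrite HA'eq by (apply Hexp, Hs). unfold source.
           replace (2 * s) with (s + s) by ring. rewrite exp_plus.
           simpl. unfold scal; simpl. unfold mult; simpl. unfold V. ring.
    + intros s Hs. split; [apply Hpos, Hexp, Hs|]. fold (V s).
      (* [V] is nonincreasing and tends to [mu] as [s] tends to minus infinity, so it never exceeds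
         [mu]. *)
      apply Rnot_lt_le. intros Hlt.
      destruct (Hstart (V s - mu) ltac:(lra)) as (d & Hd & Hdd).
      set (t := Rmin s d - 1). assert (M1 := Rmin_l s d). assert (M2 := Rmin_r s d).
      assert (K := Hdd t ltac:(unfold t; lra)). apply Rabs_lt_between in K.
      assert (V s - V t <= 0 * (s - t)); [|lra].
      apply (deriv_le_ge V (Derive V)); [unfold t; lra| |]; intros x Hx.
      * rewrite HDV by lra. apply HdV; lra.
      * apply Hdecr; lra.
    + intros e He. destruct (within_eps _ _ _ e (C0 1 I1) He) as (d & Hd & Hdd).
      assert (M1 := Rmax_l (1/2) (1 - d)). assert (M2 := Rmax_r (1/2) (1 - d)).
      assert (M3 : Rmax (1/2) (1 - d) < 1) by (apply Rmax_lub_lt; lra).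
      exists (ln (Rmax (1/2) (1 - d))). split.
      * rewrite <- ln_1. apply ln_increasing; lra.
      * intros s [Hs1 Hs2]. apply exp_increasing in Hs1. rewrite exp_ln in Hs1 by lra.
        destruct (Hexp s Hs2) as [E1 E2].
        assert (K := Hdd (exp s) ltac:(unfold icc; lra)).
        rewrite H11, Rminus_0_r in K.
        assert (K2 : Rabs (exp s - 1) < d) by (rewrite Rabs_left1; lra).
        specialize (K K2). apply Rabs_lt_between in K. apply K.
    + intros e He. destruct (Hstart e He) as (d & Hd & Hdd). exists d; split; [exact Hd|].
      intros s Hs. specialize (Hdd s Hs). apply Rabs_lt_between in Hdd. fold (V s). lra.
  - intros b Hb. fold V.
    assert (Hlnb : ln b < 0) by (rewrite <- ln_1; apply ln_increasing; lra).
    rewrite HVA by exact Hlnb. rewrite exp_ln by lra.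
    apply is_RInt_unique.
    assert (KI : is_RInt A' 0 b (minus (A b) (A 0))).
    { apply (is_RInt_derive A A'); rewrite Rmin_left, Rmax_right by lra; intros x Hx.
      - apply HAd; lra.
      - apply HA'c; lra. }
    assert (KO : is_RInt (fun x => opp (A' x)) 0 b (- A b)).
    { replace (- A b) with (opp (minus (A b) (A 0))).
      - exact (is_RInt_opp (V := R_NormedModule) A' 0 b _ KI).
      - rewrite EA0. unfold minus, plus, opp; simpl. ring. }
    apply is_RInt_ext with (2 := KO). rewrite Rmin_left, Rmax_right by lra.
    intros x Hx. rewrite HA'eq by lra. unfold opp; simpl. ring.
Qed.

(** By the chain rule, [- V'(ln x)] is a primitive of the integrand. *)
Lemma trajectory_RInt (f : R -> R) (lam mu : R) (u : R -> R) (a b : R) :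
  trajectory f lam mu (fun s => u (exp s)) (Derive (fun s => u (exp s))) ->
  (forall t, 0 < t -> continuous f t) -> 0 < a <= b -> b < 1 ->
  is_RInt (fun x => lam * f (u x) * x) a b
    (Derive (fun s => u (exp s)) (ln a) - Derive (fun s => u (exp s)) (ln b)).
Proof.
  intros Ht Hfc Hab Hb. set (V := fun s => u (exp s)) in *.
  set (F := fun x => - Derive V (ln x)).
  assert (Hln : forall x, a <= x <= b -> ln x < 0).
  { intros x Hx. rewrite <- ln_1. apply ln_increasing; lra. }
  assert (KI : is_RInt (fun x => lam * f (u x) * x) a b (minus (F b) (F a))).
  { apply (is_RInt_derive F); rewrite Rmin_left, Rmax_right by lra; intros x Hx.
    - unfold F. assert (K := traj_d2 _ _ _ _ _ Ht (ln x) (Hln x Hx)).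
      assert (K2 : is_derive (fun x => Derive V (ln x)) x (/ x * - source f lam V (ln x))).
      { apply (is_derive_comp (Derive V) ln); [exact K|apply is_derive_ln; lra]. }
      replace (lam * f (u x) * x) with (- (/ x * - source f lam V (ln x))).
      + apply (is_derive_opp (fun x => Derive V (ln x))). exact K2.
      + unfold source, V. replace (2 * ln x) with (ln x + ln x) by ring.
        rewrite exp_plus, exp_ln by lra. field. lra.
    - assert (Hu : continuous u x).
      { apply continuous_ext_loc with (fun x => V (ln x)).
        - assert (Hx0 : 0 < x) by lra. generalize (locally_positive x Hx0). apply filter_imp. intros y Hy.
          unfold V. rewrite exp_ln by lra. reflexivity.
        - apply (continuous_comp ln V).
          + apply (ex_derive_continuous ln). eexists. apply is_derive_ln; lra.
          + apply (ex_derive_continuous V). eexists. apply (traj_d1 _ _ _ _ _ Ht). apply Hln, Hx. }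
      apply (continuous_mult (fun x => lam * f (u x)) (fun x => x)); [|apply continuous_id].
      apply (continuous_mult (fun _ => lam) (fun x => f (u x))); [apply continuous_const|].
      apply (continuous_comp u f); [exact Hu|]. apply Hfc.
      destruct (traj_range _ _ _ _ _ Ht (ln x) (Hln x Hx)) as [R1 _].
      unfold V in R1. rewrite exp_ln in R1 by lra. exact R1. }
  replace (Derive V (ln a) - Derive V (ln b)) with (minus (F b) (F a)); [exact KI|].
  unfold F, minus, plus, opp; simpl. ring.
Qed.

(** * The first concentration and the profiles *)

(** With [x = rho0 / gamma0] the density at [rho0] is [x^2 f(u(rho0)) / f(mu)]. The profile falls
    like [- 4 ln x], and by convexity of [t^p] the decay of [ln f] keeps a fixed fraction of it; a
    fraction above one half beats the factor [x^2]. The logarithm is [o(mu^p)] because both heights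
    are asymptotic to [mu]. *)
Lemma base_plateau (p : R) (f : R -> R) (lam mu : nat -> R) (u : nat -> R -> R) (rho0 : nat -> R) :
  1 <= p -> exp_type p f -> is_lim_seq mu p_infty ->
  (forall n, trajectory f (lam n) (mu n) (fun s => u n (exp s)) (Derive (fun s => u n (exp s)))) ->
  (forall n b, 0 < b < 1 -> RInt (fun x => lam n * f (u n x) * x) 0 b
     = - Derive (fun s => u n (exp s)) (ln b)) ->
  first_concentration p f lam mu u rho0 ->
  plateau p f lam mu (fun n s => u n (exp s)) (fun n => Derive (fun s => u n (exp s)))
    1 4 (fun n => ln (rho0 n)).
Proof.
  intros Hp Hf Hmu Htr HR (Hrho & gam & Hgam & _ & _ & Hx & Hv & (N & HN & HN0) & HI).
  set (V := fun n s => u n (exp s)) in *.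
  assert (Hln : forall n, ln (rho0 n) < 0).
  { intros n. rewrite <- ln_1. apply ln_increasing; apply Hrho. }
  assert (HVr : forall n, V n (ln (rho0 n)) = u n (rho0 n)).
  { intros n. unfold V. rewrite exp_ln by apply Hrho. reflexivity. }
  assert (Hmu0 : forall n, 0 < mu n) by (intros n; apply (traj_mu _ _ _ _ _ (Htr n))).
  assert (LV : is_lim_seq (fun n => V n (ln (rho0 n)) / mu n) 1).
  { apply is_lim_seq_ext with (2 := Hv). intros n. rewrite HVr. reflexivity. }
  set (x := fun n => rho0 n / gam n) in *.
  assert (Hx0 : forall n, 0 < x n) by (intros n; apply Rdiv_lt_0_compat; [apply Hrho|apply Hgam]).
  set (dn := fun n => dens p f (lam n) (mu n) (V n) (ln (rho0 n))).
  assert (Hfmu : forall n, 0 < f (mu n)).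
  { intros n. destruct (Hgam n) as [G1 G2]. rewrite rpow_pos_eq in G2 by apply Hmu0.
    assert (F := proj1 Hf (mu n) ltac:(left; apply Hmu0)).
    destruct (Rle_lt_or_eq_dec _ _ F) as [F'|F']; [exact F'|]. rewrite <- F' in G2. lra. }
  assert (Hdn : forall n, dn n = x n ^ 2 * f (V n (ln (rho0 n))) / f (mu n)).
  { intros n. unfold dn, dens, source, x. destruct (Hgam n) as [G1 G2].
    rewrite rpow_pos_eq in G2 by apply Hmu0.
    assert (L := traj_lam _ _ _ _ _ (Htr n)). assert (R1 := proj1 (Hrho n)). assert (F := Hfmu n).
    replace (2 * ln (rho0 n)) with (ln (rho0 n) + ln (rho0 n)) by ring.
    rewrite exp_plus, exp_ln by exact R1.
    replace (p * Rpower (mu n) (p - 1) * (lam n * (rho0 n * rho0 n) * f (V n (ln (rho0 n)))))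
      with ((p * lam n * Rpower (mu n) (p - 1) * f (mu n) * gam n ^ 2) *
        ((rho0 n / gam n) ^ 2 * f (V n (ln (rho0 n))) / f (mu n))) by (field; lra).
    rewrite G2. ring. }
  set (z := fun n => p * Rpower (mu n) (p - 1) * (V n (ln (rho0 n)) - mu n)).
  assert (Hz : eventually (fun n => Rabs (z n - profile0 (x n)) <= 1)).
  { assert (N1 := lim_eventually_lt _ _ 1 HN0 ltac:(lra)).
    generalize (filter_and _ _ HN N1). apply filter_imp. intros n [(w' & N0 & N2 & _ & S0 & (_ & S1) & HNe) Hlt].
    assert (I0 : icc 0 (x n) (x n)) by (unfold icc; assert (K := Hx0 n); lra).
    assert (B0 : Rabs (z n - profile0 (x n)) <= N0).
    { apply S0. exists (x n). split; [exact I0|]. f_equal. unfold z, x.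
      rewrite rpow_pos_eq by apply Hmu0. rewrite HVr. repeat f_equal.
      destruct (Hgam n). field. lra. }
    assert (B1 : 0 <= N2).
    { eapply Rle_trans; [apply Rabs_pos|]. apply S1. exists (x n). split; [exact I0|reflexivity]. }
    lra. }
  assert (Hp0 : forall y, 0 < y -> profile0 y <= ln 64 - 4 * ln y).
  { intros y Hy. unfold profile0.
    assert (Hy2 : 0 < y ^ 2) by (apply pow_lt; exact Hy).
    rewrite Rcomplements.ln_div by (try apply pow_lt; lra).
    replace ((8 + y ^ 2) ^ 2) with ((8 + y ^ 2) * (8 + y ^ 2)) by ring.
    rewrite ln_mult by lra.
    assert (K : ln (y * y) <= ln (8 + y ^ 2)) by (left; apply ln_increasing; nra).
    rewrite ln_mult in K by exact Hy. lra. }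
  destruct (exp_type_log p f (1/8) Hf) as (T & HT & Hfpos & Hlog); [lra|].
  assert (HbigV := lim_scaled_infty _ _ _ T Rlt_0_1 Hmu LV).
  assert (LVp := lim_Rpower _ _ (p - 1) Rlt_0_1 LV).
  replace (Rpower 1 (p - 1)) with 1 in LVp by (unfold Rpower; rewrite ln_1, Rmult_0_r, exp_0; reflexivity).
  assert (HVp := lim_eventually_gt _ _ (6/7) LVp ltac:(lra)).
  (* The factor [7/8] of [Hlog] times the factor [6/7] of [HVp] is [3/4], and [2 ln x - 3/4 * (4 ln
     x - ln 64 - 1) = C - ln x]. *)
  set (C := 3 / 4 * (ln 64 + 1)).
  assert (Hup : eventually (fun n => 0 < dn n /\ ln (dn n) <= C - ln (x n) /\
     ln (dn n) = 2 * ln (x n) + (ln (f (V n (ln (rho0 n)))) - ln (f (mu n))))).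
  { generalize (filter_and _ _ Hz (filter_and _ _ HbigV HVp)). apply filter_imp.
    intros n (K1 & K2 & K3).
    destruct (traj_range _ _ _ _ _ (Htr n) _ (Hln n)) as [R1 R2].
    change (u n (exp (ln (rho0 n)))) with (V n (ln (rho0 n))) in R1, R2.
    set (W := V n (ln (rho0 n))) in *.
    assert (FW : 0 < f W) by (apply Hfpos; lra).
    assert (Hxn := Hx0 n). assert (Hmun := Hmu0 n). assert (Fm := Hfmu n).
    assert (Hx2 : 0 < x n ^ 2) by (apply pow_lt; exact Hxn).
    assert (E : ln (dn n) = 2 * ln (x n) + (ln (f W) - ln (f (mu n)))).
    { rewrite Hdn. fold W. rewrite Rcomplements.ln_div by (try apply Rmult_lt_0_compat; assumption).
      rewrite ln_mult by assumption.
      replace (x n ^ 2) with (x n * x n) by ring. rewrite ln_mult by assumption. ring. }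
    split; [rewrite Hdn; fold W; apply Rdiv_lt_0_compat; [apply Rmult_lt_0_compat|]; assumption|].
    split; [|exact E]. rewrite E.
    destruct (Hlog W (mu n) ltac:(lra)) as [L1 _].
    assert (Tg := Rpower_tangent p W (mu n) Hp R1 Hmun).
    assert (Hz' : p * Rpower W (p - 1) * (mu n - W) = Rpower (W / mu n) (p - 1) * (- z n)).
    { unfold z. fold W. rewrite Rpower_div by assumption. assert (P := Rpower_pos (mu n) (p - 1)).
      field. lra. }
    rewrite Hz' in Tg.
    assert (Hzn : z n <= 0).
    { unfold z. fold W. assert (P := Rpower_pos (mu n) (p - 1)).
      assert (0 <= p * Rpower (mu n) (p - 1)) by (apply Rmult_le_pos; lra). nra. }
    assert (6 / 7 * (- z n) <= Rpower (W / mu n) (p - 1) * (- z n)) by (apply Rmult_le_compat_r; lra).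
    apply Rabs_le_between in K1. assert (P0 := Hp0 (x n) Hxn). unfold C. lra. }
  assert (Hlnx : eventually (fun n => C < ln (x n) /\ 1 <= x n)).
  { generalize (lim_infty_eventually _ (Rmax 1 (exp C)) Hx). apply filter_imp. intros n Hn.
    change (rho0 n / gam n) with (x n) in Hn.
    assert (M1 := Rmax_l 1 (exp C)). assert (M2 := Rmax_r 1 (exp C)).
    split; [|lra]. rewrite <- (ln_exp C). apply ln_increasing; [apply exp_pos|lra]. }
  constructor.
  - exists 0%nat. intros n _. apply Hln.
  - exact LV.
  - apply is_lim_seq_ext with (2 := HI). intros n. rewrite HR by apply Hrho.
    unfold flux. rewrite rpow_pos_eq by apply Hmu0. unfold V. ring.
  - apply lim_squeeze with (fun _ => 0) (fun n => exp C * / x n).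
    + generalize Hup. apply filter_imp. intros n (K1 & K2 & _). fold (dn n).
      split; [lra|]. rewrite <- (exp_ln (dn n)) by exact K1.
      rewrite <- (exp_ln (x n)) at 1 by apply Hx0. rewrite <- exp_Ropp, <- exp_plus.
      apply exp_le. lra.
    + apply is_lim_seq_const.
    + replace 0 with (exp C * 0) by ring. apply lim_scal.
      apply (is_lim_seq_inv x p_infty Hx). discriminate.
  - assert (LL := log_ratio_lim p f mu (fun n => V n (ln (rho0 n))) mu 1 1 ltac:(lra) Hf Hmu
      Rlt_0_1 Rlt_0_1 LV).
    assert (L1 : is_lim_seq (fun n => mu n / mu n) 1).
    { apply is_lim_seq_ext with (fun _ => 1); [|apply is_lim_seq_const].
      intros n. assert (K := Hmu0 n). field. lra. }
    specialize (LL L1). rewrite Rminus_diag in LL.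
    (* From below the term [2 ln x >= 0] is dropped; from above [ln (dn n) <= C - ln x < 0]. *)
    apply lim_squeeze with (2 := LL) (w := fun _ => 0); [|apply is_lim_seq_const].
    generalize (filter_and _ _ Hup Hlnx). apply filter_imp. intros n [(K1 & K2 & K3) (K4 & K5)].
    fold (dn n). assert (P := Rpower_pos (mu n) p).
    assert (0 <= ln (x n)) by (rewrite <- ln_1; apply Rcomplements.ln_le; lra).
    split; apply Rmult_le_reg_r with (Rpower (mu n) p); try exact P;
      rewrite !div_mult_cancel by exact P; lra.
Qed.

(** The slopes at the two ends of a long time window give the fluxes at [rhobar] and [rho], and
    hence the masses. *)
Lemma log_profile_left (a e : R) : 0 < a -> 0 < e ->
  exists T, forall t, t <= - T -> Rabs (log_profile' a t + (2 - a)) <= e.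
Proof.
  intros Ha He. assert (Hb := log_profile_coef_pos a).
  set (q := e / (2 * a * log_profile_coef a)).
  assert (Hab : 0 < 2 * a * log_profile_coef a) by (apply Rmult_lt_0_compat; lra).
  assert (Hq : 0 < q) by (apply Rdiv_lt_0_compat; lra).
  exists (- (ln q / a)). intros t Ht.
  assert (H1 : exp (a * t) <= q).
  { rewrite <- (exp_ln q) by exact Hq. apply exp_le.
    apply Rle_trans with (a * (ln q / a)); [apply Rmult_le_compat_l; lra|right; field; lra]. }
  assert (H2 := exp_pos (a * t)). unfold log_profile'. set (b := log_profile_coef a) in *.
  set (x := exp (a * t)) in *.
  assert (Hbx : 0 < b * x) by (apply Rmult_lt_0_compat; lra).
  replace (- (2 - a) - 2 * a * (b * x) / (1 + b * x) + (2 - a)) with (- (2 * a * (b * x) / (1 + b * x))) by ring.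
  rewrite Rabs_Ropp, Rabs_pos_eq by (apply Rdiv_le_0_compat; nra).
  assert (H3 : 2 * a * b * x <= e).
  { apply Rle_trans with (2 * a * b * q); [apply Rmult_le_compat_l; lra|].
    unfold q. right; field; lra. }
  apply Rmult_le_reg_r with (1 + b * x); [lra|]. rewrite div_mult_cancel by lra. nra.
Qed.

Lemma log_profile_right (a e : R) : 0 < a -> 0 < e ->
  exists T, forall t, T <= t ->
    Rabs (log_profile' a t + (2 + a)) <= e /\ Rabs (log_profile'' a t) <= e.
Proof.
  intros Ha He. assert (Hb := log_profile_coef_pos a).
  set (q := (2 * a + 2 * a ^ 2) / e / log_profile_coef a).
  assert (Hq : 0 < q) by (repeat apply Rdiv_lt_0_compat; nra).
  exists (ln q / a). intros t Ht.
  assert (H1 : q <= exp (a * t)).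
  { rewrite <- (exp_ln q) by exact Hq. apply exp_le.
    apply Rle_trans with (a * (ln q / a)); [right; field; lra|apply Rmult_le_compat_l; lra]. }
  assert (H2 := exp_pos (a * t)). unfold log_profile', log_profile''. set (b := log_profile_coef a) in *.
  set (x := exp (a * t)) in *.
  assert (Hbx : 0 < b * x) by (apply Rmult_lt_0_compat; lra).
  assert (H3 : 2 * a + 2 * a ^ 2 <= e * (b * x)).
  { apply Rle_trans with (e * (b * q)).
    - unfold q. right; field; lra.
    - apply Rmult_le_compat_l; [lra|]. apply Rmult_le_compat_l; lra. }
  split.
  - replace (- (2 - a) - 2 * a * (b * x) / (1 + b * x) + (2 + a)) with (2 * a / (1 + b * x)) by (field; lra).
    rewrite Rabs_pos_eq by (apply Rdiv_le_0_compat; lra).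
    apply Rmult_le_reg_r with (1 + b * x); [lra|]. rewrite div_mult_cancel by lra. nra.
  - replace (- (2 * a ^ 2 * (b * x)) / (1 + b * x) ^ 2) with (- (2 * a ^ 2 * (b * x) / (1 + b * x) ^ 2))
      by (unfold Rdiv; ring).
    assert (Hsq : 0 < (1 + b * x) ^ 2) by (apply pow_lt; lra).
    rewrite Rabs_Ropp, Rabs_pos_eq by (apply Rdiv_le_0_compat; nra).
    apply Rmult_le_reg_r with ((1 + b * x) ^ 2); [lra|]. rewrite div_mult_cancel by lra.
    set (y := b * x) in *.
    nra.
Qed.

Lemma is_derive_profile (a x : R) : 0 < a -> 0 < x ->
  is_derive (profile a) x (log_profile' a (ln x) / x).
Proof.
  intros Ha Hx. apply is_derive_ext_loc with (fun x => log_profile a (ln x)).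
  - generalize (locally_positive x Hx). apply filter_imp. intros y Hy. symmetry. apply profile_log; lra.
  - evar_last.
    + apply (is_derive_comp (log_profile a) ln); [apply is_derive_log_profile|apply is_derive_ln, Hx].
    + simpl. unfold scal; simpl. unfold mult; simpl. unfold Rdiv. ring.
Qed.

Lemma is_derive_profile' (a x : R) : 0 < x ->
  is_derive (fun x => log_profile' a (ln x) / x) x
    ((log_profile'' a (ln x) - log_profile' a (ln x)) / x ^ 2).
Proof.
  intros Hx.
  assert (K : is_derive (fun x => log_profile' a (ln x)) x (/ x * log_profile'' a (ln x))).
  { apply (is_derive_comp (log_profile' a) ln); [apply is_derive_log_profile'|apply is_derive_ln, Hx]. }
  evar_last.
  - apply (is_derive_div (fun x => log_profile' a (ln x)) (fun x => x)); [exact K|apply is_derive_id|lra].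
  - unfold one; simpl. field. lra.
Qed.

Lemma profile_solves_liouville (a : R) : 0 < a -> solves_liouville (profile a).
Proof.
  intros Ha r Hr.
  assert (D1 := is_derive_profile a r Ha Hr).
  assert (D2 : is_derive (Derive (profile a)) r
     ((log_profile'' a (ln r) - log_profile' a (ln r)) / r ^ 2)).
  { apply is_derive_ext_loc with (fun x => log_profile' a (ln x) / x).
    - generalize (locally_positive r Hr). apply filter_imp. intros y Hy. symmetry. apply is_derive_unique, is_derive_profile; lra.
    - apply is_derive_profile', Hr. }
  split; [eexists; exact D1|]. split; [eexists; exact D2|].
  rewrite (is_derive_unique _ _ _ D1), (is_derive_unique _ _ _ D2), profile_log by assumption.
  rewrite log_profile''_eq by exact Ha.
  replace (2 * ln r + log_profile a (ln r)) with (ln r + ln r + log_profile a (ln r)) by ring.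
  rewrite !exp_plus, exp_ln by exact Hr. field. lra.
Qed.

Lemma profile_at_center (a : R) : 0 < a -> profile a (a / sqrt 2) = 0.
Proof.
  intros Ha. rewrite profile_log; [|exact Ha|apply sqrt2_div_pos, Ha].
  apply log_profile_at_center, Ha.
Qed.

Lemma profile'_at_center (a : R) : 0 < a ->
  - (a / sqrt 2) * Derive (profile a) (a / sqrt 2) = 2.
Proof.
  intros Ha. assert (Hs := sqrt2_div_pos a Ha).
  rewrite (is_derive_unique _ _ _ (is_derive_profile a _ Ha Hs)).
  rewrite log_profile'_at_center by exact Ha. set (c := a / sqrt 2) in *. field. lra.
Qed.

(** By the Liouville equation [- r z'(r)] is a primitive of [e^z r]; it increases from [2 - a] at 0
    to [2 + a] at infinity. *)
Lemma profile_mass (a : R) : 0 < a ->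
  is_RInt_gen (fun x => exp (profile a x) * x) (at_right 0) (Rbar_locally p_infty) (2 * a).
Proof.
  intros Ha.
  set (F := fun x => - log_profile' a (ln x)).
  assert (HF : forall x, 0 < x -> is_derive F x (exp (profile a x) * x)).
  { intros x Hx. unfold F. rewrite profile_log by assumption.
    evar_last.
    - apply (is_derive_opp (fun x => log_profile' a (ln x))).
      apply (is_derive_comp (log_profile' a) ln); [apply is_derive_log_profile'|apply is_derive_ln, Hx].
    - rewrite log_profile''_eq by exact Ha.
      replace (2 * ln x + log_profile a (ln x)) with (ln x + ln x + log_profile a (ln x)) by ring.
      rewrite !exp_plus, exp_ln by exact Hx.
      unfold opp, scal; simpl. unfold mult; simpl. field. lra. }
  assert (Hprod : forall P : R -> Prop, (forall x, 0 < x -> P x) ->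
    filter_prod (at_right 0) (Rbar_locally p_infty)
      (fun ab => forall x, Rmin (fst ab) (snd ab) <= x <= Rmax (fst ab) (snd ab) -> P x)).
  { intros P HP. apply Filter_prod with (fun x => 0 < x) (fun x => 0 < x).
    - exists (mkposreal 1 Rlt_0_1). intros y _ Hy. exact Hy.
    - exists 0. auto.
    - intros x y Hx Hy z Hz. apply HP. simpl in Hz.
      eapply Rlt_le_trans; [|apply Hz]. apply Rmin_pos; assumption. }
  apply is_RInt_gen_ext with (Derive F).
  { generalize (Hprod (fun x => Derive F x = exp (profile a x) * x)
      (fun x Hx => is_derive_unique _ _ _ (HF x Hx))). apply filter_imp.
    intros ab H x Hx. apply H. lra. }
  replace (2 * a) with ((2 + a) - (2 - a)) by ring.
  apply is_RInt_gen_Derive.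
  - apply Hprod. intros x Hx. eexists. apply HF, Hx.
  - apply Hprod. intros x Hx.
    apply continuous_ext_loc with (fun x => exp (profile a x) * x).
    + generalize (locally_positive x Hx). apply filter_imp. intros y Hy. symmetry. apply is_derive_unique, HF. lra.
    + apply (continuous_mult (fun x => exp (profile a x)) (fun x => x)); [|apply continuous_id].
      apply (continuous_comp (profile a) exp).
      * apply (ex_derive_continuous (profile a)). eexists. apply is_derive_profile; assumption.
      * apply (ex_derive_continuous exp). eexists. apply is_derive_exp.
  - apply filterlim_locally. intros [e He].
    destruct (log_profile_left a (e / 2) Ha ltac:(lra)) as [T HT].
    exists (mkposreal (exp (- T)) (exp_pos _)). intros y Hy Hy0.
    change (Rabs (y - 0) < exp (- T)) in Hy. rewrite Rminus_0_r, Rabs_pos_eq in Hy by lra.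
    change (Rabs (F y - (2 - a)) < e). unfold F.
    assert (K : ln y <= - T) by (left; rewrite <- (ln_exp (- T)); apply ln_increasing; lra).
    specialize (HT _ K). rewrite <- Rabs_Ropp.
    replace (- (- log_profile' a (ln y) - (2 - a))) with (log_profile' a (ln y) + (2 - a)) by ring. lra.
  - apply filterlim_locally. intros [e He].
    destruct (log_profile_right a (e / 2) Ha ltac:(lra)) as [T HT].
    exists (exp T). intros y Hy.
    change (Rabs (F y - (2 + a)) < e). unfold F.
    assert (HeT := exp_pos T).
    assert (K : T <= ln y) by (left; rewrite <- (ln_exp T); apply ln_increasing; lra).
    destruct (HT _ K) as [HT1 _]. rewrite <- Rabs_Ropp.
    replace (- (- log_profile' a (ln y) - (2 + a))) with (log_profile' a (ln y) + (2 + a)) by ring. lra.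
Qed.

(** * Norms of differentiable functions on a set *)

Lemma derivative_on_of_is_derive (D : R -> Prop) (f f' : R -> R) :
  (forall x, D x -> is_derive f x (f' x)) -> derivative_on D f f'.
Proof.
  intros H x Dx. destruct (H x Dx) as [Hlin Hdom]. split; [exact Hlin|].
  intros x' Hx'.
  (* [filterdiff] quantifies over all limits of the filter; since [x] itself belongs to [D], every
     neighbourhood of such a limit contains [x]. *)
  assert (E : x' = x).
  { apply NNPP. intros Hne.
    assert (Hpos : 0 < Rabs (x - x')) by (apply Rabs_pos_lt; lra).
    assert (K := Hx' (fun y => Rabs (y - x') < Rabs (x - x'))
      ltac:(exists (mkposreal _ Hpos); intros y Hy; exact Hy)).
    unfold within in K. apply locally_singleton in K. specialize (K Dx). lra. }
  subst x'. intros eps.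
  assert (K := Hdom x ltac:(intros P HP; exact HP) eps).
  unfold within. revert K. apply filter_imp. auto.
Qed.

Lemma sup_norm_exists (D : R -> Prop) (w : R -> R) (x0 e : R) :
  D x0 -> (forall x, D x -> Rabs (w x) <= e) ->
  exists N, is_sup_norm D w N /\ 0 <= N <= e.
Proof.
  intros Hx0 Hb.
  destruct (completeness (fun y => exists x, D x /\ y = Rabs (w x))) as [N HN].
  - exists e. intros y (x & Dx & ->). apply Hb, Dx.
  - exists (Rabs (w x0)), x0. auto.
  - exists N. split; [exact HN|]. destruct HN as [H1 H2]. split.
    + eapply Rle_trans; [apply Rabs_pos|]. apply H1. exists x0; eauto.
    + apply H2. intros y (x & Dx & ->). apply Hb, Dx.
Qed.

Lemma C2_norm_small (D : R -> Prop) (w w1 w2 : R -> R) (x0 e : R) : D x0 ->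
  (forall x, D x -> is_derive w x (w1 x) /\ is_derive w1 x (w2 x) /\ continuous w2 x) ->
  (forall x, D x -> Rabs (w x) <= e /\ Rabs (w1 x) <= e /\ Rabs (w2 x) <= e) ->
  exists N, is_Ck_norm 2 D w N /\ 0 <= N <= 3 * e.
Proof.
  intros Hx0 Hd Hb.
  destruct (sup_norm_exists D w x0 e Hx0) as (N0 & S0 & B0); [intros x Hx; apply Hb, Hx|].
  destruct (sup_norm_exists D w1 x0 e Hx0) as (N1 & S1 & B1); [intros x Hx; apply Hb, Hx|].
  destruct (sup_norm_exists D w2 x0 e Hx0) as (N2 & S2 & B2); [intros x Hx; apply Hb, Hx|].
  exists (N0 + (N1 + N2)). split; [|lra].
  exists w1, N0, (N1 + N2). split; [apply derivative_on_of_is_derive; intros x Hx; apply Hd, Hx|].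
  split; [exact S0|]. split; [|reflexivity].
  exists w2, N1, N2. split; [apply derivative_on_of_is_derive; intros x Hx; apply Hd, Hx|].
  split; [exact S1|]. split; [|reflexivity].
  split; [|exact S2].
  intros x Hx P HP. assert (K := proj2 (proj2 (Hd x Hx)) P HP).
  unfold filtermap, within in *. revert K. apply filter_imp. auto.
Qed.

(** * The radii of a concentration *)

(** Near the origin [V] is close to [mu], where [f] is positive. Such a point serves as default
    center at small indices, where the scale [gamma] must already be defined. *)
Lemma trajectory_positive_source (f : R -> R) (lam mu : R) (V V1 : R -> R) :
  trajectory f lam mu V V1 -> (forall t, 0 < t -> continuous f t) -> 0 < f mu ->
  exists s, s < 0 /\ 0 < f (V s).
Proof.
  intros Ht Hc Hmu.
  assert (Hm := traj_mu _ _ _ _ _ Ht).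
  destruct (proj1 (filterlim_locally _ _) (Hc mu Hm) (mkposreal _ Hmu)) as [d Hd].
  destruct (traj_start _ _ _ _ _ Ht d (cond_pos d)) as (s0 & Hs0 & Hs).
  exists (s0 - 1). split; [lra|].
  assert (K := Hs (s0 - 1) ltac:(lra)).
  destruct (traj_range _ _ _ _ _ Ht (s0 - 1) ltac:(lra)) as [R1 R2].
  assert (Hb : ball mu d (V (s0 - 1))).
  { change (Rabs (V (s0 - 1) - mu) < d). rewrite Rabs_left1; lra. }
  specialize (Hd _ Hb). change (Rabs (f (V (s0 - 1)) - f mu) < f mu) in Hd.
  apply Rabs_lt_between in Hd. lra.
Qed.

(** The conclusion of [bubble_exists] has a single tolerance, which also encodes divergence through
    [/ eps <= s - sg n], so one diagonal choice yields all the limits together. *)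
Lemma bubble_center (p : R) (f : R -> R) (lam mu : nat -> R) (V V1 : nat -> R -> R)
  (d A d' a' : R) (sg : nat -> R) :
  1 <= p -> exp_type p f -> is_lim_seq mu p_infty ->
  (forall n, trajectory f (lam n) (mu n) (V n) (V1 n)) ->
  (forall t, 0 < t -> continuous f t) -> (forall n, 0 < f (mu n)) ->
  plateau p f lam mu V V1 d A sg ->
  0 < d' < d -> 0 < A -> 0 < a' < 2 -> A * Rpower d' (p - 1) = 2 - a' ->
  2 * ((d - d') / (A / p)) + Rpower d' p - Rpower d p = 0 ->
  exists st : nat -> R,
    (forall n, st n < 0 /\ 0 < f (V n (st n))) /\
    is_lim_seq (fun n => st n - sg n) p_infty /\
    is_lim_seq (fun n => V n (st n) / mu n) d' /\
    is_lim_seq (fun n => flux p (mu n) (V1 n) (st n)) (2 / Rpower d' (p - 1)) /\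
    is_lim_seq (fun n => dens p f (lam n) (mu n) (V n) (st n))
      (a' ^ 2 / 2 / Rpower d' (p - 1)).
Proof.
  intros Hp Hf Hmu Htr Hc Hfm Hpl Hd HA Ha HAD HPhi.
  assert (HB := bubble_exists p f lam mu V V1 d A d' a' sg Hp Hf Hmu Htr Hpl Hd HA Ha HAD HPhi).
  set (D := Rpower d' (p - 1)) in *.
  assert (HD : 0 < D) by apply Rpower_pos.
  destruct (diagonal_choice (fun n s => s < 0 /\ 0 < f (V n s))
    (fun n e s => / e <= s - sg n /\ Rabs (V n s / mu n - d') <= e /\
      D * flux p (mu n) (V1 n) s = 2 /\
      Rabs (D * dens p f (lam n) (mu n) (V n) s - a' ^ 2 / 2) <= e))
    as (st & Hst & Hlim).
  - intros n. apply trajectory_positive_source with (lam n) (mu n) (V1 n); auto.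
  - intros n e e' s He (K1 & K2 & K3 & K4).
    assert (/ e' <= / e) by (apply Rinv_le_contravar; lra).
    repeat split; lra.
  - exact HB.
  - exists st. split; [exact Hst|]. split; [|split; [|split]].
    + apply is_lim_seq_spec. intros M. set (e := / (Rmax M 0 + 1)).
      assert (M1 := Rmax_l M 0). assert (M2 := Rmax_r M 0).
      assert (He : 0 < e) by (apply Rinv_0_lt_compat; lra).
      generalize (Hlim e He). apply filter_imp. intros n (K & _).
      unfold e in K. rewrite Rinv_inv in K. lra.
    + apply is_lim_seq_eps. intros e He. generalize (Hlim e He). apply filter_imp. intros n K. apply K.
    + apply lim_ext_ev with (fun _ => 2 / D); [|apply is_lim_seq_const].
      generalize (Hlim 1 Rlt_0_1). apply filter_imp. intros n (_ & _ & K & _).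
      rewrite <- K. field. lra.
    + apply is_lim_seq_ext with (fun n => D * dens p f (lam n) (mu n) (V n) (st n) / D).
      { intros n. field. lra. }
      apply lim_div; [lra| |apply is_lim_seq_const].
      apply is_lim_seq_eps. intros e He. generalize (Hlim e He). apply filter_imp. intros n K. apply K.
Qed.

Lemma lim_inv_infty (u : nat -> R) : is_lim_seq u p_infty -> is_lim_seq (fun n => / u n) 0.
Proof. intros H. apply (is_lim_seq_inv u p_infty H). discriminate. Qed.

(** Since [m] tends to infinity, a bounded rescaled difference does not change the height in units
    of [mu]. The factor [d^(p-1)] converts the normalization by [u(r_k)^(p-1)] into that by
    [mu^(p-1)]. The limit of the density is positive because [y2 < 0], so its logarithm is
    negligible against [mu^p]. *)
Lemma rescaled_limits (p : R) (f : R -> R) (lam mu : nat -> R) (V V1 : nat -> R -> R)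
  (d a : R) (st s m : nat -> R) (y y1 y2 : R) :
  1 < p -> is_lim_seq mu p_infty -> (forall n, 0 < mu n) -> 0 < d -> y2 < 0 ->
  (forall n, 0 < V n (st n)) ->
  is_lim_seq (fun n => V n (st n) / mu n) d ->
  (forall n, m n = p * Rpower (V n (st n)) (p - 1)) ->
  is_lim_seq (fun n => m n * (V n (s n) - V n (st n))) y ->
  is_lim_seq (fun n => m n * V1 n (s n)) y1 ->
  is_lim_seq (fun n => - (m n * source f (lam n) (V n) (s n))) y2 ->
  is_lim_seq (fun n => V n (s n) / mu n) d /\
  is_lim_seq (fun n => flux p (mu n) (V1 n) (s n)) (- y1 / Rpower d (p - 1)) /\
  is_lim_seq (fun n => dens p f (lam n) (mu n) (V n) (s n)) (- y2 / Rpower d (p - 1)) /\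
  is_lim_seq (fun n => ln (dens p f (lam n) (mu n) (V n) (s n)) / Rpower (mu n) p) 0.
Proof.
  intros Hp Hmu Hmu0 Hd Hy2 HU0 HU Hm L0 L1 L2.
  set (U := fun n => V n (st n)) in *.
  set (D := Rpower d (p - 1)). assert (HD : 0 < D) by apply Rpower_pos.
  assert (LUp : is_lim_seq (fun n => Rpower (U n / mu n) (p - 1)) D) by (apply lim_Rpower; assumption).
  assert (HUinf : is_lim_seq U p_infty).
  { apply is_lim_seq_spec. intros M. apply (lim_scaled_infty U mu d M Hd Hmu HU). }
  assert (Hmp : forall n, 0 < m n).
  { intros n. rewrite Hm. apply Rmult_lt_0_compat; [lra|apply Rpower_pos]. }
  assert (Hmm : forall n, p * Rpower (mu n) (p - 1) = m n / Rpower (U n / mu n) (p - 1)).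
  { intros n. rewrite Hm. fold (U n). rewrite Rpower_div by (apply HU0 || apply Hmu0).
    assert (P1 := Rpower_pos (mu n) (p - 1)). assert (P2 := Rpower_pos (U n) (p - 1)). field. lra. }
  assert (Lm : is_lim_seq m p_infty).
  { apply lim_infty_le with (fun n => Rpower (U n) (p - 1)); [apply lim_Rpower_infty; [lra|exact HUinf]|].
    exists 0%nat. intros n _. rewrite Hm. fold (U n). assert (P2 := Rpower_pos (U n) (p - 1)). nra. }
  assert (Ld : is_lim_seq (fun n => dens p f (lam n) (mu n) (V n) (s n)) (- y2 / D)).
  { apply is_lim_seq_ext with (fun n => - - (m n * source f (lam n) (V n) (s n)) / Rpower (U n / mu n) (p - 1)).
    { intros n. unfold dens. rewrite Hmm. unfold Rdiv. ring. }
    apply lim_div; [lra| |exact LUp]. apply is_lim_seq_opp in L2. exact L2. }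
  split; [|split; [|split]].
  - replace d with (d + y * 0 * 0) by ring.
    apply is_lim_seq_ext with (fun n => U n / mu n + m n * (V n (s n) - U n) * / m n * / mu n).
    { intros n. assert (K := Hmp n). assert (K2 := Hmu0 n). field. lra. }
    apply lim_plus; [exact HU|]. apply lim_mult; [|apply lim_inv_infty, Hmu].
    apply lim_mult; [exact L0|apply lim_inv_infty, Lm].
  - apply is_lim_seq_ext with (fun n => - (m n * V1 n (s n)) / Rpower (U n / mu n) (p - 1)).
    { intros n. unfold flux. rewrite Hmm. unfold Rdiv. ring. }
    apply lim_div; [lra| |exact LUp]. apply is_lim_seq_opp in L1. exact L1.
  - exact Ld.
  - replace 0 with (ln (- y2 / D) * 0) by ring. apply lim_mult.
    + apply (is_lim_seq_continuous ln _ (- y2 / D)); [|exact Ld].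
      apply continuity_pt_filterlim. apply (ex_derive_continuous ln).
      eexists. apply is_derive_ln. apply Rdiv_lt_0_compat; lra.
    + apply lim_inv_infty. apply lim_Rpower_infty; [lra|exact Hmu].
Qed.

Lemma is_derive_comp_ln (W W1 : R -> R) (x : R) : 0 < x -> is_derive W (ln x) (W1 (ln x)) ->
  is_derive (fun x => W (ln x)) x (W1 (ln x) / x).
Proof.
  intros Hx H. evar_last.
  - apply (is_derive_comp W ln); [exact H|apply is_derive_ln, Hx].
  - simpl. unfold scal; simpl. unfold mult; simpl. unfold Rdiv. ring.
Qed.

Lemma is_derive_comp_ln_div (W1 W2 : R -> R) (x : R) : 0 < x -> is_derive W1 (ln x) (W2 (ln x)) ->
  is_derive (fun x => W1 (ln x) / x) x ((W2 (ln x) - W1 (ln x)) / x ^ 2).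
Proof.
  intros Hx H. evar_last.
  - apply (is_derive_div (fun x => W1 (ln x)) (fun x => x));
      [apply (is_derive_comp_ln W1 W2); assumption|apply is_derive_id|lra].
  - unfold one; simpl. field. lra.
Qed.

Lemma continuous_source (f : R -> R) (lam mu : R) (V V1 : R -> R) (s : R) :
  trajectory f lam mu V V1 -> (forall t, 0 < t -> continuous f t) -> s < 0 ->
  continuous (source f lam V) s.
Proof.
  intros Ht Hc Hs. unfold source.
  apply (continuous_mult (fun s => lam * exp (2 * s)) (fun s => f (V s))).
  - apply (ex_derive_continuous (fun s => lam * exp (2 * s))). auto_derive. auto.
  - apply (continuous_comp V f).
    + apply (ex_derive_continuous V). eexists. apply (traj_d1 _ _ _ _ _ Ht s Hs).
    + apply Hc. apply (traj_range _ _ _ _ _ Ht s Hs).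
Qed.

Lemma continuous_log_profile'' (a t : R) : continuous (log_profile'' a) t.
Proof.
  apply (ex_derive_continuous (log_profile'' a)). unfold log_profile''.
  assert (Hb := log_profile_coef_pos a). assert (He := exp_pos (a * t)).
  assert (0 < log_profile_coef a * exp (a * t)) by (apply Rmult_lt_0_compat; assumption).
  auto_derive. apply Rgt_not_eq.
  repeat (apply Rmult_lt_0_compat; try lra).
Qed.

(** Passing from [t = ln x] back to [x] divides the first derivative by [x] and turns the second
    into [(W2 - W1) / x^2]. On [[e^(-T), e^T]] this costs at most the factor [2 exp (2 T)], which is
    harmless while [T] is fixed. *)
Lemma rescaled_C2_norm (f : R -> R) (lam mu a U m sc T e : R) (u : R -> R) :
  let V := fun s => u (exp s) in
  trajectory f lam mu V (Derive V) -> (forall t, 0 < t -> continuous f t) -> 0 < a -> 0 < T -> 0 < e ->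
  (forall t, - T <= t <= T -> sc + t < 0 /\
    Rabs (m * (V (sc + t) - U) - log_profile a t) <= e /\
    Rabs (m * Derive V (sc + t) - log_profile' a t) <= e /\
    Rabs (- (m * source f lam V (sc + t)) - log_profile'' a t) <= e) ->
  exists N, is_Ck_norm 2 (icc (exp (- T)) (exp T))
    (fun x => m * (u (exp sc * x) - U) - profile a x) N /\ 0 <= N <= 3 * (2 * exp (2 * T) * e).
Proof.
  intros V Ht Hc Ha HT He H.
  set (W := fun t => m * (V (sc + t) - U) - log_profile a t).
  set (W1 := fun t => m * Derive V (sc + t) - log_profile' a t).
  set (W2 := fun t => - (m * source f lam V (sc + t)) - log_profile'' a t).
  assert (HDW : forall t, sc + t < 0 -> is_derive W t (W1 t)).
  { intros t Hs. apply (is_derive_minus (fun t => m * (V (sc + t) - U)) (log_profile a));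
      [|apply is_derive_log_profile].
    apply is_derive_scal. apply (is_derive_shift (fun s => V s - U)).
    rewrite <- (Rminus_0_r (Derive V (sc + t))).
    apply (is_derive_minus V (fun _ => U)); [|apply (is_derive_const U)].
    apply (traj_d1 _ _ _ _ _ Ht _ Hs). }
  assert (HDW1 : forall t, sc + t < 0 -> is_derive W1 t (W2 t)).
  { intros t Hs. apply (is_derive_minus (fun t => m * Derive V (sc + t)) (log_profile' a));
      [|apply is_derive_log_profile'].
    replace (- (m * source f lam V (sc + t))) with (m * - source f lam V (sc + t)) by ring.
    apply is_derive_scal. apply (is_derive_shift (Derive V)). apply (traj_d2 _ _ _ _ _ Ht _ Hs). }
  assert (HCW2 : forall t, sc + t < 0 -> continuous W2 t).
  { intros t Hs. apply (continuous_minus (fun t => - (m * source f lam V (sc + t))) (log_profile'' a));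
      [|apply continuous_log_profile''].
    apply (continuous_opp (fun t => m * source f lam V (sc + t))).
    apply (continuous_mult (fun _ => m) (fun t => source f lam V (sc + t))); [apply continuous_const|].
    apply (continuous_comp (fun t => sc + t) (source f lam V)).
    - apply (ex_derive_continuous (fun t => sc + t)). auto_derive. auto.
    - apply continuous_source with mu (Derive V); assumption. }
  assert (Hx : forall x, icc (exp (- T)) (exp T) x -> 0 < x /\ - T <= ln x <= T /\ / x <= exp T).
  { intros x [X1 X2]. assert (E := exp_pos (- T)).
    split; [lra|]. split.
    - split; [rewrite <- (ln_exp (- T))|rewrite <- (ln_exp T)]; apply Rcomplements.ln_le; lra.
    - rewrite <- (Ropp_involutive T), exp_Ropp. apply Rinv_le_contravar; assumption. }
  assert (HE1 : 1 <= exp T) by (rewrite <- exp_0; apply exp_le; lra).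
  assert (HE2 : exp (2 * T) = exp T * exp T) by (rewrite <- exp_plus; f_equal; ring).
  assert (HE3 : e * 1 <= e * (exp T * exp T)) by (apply Rmult_le_compat_l; nra).
  apply (C2_norm_small _ _ (fun x => W1 (ln x) / x) (fun x => (W2 (ln x) - W1 (ln x)) / x ^ 2) 1).
  - split; [rewrite <- exp_0; apply exp_le; lra|exact HE1].
  - intros x HIx. destruct (Hx x HIx) as (X0 & X1 & _).
    destruct (H (ln x) X1) as (Hs & _).
    assert (C1 : continuous ln x).
    { apply (ex_derive_continuous ln). eexists. apply is_derive_ln, X0. }
    split; [|split].
    + apply is_derive_ext_loc with (fun x => W (ln x)).
      * generalize (locally_positive x X0). apply filter_imp. intros y Hy. unfold W, V. rewrite exp_plus, exp_ln, profile_log by lra. reflexivity.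
      * apply is_derive_comp_ln; [exact X0|]. apply HDW, Hs.
    + apply is_derive_comp_ln_div; [exact X0|]. apply HDW1, Hs.
    + apply (continuous_mult (fun x => W2 (ln x) - W1 (ln x)) (fun x => / x ^ 2)).
      * apply (continuous_minus (fun x => W2 (ln x)) (fun x => W1 (ln x))).
        -- apply (continuous_comp ln W2); [exact C1|apply HCW2, Hs].
        -- apply (continuous_comp ln W1); [exact C1|]. apply (ex_derive_continuous W1).
           eexists. apply HDW1, Hs.
      * apply (ex_derive_continuous (fun x => / x ^ 2)). auto_derive. apply Rgt_not_eq. nra.
  - intros x HIx. destruct (Hx x HIx) as (X0 & X1 & X2).
    destruct (H (ln x) X1) as (Hs & B0 & B1 & B2).
    assert (Hix : 0 < / x) by (apply Rinv_0_lt_compat, X0).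
    split; [|split].
    + rewrite profile_log by assumption.
      replace (exp sc * x) with (exp (sc + ln x)) by (rewrite exp_plus, exp_ln by exact X0; reflexivity).
      eapply Rle_trans; [exact B0|]. rewrite HE2. lra.
    + unfold Rdiv. rewrite Rabs_mult, (Rabs_pos_eq (/ x)) by lra. fold (W1 (ln x)) in B1.
      apply Rle_trans with (e * exp T); [apply Rmult_le_compat; try apply Rabs_pos; lra|].
      rewrite HE2. assert (e * exp T * 1 <= e * exp T * exp T) by (apply Rmult_le_compat_l; nra). lra.
    + fold (W1 (ln x)) in B1. fold (W2 (ln x)) in B2. unfold Rdiv.
      replace (/ x ^ 2) with (/ x * / x) by (field; lra).
      rewrite Rabs_mult, (Rabs_pos_eq (/ x * / x)) by nra.
      assert (BB : Rabs (W2 (ln x) - W1 (ln x)) <= 2 * e).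
      { eapply Rle_trans; [apply Rabs_triang|]. rewrite Rabs_Ropp. lra. }
      assert (PP : / x * / x <= exp T * exp T) by (apply Rmult_le_compat; lra).
      rewrite HE2. apply Rle_trans with (2 * e * (exp T * exp T)); [|lra].
      apply Rmult_le_compat; [apply Rabs_pos|nra|exact BB|exact PP].
Qed.

Lemma ln_neg (x : R) : 0 < x < 1 -> ln x < 0.
Proof. intros H. rewrite <- ln_1. apply ln_increasing; lra. Qed.

(** [u] is nonincreasing in [r], so [u^(p-1)] lies between its values at the end points while the
    remaining factor of the integrand is nonnegative. *)
Lemma weighted_RInt_bounds (p : R) (f : R -> R) (lam mu : R) (u : R -> R) (a b J : R) :
  1 <= p -> (forall t, 0 <= t -> 0 <= f t) -> (forall t, 0 < t -> continuous f t) ->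
  trajectory f lam mu (fun s => u (exp s)) (Derive (fun s => u (exp s))) ->
  0 < a <= b -> b < 1 ->
  is_RInt (fun x => lam * f (u x) * x) a b J ->
  Rpower (u b) (p - 1) * J <= RInt (fun x => lam * rpow (u x) (p - 1) * f (u x) * x) a b
    <= Rpower (u a) (p - 1) * J.
Proof.
  intros Hp Hf0 Hfc Ht Hab Hb HJ. set (V := fun s => u (exp s)) in *.
  assert (Hlam := traj_lam _ _ _ _ _ Ht).
  assert (HuV : forall x, 0 < x -> u x = V (ln x)) by (intros x Hx; unfold V; rewrite exp_ln by exact Hx; reflexivity).
  assert (Hu : forall x, a <= x <= b -> 0 < u x).
  { intros x Hx. rewrite HuV by lra. apply (traj_range _ _ _ _ _ Ht). apply ln_neg. lra. }
  assert (Hmono : forall x y, a <= x <= y -> y <= b -> u y <= u x).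
  { intros x y Hx Hy. rewrite !HuV by lra. apply trajectory_mono with f lam mu (Derive V); [exact Ht|].
    split; [apply Rcomplements.ln_le; lra|apply ln_neg; lra]. }
  assert (Huc : forall x, a <= x <= b -> continuous u x).
  { intros x Hx. apply continuous_ext_loc with (fun x => V (ln x)).
    - assert (Hx0 : 0 < x) by lra. generalize (locally_positive x Hx0). apply filter_imp. intros y Hy. symmetry. apply HuV. lra.
    - apply (continuous_comp ln V).
      + apply (ex_derive_continuous ln). eexists. apply is_derive_ln; lra.
      + apply (ex_derive_continuous V). eexists. apply (traj_d1 _ _ _ _ _ Ht). apply ln_neg; lra. }
  assert (HI : is_RInt (fun x => lam * rpow (u x) (p - 1) * f (u x) * x) a b
    (RInt (fun x => lam * rpow (u x) (p - 1) * f (u x) * x) a b)).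
  { apply (RInt_correct (V := R_CompleteNormedModule)).
    apply ex_RInt_ext with (fun x => lam * Rpower (u x) (p - 1) * f (u x) * x).
    - rewrite Rmin_left, Rmax_right by lra. intros x Hx. rewrite rpow_pos_eq; [reflexivity|apply Hu; lra].
    - apply (ex_RInt_continuous (V := R_CompleteNormedModule)).
      rewrite Rmin_left, Rmax_right by lra. intros x Hx.
      apply (continuous_mult (fun x => lam * Rpower (u x) (p - 1) * f (u x)) (fun x => x)); [|apply continuous_id].
      apply (continuous_mult (fun x => lam * Rpower (u x) (p - 1)) (fun x => f (u x))).
      + apply (continuous_mult (fun _ => lam) (fun x => Rpower (u x) (p - 1))); [apply continuous_const|].
        apply (continuous_comp u (fun y => Rpower y (p - 1))); [apply Huc, Hx|].
        apply continuous_Rpower, Hu, Hx.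
      + apply (continuous_comp u f); [apply Huc, Hx|apply Hfc, Hu, Hx]. }
  assert (Hg : forall x, a <= x <= b -> 0 <= lam * f (u x) * x).
  { intros x Hx. apply Rmult_le_pos; [|lra]. apply Rmult_le_pos; [lra|]. apply Hf0.
    left; apply Hu, Hx. }
  split.
  - apply (is_RInt_le (fun x => Rpower (u b) (p - 1) * (lam * f (u x) * x))
      (fun x => lam * rpow (u x) (p - 1) * f (u x) * x) a b); [lra| |exact HI|].
    + apply (is_RInt_scal (V := R_NormedModule)). exact HJ.
    + intros x Hx. rewrite rpow_pos_eq by (apply Hu; lra).
      assert (K := Rpower_incr (u b) (u x) (p - 1) ltac:(lra) ltac:(split; [apply Hu|apply Hmono]; lra)).
      assert (G := Hg x ltac:(lra)). nra.
  - apply (is_RInt_le (fun x => lam * rpow (u x) (p - 1) * f (u x) * x)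
      (fun x => Rpower (u a) (p - 1) * (lam * f (u x) * x)) a b); [lra|exact HI| |].
    + apply (is_RInt_scal (V := R_NormedModule)). exact HJ.
    + intros x Hx. rewrite rpow_pos_eq by (apply Hu; lra).
      assert (K := Rpower_incr (u x) (u a) (p - 1) ltac:(lra) ltac:(split; [apply Hu|apply Hmono]; lra)).
      assert (G := Hg x ltac:(lra)). nra.
Qed.

(* The source integrals are differences of fluxes, so their limits follow from
   the limits of the fluxes at the end points. *)
Lemma RInt_limits (p : R) (f : R -> R) (lam mu : nat -> R) (u : nat -> R -> R)
  (ra rb : nat -> R) (da db Fa Fb : R) :
  1 <= p -> (forall t, 0 <= t -> 0 <= f t) -> (forall t, 0 < t -> continuous f t) ->
  (forall n, trajectory f (lam n) (mu n) (fun s => u n (exp s)) (Derive (fun s => u n (exp s)))) ->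
  (forall n, 0 < ra n < 1) -> (forall n, 0 < rb n < 1) ->
  eventually (fun n => ra n <= rb n) -> 0 < da -> 0 < db ->
  is_lim_seq (fun n => u n (ra n) / mu n) da -> is_lim_seq (fun n => u n (rb n) / mu n) db ->
  is_lim_seq (fun n => flux p (mu n) (Derive (fun s => u n (exp s))) (ln (ra n))) Fa ->
  is_lim_seq (fun n => flux p (mu n) (Derive (fun s => u n (exp s))) (ln (rb n))) Fb ->
  Rpower da (p - 1) * (Fb - Fa) = Rpower db (p - 1) * (Fb - Fa) ->
  is_lim_seq (fun n => p * rpow (mu n) (p - 1) *
    RInt (fun x => lam n * f (u n x) * x) (ra n) (rb n)) (Fb - Fa) /\
  is_lim_seq (fun n => p *
    RInt (fun x => lam n * rpow (u n x) (p - 1) * f (u n x) * x) (ra n) (rb n))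
    (Rpower db (p - 1) * (Fb - Fa)).
Proof.
  intros Hp Hf0 Hfc Ht Hra Hrb Hle Hda Hdb La Lb LFa LFb Hq.
  assert (Hmu0 : forall n, 0 < mu n) by (intros n; apply (traj_mu _ _ _ _ _ (Ht n))).
  set (J := fun n => Derive (fun s => u n (exp s)) (ln (ra n)) - Derive (fun s => u n (exp s)) (ln (rb n))).
  assert (HJ : eventually (fun n => ra n <= rb n /\
    is_RInt (fun x => lam n * f (u n x) * x) (ra n) (rb n) (J n))).
  { revert Hle. apply filter_imp. intros n Hn. split; [exact Hn|].
    assert (K1 := Hra n). assert (K2 := Hrb n).
    apply trajectory_RInt with (mu n); [apply Ht|exact Hfc|lra|lra]. }
  assert (LJ : is_lim_seq (fun n => p * Rpower (mu n) (p - 1) * J n) (Fb - Fa)).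
  { assert (L := lim_minus _ _ _ _ LFb LFa). cbv beta in L.
    apply is_lim_seq_ext with (2 := L). intros n. unfold flux, J. ring. }
  split.
  - apply lim_ext_ev with (2 := LJ). revert HJ. apply filter_imp. intros n [_ HJ].
    rewrite (is_RInt_unique _ _ _ _ HJ), rpow_pos_eq by apply Hmu0. reflexivity.
  - apply lim_squeeze with
      (fun n => Rpower (u n (rb n) / mu n) (p - 1) * (p * Rpower (mu n) (p - 1) * J n))
      (fun n => Rpower (u n (ra n) / mu n) (p - 1) * (p * Rpower (mu n) (p - 1) * J n)).
    + revert HJ. apply filter_imp. intros n [Hn HJ].
      assert (K1 := Hra n). assert (K2 := Hrb n). assert (M := Hmu0 n).
      assert (B := weighted_RInt_bounds p f (lam n) (mu n) (u n) (ra n) (rb n) (J n)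
        Hp Hf0 Hfc (Ht n) ltac:(lra) ltac:(lra) HJ).
      assert (Hup : forall r, 0 < r < 1 -> 0 < u n r).
      { intros r Hr. destruct (traj_range _ _ _ _ _ (Ht n) (ln r) (ln_neg r Hr)) as [R1 _].
        rewrite exp_ln in R1 by lra. exact R1. }
      assert (P := Rpower_pos (mu n) (p - 1)).
      rewrite !Rpower_div by (try apply Hup; assumption).
      replace (Rpower (u n (rb n)) (p - 1) / Rpower (mu n) (p - 1) * (p * Rpower (mu n) (p - 1) * J n))
        with (p * (Rpower (u n (rb n)) (p - 1) * J n)) by (field; lra).
      replace (Rpower (u n (ra n)) (p - 1) / Rpower (mu n) (p - 1) * (p * Rpower (mu n) (p - 1) * J n))
        with (p * (Rpower (u n (ra n)) (p - 1) * J n)) by (field; lra).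
      split; apply Rmult_le_compat_l; lra.
    + apply lim_mult; [apply lim_Rpower; assumption|exact LJ].
    (* [Hq] makes the lower and the upper bound agree. It holds if the fluxes have equal limits
       (between concentrations) or if the heights do (inside one). *)
    + rewrite <- Hq. apply lim_mult; [apply lim_Rpower; assumption|exact LJ].
Qed.

(** The clauses of the conclusion for one [k] that involve the solutions, with the previous outer
    radius as the parameter [rprev]; the clauses on the profile alone depend only on [a_k]. *)
Definition concentrates (p : R) (f : R -> R) (lam m : nat -> R) (v : nat -> R -> R)
  (d a : R) (rprev r rho rhobar : nat -> R) : Prop :=
  (forall n, 0 < r n < 1) /\
  (forall n, 0 < rho n < 1) /\
  (forall n, 0 < rhobar n < 1) /\
  is_lim_seq (fun n => v n (r n) / m n) d /\
  is_lim_seq (fun n => p * lam n * r n ^ 2 * rpow (v n (r n)) (p - 1)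
                       * f (v n (r n))) (a ^ 2 / 2) /\
  is_lim_seq (fun n => v n (rho n) / m n) d /\
  is_lim_seq (fun n => v n (rhobar n) / m n) d /\
  is_lim_seq (fun n => rprev n / rhobar n) 0 /\
  is_lim_seq (fun n => rhobar n / r n) 0 /\
  is_lim_seq (fun n => r n / rho n) 0 /\
  (exists gamma : nat -> R,
    (forall n, 0 < gamma n /\
       gamma n ^ 2 * p * lam n * rpow (v n (r n)) (p - 1)
         * f (v n (r n)) = 1) /\
    is_lim_seq gamma 0 /\
    Ck_norm_to_0 2
      (fun n => icc (rhobar n / gamma n) (rho n / gamma n))
      (fun n x => p * rpow (v n (r n)) (p - 1)
                    * (v n (gamma n * x) - v n (r n))
                  - profile a x)) /\
  is_lim_seq (fun n => p * rpow (m n) (p - 1) *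
    RInt (fun x => lam n * f (v n x) * x) (rprev n) (rhobar n)) 0 /\
  is_lim_seq (fun n => p * rpow (m n) (p - 1) *
    RInt (fun x => lam n * f (v n x) * x) (rhobar n) (rho n))
    (2 * a / rpow d (p - 1)) /\
  is_lim_seq (fun n => p *
    RInt (fun x => lam n * rpow (v n x) (p - 1) * f (v n x) * x)
      (rprev n) (rhobar n)) 0 /\
  is_lim_seq (fun n => p *
    RInt (fun x => lam n * rpow (v n x) (p - 1) * f (v n x) * x)
      (rhobar n) (rho n)) (2 * a).

(** The radii [rhobar] and [rho] sit at logarithmic distance [T] on either side of [gamma]. For
    fixed [T] all rescaled quantities converge; in particular the density has a positive limit and
    its logarithm is [o(mu^p)]. Letting [T] grow slowly with [n] brings the slopes to [2 - a'] and
    [2 + a'] and the density at [rho] to 0, so [rho] starts the next plateau. *)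
Lemma concentration_step (p : R) (f : R -> R) (lam mu : nat -> R) (u : nat -> R -> R)
  (d A d' a' : R) (rprev : nat -> R) :
  1 < p -> exp_type p f -> is_lim_seq mu p_infty ->
  (forall n, trajectory f (lam n) (mu n) (fun s => u n (exp s)) (Derive (fun s => u n (exp s)))) ->
  (forall t, 0 < t -> continuous f t) -> (forall n, 0 < f (mu n)) ->
  (forall n, 0 < rprev n < 1) ->
  plateau p f lam mu (fun n s => u n (exp s)) (fun n => Derive (fun s => u n (exp s))) d A
    (fun n => ln (rprev n)) ->
  0 < d' < d -> 0 < A -> 0 < a' < 2 -> A * Rpower d' (p - 1) = 2 - a' ->
  2 * ((d - d') / (A / p)) + Rpower d' p - Rpower d p = 0 ->
  exists r rho rhobar : nat -> R,
    concentrates p f lam mu u d' a' rprev r rho rhobar /\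
    plateau p f lam mu (fun n s => u n (exp s)) (fun n => Derive (fun s => u n (exp s))) d'
      ((2 + a') / Rpower d' (p - 1)) (fun n => ln (rho n)).
Proof.
  intros Hp Hf Hmu Htr Hc Hfm Hrp Hpl Hd HA Ha HAD HPhi.
  set (V := fun n s => u n (exp s)) in *.
  destruct (bubble_center p f lam mu V (fun n => Derive (V n)) d A d' a' _ ltac:(lra) Hf Hmu Htr Hc Hfm
    Hpl Hd HA Ha HAD HPhi) as (st & Hst & Lst & LU & LF & LD).
  set (D := Rpower d' (p - 1)) in *.
  assert (HD : 0 < D) by apply Rpower_pos.
  assert (Hmu0 : forall n, 0 < mu n) by (intros n; apply (traj_mu _ _ _ _ _ (Htr n))).
  assert (Hlam : forall n, 0 < lam n) by (intros n; apply (traj_lam _ _ _ _ _ (Htr n))).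
  set (U := fun n => V n (st n)).
  assert (HU0 : forall n, 0 < U n).
  { intros n. apply (traj_range _ _ _ _ _ (Htr n)). apply Hst. }
  assert (HUinf : is_lim_seq U p_infty).
  { apply is_lim_seq_spec. intros M. apply (lim_scaled_infty U mu d' M ltac:(lra) Hmu LU). }
  assert (LUp : is_lim_seq (fun n => Rpower (U n / mu n) (p - 1)) D) by (apply lim_Rpower; [lra|exact LU]).
  set (m := fun n => p * Rpower (U n) (p - 1)).
  assert (HmU : forall n, m n = Rpower (U n / mu n) (p - 1) * (p * Rpower (mu n) (p - 1))).
  { intros n. unfold m. rewrite Rpower_div by (apply HU0 || apply Hmu0).
    assert (P1 := Rpower_pos (mu n) (p - 1)). field. lra. }
  set (G := fun n => m n * source f (lam n) (V n) (st n)).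
  assert (HG0 : forall n, 0 < G n).
  { intros n. unfold G, source. repeat apply Rmult_lt_0_compat; auto.
    - lra.
    - apply exp_pos.
    - apply exp_pos.
    - apply Hst. }
  set (sc := fun n => st n - ln (G n) / 2).
  assert (LQ : is_lim_seq (fun n => - (m n * Derive (V n) (st n))) 2).
  { replace 2 with (D * (2 / D)) by (field; lra).
    apply is_lim_seq_ext with (2 := lim_mult _ _ _ _ LUp LF).
    intros n. rewrite HmU. unfold flux. ring. }
  assert (LG : is_lim_seq G (a' ^ 2 / 2)).
  { replace (a' ^ 2 / 2) with (D * (a' ^ 2 / 2 / D)) by (field; lra).
    apply is_lim_seq_ext with (2 := lim_mult _ _ _ _ LUp LD).
    intros n. unfold G. rewrite HmU. unfold dens. ring. }
  assert (Hconv := liouville_convergence p f lam mu V (fun n => Derive (V n)) a' st m G sc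
    ltac:(lra) Hf ltac:(lra) Htr ltac:(exists 0%nat; intros n _; apply Hst) HUinf
    (fun n => eq_refl) (fun n => eq_refl) (fun n => eq_refl) LQ LG).
  set (tn := fun n => ln (G n) / 2).
  set (t0 := ln (a' ^ 2 / 2) / 2).
  assert (Ltn : is_lim_seq tn t0).
  { unfold tn, t0. apply lim_div; [lra| |apply is_lim_seq_const].
    apply (is_lim_seq_continuous ln G (a' ^ 2 / 2)); [|exact LG].
    apply continuity_pt_filterlim. apply (ex_derive_continuous ln).
    eexists. apply is_derive_ln. nra. }
  assert (Hscs : forall n, sc n = st n - tn n) by reflexivity.
  assert (Hfix : forall t,
    is_lim_seq (fun n => V n (sc n + t) / mu n) d' /\
    is_lim_seq (fun n => flux p (mu n) (Derive (V n)) (sc n + t)) (- log_profile' a' t / D) /\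
    is_lim_seq (fun n => dens p f (lam n) (mu n) (V n) (sc n + t)) (- log_profile'' a' t / D) /\
    is_lim_seq (fun n => ln (dens p f (lam n) (mu n) (V n) (sc n + t)) / Rpower (mu n) p) 0).
  { intros t.
    assert (HT : 0 < Rabs t + 1) by (assert (K := Rabs_pos t); lra).
    assert (Hin : - (Rabs t + 1) <= t <= Rabs t + 1).
    { assert (K1 := Rle_abs t). assert (K2 := Rle_abs (- t)). rewrite Rabs_Ropp in K2. lra. }
    apply rescaled_limits with (st := st) (m := m) (y := log_profile a' t); auto; try lra.
    - rewrite log_profile''_eq by lra. assert (K := exp_pos (2 * t + log_profile a' t)). lra.
    - apply is_lim_seq_eps. intros e He. generalize (Hconv _ e HT He). apply filter_imp.
      intros n K. apply (K t Hin).
    - apply is_lim_seq_eps. intros e He. generalize (Hconv _ e HT He). apply filter_imp.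
      intros n K. apply (K t Hin).
    - apply is_lim_seq_eps. intros e He. generalize (Hconv _ e HT He). apply filter_imp.
      intros n K. apply (K t Hin). }
  set (gam := fun n => exp (sc n)). set (r := fun n => exp (st n)).
  set (w := fun n x => m n * (u n (gam n * x) - U n) - profile a' x).
  (* A candidate is a triple of [rhobar], [rho] and the norm; the norm is chosen along with the
     radii because [Ck_norm_to_0] asks for a sequence of norms. *)
  destruct (diagonal_choice
    (fun (n : nat) (q : R * R * R) => 0 < fst (fst q) < 1 /\ 0 < snd (fst q) < 1)
    (fun n e q => let rb := fst (fst q) in let rh := snd (fst q) in let N := snd q in
      Rabs (u n rb / mu n - d') <= e /\ Rabs (u n rh / mu n - d') <= e /\
      rprev n / rb <= e /\ rb / r n <= e /\ r n / rh <= e /\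
      Rabs (flux p (mu n) (Derive (V n)) (ln rb) - (2 - a') / D) <= e /\
      Rabs (flux p (mu n) (Derive (V n)) (ln rh) - (2 + a') / D) <= e /\
      Rabs (dens p f (lam n) (mu n) (V n) (ln rh)) <= e /\
      Rabs (ln (dens p f (lam n) (mu n) (V n) (ln rh)) / Rpower (mu n) p) <= e /\
      is_Ck_norm 2 (icc (rb / gam n) (rh / gam n)) (w n) N /\ Rabs N <= e))
    as (q & Hq & Hgood).
  - intros n. exists (1/2, 1/2, 0). simpl. lra.
  - intros n e e' x He (K1 & K2 & K3 & K4 & K5 & K6 & K7 & K8 & K9 & K10 & K11).
    repeat split; try assumption; eapply Rle_trans; try eassumption; apply He.
  - intros e He.
    destruct (log_profile_left a' (D * (e / 2)) ltac:(lra) ltac:(apply Rmult_lt_0_compat; lra)) as [T1 HT1].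
    destruct (log_profile_right a' (D * (e / 2)) ltac:(lra) ltac:(apply Rmult_lt_0_compat; lra)) as [T2 HT2].
    (* [T1] and [T2] handle the slopes. The last entry makes the ratios of the radii at most [e]:
       [ln r = sc + tn], and [tn] is within 1 of [t0]. *)
    set (T := Rmax (Rmax T1 T2) (Rmax 1 (Rabs t0 + 1 - ln e))).
    assert (M1 : T1 <= T) by (eapply Rle_trans; [apply Rmax_l|apply Rmax_l]).
    assert (M2 : T2 <= T) by (eapply Rle_trans; [apply Rmax_r|apply Rmax_l]).
    assert (M3 : 1 <= T) by (eapply Rle_trans; [apply Rmax_l|apply Rmax_r]).
    assert (M4 : Rabs t0 + 1 - ln e <= T) by (eapply Rle_trans; [apply Rmax_r|apply Rmax_r]).
    specialize (HT1 (- T) ltac:(lra)). destruct (HT2 T M2) as [HT2a HT2b].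
    destruct (Hfix (- T)) as (A1 & A2 & _ & _). destruct (Hfix T) as (B1 & B2 & B3 & B4).
    (* With this value the bound [3 * (2 * exp (2 * T) * e0)] of [rescaled_C2_norm] equals [e]. *)
    set (e0 := e / (6 * exp (2 * T))).
    assert (HE := exp_pos (2 * T)).
    assert (He0 : 0 < e0) by (apply Rdiv_lt_0_compat; lra).
    assert (He2 : 0 < e / 2) by lra.
    assert (Hdiv : forall x y, Rabs (x + y) <= D * (e / 2) -> Rabs (- x / D - y / D) <= e / 2).
    { intros x y Hxy. replace (- x / D - y / D) with (- ((x + y) / D)) by (field; lra).
      rewrite Rabs_Ropp. unfold Rdiv. rewrite Rabs_mult, (Rabs_pos_eq (/ D)) by (left; apply Rinv_0_lt_compat; lra).
      apply Rmult_le_reg_r with D; [lra|]. rewrite Rmult_assoc, Rinv_l, Rmult_1_r by lra. lra. }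
    assert (F1 := proj1 (is_lim_seq_eps _ _) A1 e He).
    assert (F2 := proj1 (is_lim_seq_eps _ _) A2 _ He2).
    assert (F3 := proj1 (is_lim_seq_eps _ _) B1 e He).
    assert (F4 := proj1 (is_lim_seq_eps _ _) B2 _ He2).
    assert (F5 := proj1 (is_lim_seq_eps _ _) B3 _ He2).
    assert (F6 := proj1 (is_lim_seq_eps _ _) B4 e He).
    assert (F7 := Hconv T e0 ltac:(lra) He0).
    assert (F8 := proj1 (is_lim_seq_eps _ _) Ltn 1 Rlt_0_1).
    assert (F9 := lim_infty_eventually _ (Rabs t0 + 1 + T - ln e) Lst).
    generalize (filter_and _ _ (filter_and _ _ (filter_and _ _ F1 F2) (filter_and _ _ F3 F4))
      (filter_and _ _ (filter_and _ _ F5 F6) (filter_and _ _ F7 (filter_and _ _ F8 F9)))).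
    apply filter_imp. intros n [[[C1 C2] [C3 C4]] [[C5 C6] [C7 [C8 C9]]]].
    clear F1 F2 F3 F4 F5 F6 F7 F8 F9 A1 A2 B1 B2 B3 B4.
    destruct (C7 T ltac:(lra)) as (Hneg & _).
    assert (Habs1 := Rle_abs t0). assert (Habs2 := Rle_abs (- t0)). rewrite Rabs_Ropp in Habs2.
    apply Rabs_le_between in C8. assert (Hs := Hscs n).
    destruct (rescaled_C2_norm f (lam n) (mu n) a' (U n) (m n) (sc n) T e0 (u n) (Htr n) Hc
      ltac:(lra) ltac:(lra) He0 C7) as (N & HN & HNb).
    replace (3 * (2 * exp (2 * T) * e0)) with e in HNb by (unfold e0; field; lra).
    exists (exp (sc n - T), exp (sc n + T), N). cbn [fst snd]. rewrite !ln_exp.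
    assert (Hexple : forall x, x <= ln e -> exp x <= e).
    { intros x Hx. rewrite <- (exp_ln e) by exact He. apply exp_le, Hx. }
    assert (Hexp1 : forall x, x < 0 -> exp x < 1).
    { intros x Hx. rewrite <- exp_0. apply exp_increasing, Hx. }
    split; [split; (split; [apply exp_pos|apply Hexp1; lra])|].
    split; [exact C1|]. split; [exact C3|].
    assert (Hexpdiv : forall x y, exp x / exp y = exp (x - y)).
    { intros x y. unfold Rminus. rewrite exp_plus, exp_Ropp. reflexivity. }
    split.
    { rewrite <- (exp_ln (rprev n)) by apply Hrp. rewrite Hexpdiv. apply Hexple. lra. }
    split; [unfold r; rewrite Hexpdiv; apply Hexple; lra|].
    split; [unfold r; rewrite Hexpdiv; apply Hexple; lra|].
    split.
    { specialize (Hdiv _ _ HT1).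
      replace (flux p (mu n) (Derive (V n)) (sc n - T) - (2 - a') / D) with
        ((flux p (mu n) (Derive (V n)) (sc n + - T) - - log_profile' a' (- T) / D) +
         (- log_profile' a' (- T) / D - (2 - a') / D)) by (unfold Rminus; ring).
      eapply Rle_trans; [apply Rabs_triang|]. lra. }
    split.
    { specialize (Hdiv _ _ HT2a).
      replace (flux p (mu n) (Derive (V n)) (sc n + T) - (2 + a') / D) with
        ((flux p (mu n) (Derive (V n)) (sc n + T) - - log_profile' a' T / D) +
         (- log_profile' a' T / D - (2 + a') / D)) by ring.
      eapply Rle_trans; [apply Rabs_triang|]. lra. }
    split.
    { assert (K : Rabs (- log_profile'' a' T / D - 0 / D) <= e / 2).
      { apply Hdiv. rewrite Rplus_0_r. exact HT2b. }
      replace (dens p f (lam n) (mu n) (V n) (sc n + T)) with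
        ((dens p f (lam n) (mu n) (V n) (sc n + T) - - log_profile'' a' T / D) +
         (- log_profile'' a' T / D - 0 / D)) by (unfold Rdiv; ring).
      eapply Rle_trans; [apply Rabs_triang|]. lra. }
    split; [rewrite Rminus_0_r in C6; exact C6|].
    split; [|rewrite Rabs_pos_eq; lra].
    unfold gam. rewrite !Hexpdiv.
    replace (sc n - T - sc n) with (- T) by ring. replace (sc n + T - sc n) with T by ring.
    exact HN.
  - set (rb := fun n => fst (fst (q n))). set (rh := fun n => snd (fst (q n))).
    exists r, rh, rb.
    assert (Hr : forall n, 0 < r n < 1).
    { intros n. split; [apply exp_pos|]. rewrite <- exp_0. apply exp_increasing, Hst. }
    assert (Hrb : forall n, 0 < rb n < 1) by (intros n; apply Hq).
    assert (Hrh : forall n, 0 < rh n < 1) by (intros n; apply Hq).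
    assert (Hur : forall n, u n (r n) = U n) by reflexivity.
    assert (Hsmall : forall x : nat -> R, (forall n, 0 < x n) ->
      (forall e, 0 < e -> eventually (fun n => x n <= e)) -> is_lim_seq x 0).
    { intros x Hx H. apply is_lim_seq_eps. intros e He. generalize (H e He). apply filter_imp.
      intros n K. rewrite Rminus_0_r, Rabs_pos_eq; [exact K|left; apply Hx]. }
    assert (L1 : is_lim_seq (fun n => u n (rb n) / mu n) d').
    { apply is_lim_seq_eps. intros e He. generalize (Hgood e He). apply filter_imp. intros n K. apply K. }
    assert (L2 : is_lim_seq (fun n => u n (rh n) / mu n) d').
    { apply is_lim_seq_eps. intros e He. generalize (Hgood e He). apply filter_imp. intros n K. apply K. }
    assert (L3 : is_lim_seq (fun n => rprev n / rb n) 0).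
    { apply Hsmall; [intros n; apply Rdiv_lt_0_compat; [apply Hrp|apply Hrb]|].
      intros e He. generalize (Hgood e He). apply filter_imp. intros n K. apply K. }
    assert (L4 : is_lim_seq (fun n => rb n / r n) 0).
    { apply Hsmall; [intros n; apply Rdiv_lt_0_compat; [apply Hrb|apply Hr]|].
      intros e He. generalize (Hgood e He). apply filter_imp. intros n K. apply K. }
    assert (L5 : is_lim_seq (fun n => r n / rh n) 0).
    { apply Hsmall; [intros n; apply Rdiv_lt_0_compat; [apply Hr|apply Hrh]|].
      intros e He. generalize (Hgood e He). apply filter_imp. intros n K. apply K. }
    assert (L6 : is_lim_seq (fun n => flux p (mu n) (Derive (V n)) (ln (rb n))) ((2 - a') / D)).
    { apply is_lim_seq_eps. intros e He. generalize (Hgood e He). apply filter_imp. intros n K. apply K. }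
    assert (L7 : is_lim_seq (fun n => flux p (mu n) (Derive (V n)) (ln (rh n))) ((2 + a') / D)).
    { apply is_lim_seq_eps. intros e He. generalize (Hgood e He). apply filter_imp. intros n K. apply K. }
    assert (L8 : is_lim_seq (fun n => dens p f (lam n) (mu n) (V n) (ln (rh n))) 0).
    { apply is_lim_seq_eps. intros e He. generalize (Hgood e He). apply filter_imp. intros n K.
      rewrite Rminus_0_r. apply K. }
    assert (L9 : is_lim_seq (fun n => ln (dens p f (lam n) (mu n) (V n) (ln (rh n))) / Rpower (mu n) p) 0).
    { apply is_lim_seq_eps. intros e He. generalize (Hgood e He). apply filter_imp. intros n K.
      rewrite Rminus_0_r. apply K. }
    assert (Hle1 : forall x y, 0 < y -> x / y <= 1 -> x <= y).
    { intros x y Hy H. rewrite <- (div_mult_cancel x y Hy). nra. }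
    assert (O1 : eventually (fun n => rprev n <= rb n)).
    { generalize (Hgood 1 Rlt_0_1). apply filter_imp. intros n K. apply Hle1; [apply Hrb|apply K]. }
    assert (O2 : eventually (fun n => rb n <= rh n)).
    { generalize (Hgood 1 Rlt_0_1). apply filter_imp. intros n K.
      apply Rle_trans with (r n); apply Hle1; try apply K; [apply Hr|apply Hrh]. }
    assert (Lprev : is_lim_seq (fun n => u n (rprev n) / mu n) d).
    { apply is_lim_seq_ext with (2 := pl_height _ _ _ _ _ _ _ _ _ Hpl).
      intros n. unfold V. rewrite exp_ln by apply Hrp. reflexivity. }
    (* The flux that arrives at the new concentration is the one that left the previous one. So both
       integrals in between tend to 0, although the heights [d] and [d'] differ. *)
    assert (HAd : A = (2 - a') / D) by (rewrite <- HAD; field; lra).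
    destruct (RInt_limits p f lam mu u rprev rb d d' A ((2 - a') / D) ltac:(lra) (proj1 Hf) Hc Htr Hrp Hrb
      O1 ltac:(lra) ltac:(lra) Lprev L1 (pl_flux _ _ _ _ _ _ _ _ _ Hpl) L6
      ltac:(rewrite HAd; ring)) as [I1 I2].
    replace ((2 - a') / D - A) with 0 in I1, I2 by (rewrite HAd; ring). rewrite Rmult_0_r in I2.
    destruct (RInt_limits p f lam mu u rb rh d' d' ((2 - a') / D) ((2 + a') / D) ltac:(lra) (proj1 Hf) Hc Htr
      Hrb Hrh O2 ltac:(lra) ltac:(lra) L1 L2 L6 L7 eq_refl) as [I3 I4].
    replace ((2 + a') / D - (2 - a') / D) with (2 * a' / D) in I3, I4 by (field; lra).
    fold D in I4. replace (D * (2 * a' / D)) with (2 * a') in I4 by (field; lra).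
    assert (HGr : forall n, p * lam n * r n ^ 2 * rpow (u n (r n)) (p - 1) * f (u n (r n)) = G n).
    { intros n. rewrite Hur, rpow_pos_eq by apply HU0. unfold G, m, source, r. fold (U n).
      replace (2 * st n) with (st n + st n) by ring. rewrite exp_plus. ring. }
    split.
    + split; [exact Hr|]. split; [exact Hrh|]. split; [exact Hrb|]. split; [exact LU|].
      split; [apply is_lim_seq_ext with (2 := LG); intros n; symmetry; apply HGr|].
      split; [exact L2|]. split; [exact L1|]. split; [exact L3|]. split; [exact L4|].
      split; [exact L5|]. split.
      { exists gam. split; [|split].
        - intros n. split; [apply exp_pos|].
          assert (Hg2 : gam n ^ 2 = r n ^ 2 / G n).
          { unfold gam, r, sc. replace (exp (st n - ln (G n) / 2) ^ 2) with
              (exp (st n - ln (G n) / 2) * exp (st n - ln (G n) / 2)) by ring.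
            rewrite <- exp_plus.
            replace (st n - ln (G n) / 2 + (st n - ln (G n) / 2)) with (st n + st n + - ln (G n)) by field.
            rewrite !exp_plus, exp_Ropp, exp_ln by apply HG0. unfold Rdiv; ring. }
          rewrite Hg2. assert (K := HG0 n). assert (K2 := HGr n).
          replace (r n ^ 2 / G n * p * lam n * rpow (u n (r n)) (p - 1) * f (u n (r n))) with
            (p * lam n * r n ^ 2 * rpow (u n (r n)) (p - 1) * f (u n (r n)) / G n) by (field; lra).
          rewrite K2. field. lra.
        (* For every [T] the window up to [sc n + T] eventually lies in the domain, so
           [ln gamma = sc n] is below [- T]. *)
        - apply Hsmall; [intros n; apply exp_pos|]. intros e He.
          set (T := Rmax 1 (- ln e)).
          assert (M1 : 1 <= T) by apply Rmax_l. assert (M2 : - ln e <= T) by apply Rmax_r.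
          generalize (Hconv T 1 ltac:(lra) Rlt_0_1). apply filter_imp. intros n K.
          destruct (K T ltac:(lra)) as [K1 _]. unfold gam. rewrite <- (exp_ln e) by exact He.
          apply exp_le. lra.
        - exists (fun n => snd (q n)). split.
          + generalize (Hgood 1 Rlt_0_1). apply filter_imp. intros n K.
            rewrite Hur, rpow_pos_eq by apply HU0. apply K.
          + apply is_lim_seq_eps. intros e He. generalize (Hgood e He). apply filter_imp. intros n K.
            rewrite Rminus_0_r. apply K. }
      split; [exact I1|]. split; [rewrite rpow_pos_eq by lra; exact I3|]. split; [exact I2|exact I4].
    + constructor.
      * exists 0%nat. intros n _. apply ln_neg, Hrh.
      * apply is_lim_seq_ext with (2 := L2). intros n. unfold V. rewrite exp_ln by apply Hrh. reflexivity.
      * exact L7.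
      * exact L8.
      * exact L9.
Qed.

(** * The recursion for the limiting numbers and the iteration *)

(** [A] is the limit of the flux after the [k]-th concentration. Multiplied by [delta_k^p], the
    first equation of the recursion says that the exponent vanishes when the tangent line reaches
    height [delta_{k+1}]; the second one gives the slope there. *)
Lemma concentration_numbers_step (p : R) (a delta : nat -> R) (k : nat) :
  0 < p -> concentration_numbers p a delta ->
  let d := delta k in let d' := delta (S k) in
  let A := (2 + a k) / Rpower d (p - 1) in
  0 < d' < d /\ 0 < A /\ 0 < a (S k) < 2 /\ A * Rpower d' (p - 1) = 2 - a (S k) /\
  2 * ((d - d') / (A / p)) + Rpower d' p - Rpower d p = 0.
Proof.
  intros Hp (Ha0 & Hd0 & H) d d' A.
  assert (Hdk : 0 < d).
  { unfold d. destruct k; [lra|]. apply (H (S k)). lia. }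
  assert (Hak : 0 < a k).
  { destruct k; [lra|]. apply (H (S k)). lia. }
  destruct (H (S k) ltac:(lia)) as (H1 & H2 & H3 & H4). cbn [pred] in H1, H3, H4.
  fold d d' in H1, H3, H4.
  assert (Hq : 0 < d' / d) by (apply Rdiv_lt_0_compat; lra).
  rewrite rpow_pos_eq in H3, H4 by exact Hq. rewrite Rpower_div in H3, H4 by lra.
  assert (P1 := Rpower_pos d (p - 1)).
  split; [exact H1|]. split; [apply Rdiv_lt_0_compat; lra|]. split; [exact H2|].
  split.
  - rewrite H4. unfold A. field. lra.
  - assert (E : Rpower d p = d * Rpower d (p - 1)) by (apply Rpower_pred; exact Hdk).
    rewrite E in H3. unfold A. rewrite E.
    apply Rmult_eq_reg_r with (/ (d * Rpower d (p - 1)));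
      [|apply Rinv_neq_0_compat; apply Rgt_not_eq; apply Rmult_lt_0_compat; assumption].
    rewrite Rmult_0_l, <- H3. field. lra.
Qed.

Theorem theorem1p4
  (p : R) (Hp : 2 < p)
  (h : R -> R)
  (HhC1 : C1_on (fun t => 0 <= t) h)
  (Hhnonneg : forall t, 0 <= t -> 0 <= h t)
  (Hhpos : exists t0, 0 < t0 /\ forall t, t0 <= t -> 0 < h t)
  (Hhlim : is_lim (fun t => Derive h t / (rpow t (p - 1) * h t)) p_infty 0)
  (a delta : nat -> R) (Hnum : concentration_numbers p a delta)
  (lambda mu : nat -> R) (u : nat -> R -> R)
  (Hsol : forall n, is_solution (nonlin h p) (lambda n) (mu n) (u n))
  (Hmu : is_lim_seq mu p_infty)
  (psi : nat -> nat) (Hpsi : strictly_increasing psi)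
  (rho0 : nat -> R)
  (Hrho0 : first_concentration p (nonlin h p)
             (fun n => lambda (psi n)) (fun n => mu (psi n))
             (fun n => u (psi n)) (fun n => rho0 (psi n))) :
  exists s : nat -> nat, subsequence_of s psi /\
  exists r rho rhobar : nat -> nat -> R,
    (forall n, rho 0%nat n = rho0 (s n)) /\
    forall k : nat, (1 <= k)%nat ->
    let f := nonlin h p in
    let lam n := lambda (s n) in
    let m n := mu (s n) in
    let v n := u (s n) in
    (forall n, 0 < r k n < 1) /\
    (forall n, 0 < rho k n < 1) /\
    (forall n, 0 < rhobar k n < 1) /\
    is_lim_seq (fun n => v n (r k n) / m n) (delta k) /\
    is_lim_seq (fun n => p * lam n * r k n ^ 2 * rpow (v n (r k n)) (p - 1)
                         * f (v n (r k n))) (a k ^ 2 / 2) /\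
    is_lim_seq (fun n => v n (rho k n) / m n) (delta k) /\
    is_lim_seq (fun n => v n (rhobar k n) / m n) (delta k) /\
    is_lim_seq (fun n => rho (pred k) n / rhobar k n) 0 /\
    is_lim_seq (fun n => rhobar k n / r k n) 0 /\
    is_lim_seq (fun n => r k n / rho k n) 0 /\
    (exists gamma : nat -> R,
      (forall n, 0 < gamma n /\
         gamma n ^ 2 * p * lam n * rpow (v n (r k n)) (p - 1)
           * f (v n (r k n)) = 1) /\
      is_lim_seq gamma 0 /\
      Ck_norm_to_0 2
        (fun n => icc (rhobar k n / gamma n) (rho k n / gamma n))
        (fun n x => p * rpow (v n (r k n)) (p - 1)
                      * (v n (gamma n * x) - v n (r k n))
                    - profile (a k) x)) /\
    solves_liouville (profile (a k)) /\
    profile (a k) (a k / sqrt 2) = 0 /\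
    - (a k / sqrt 2) * Derive (profile (a k)) (a k / sqrt 2) = 2 /\
    is_RInt_gen (fun x => exp (profile (a k) x) * x)
      (at_right 0) (Rbar_locally p_infty) (2 * a k) /\
    is_lim_seq (fun n => p * rpow (m n) (p - 1) *
      RInt (fun x => lam n * f (v n x) * x) (rho (pred k) n) (rhobar k n)) 0 /\
    is_lim_seq (fun n => p * rpow (m n) (p - 1) *
      RInt (fun x => lam n * f (v n x) * x) (rhobar k n) (rho k n))
      (2 * a k / rpow (delta k) (p - 1)) /\
    is_lim_seq (fun n => p *
      RInt (fun x => lam n * rpow (v n x) (p - 1) * f (v n x) * x)
        (rho (pred k) n) (rhobar k n)) 0 /\
    is_lim_seq (fun n => p *
      RInt (fun x => lam n * rpow (v n x) (p - 1) * f (v n x) * x)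
        (rhobar k n) (rho k n)) (2 * a k).
Proof.
  set (f := nonlin h p).
  assert (Hf : exp_type p f) by (apply nonlin_exp_type; assumption).
  assert (Hc : forall t, 0 < t -> continuous f t).
  { intros t Ht. destruct HhC1 as (h' & Hh & _). apply (ex_derive_continuous f).
    eexists. apply (is_derive_nonlin h h' p t Hh Ht). }
  set (lam := fun n => lambda (psi n)). set (m := fun n => mu (psi n)). set (v := fun n => u (psi n)).
  assert (Hm : is_lim_seq m p_infty) by (apply (is_lim_seq_subseq mu p_infty psi); [apply eventually_subseq, Hpsi|exact Hmu]).
  assert (Htr := fun n => solution_trajectory f (lam n) (m n) (v n) (proj1 Hf) (Hsol (psi n))).
  assert (Hfm : forall n, 0 < f (m n)).
  { intros n. destruct Hrho0 as (_ & g & Hg & _). destruct (Hg n) as [G1 G2].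
    assert (M := traj_mu _ _ _ _ _ (proj1 (Htr n))).
    destruct (Rle_lt_or_eq_dec _ _ (proj1 Hf (m n) ltac:(lra))) as [F|F]; [exact F|].
    change (nonlin h p (mu (psi n))) with (f (m n)) in G2. rewrite <- F in G2. lra. }
  set (plat := fun k rho => (forall n : nat, 0 < rho n < 1) /\
    plateau p f lam m (fun n s => v n (exp s)) (fun n => Derive (fun s => v n (exp s)))
      (delta k) ((2 + a k) / Rpower (delta k) (p - 1)) (fun n => ln (rho n))).
  assert (Hbase : plat 0%nat (fun n => rho0 (psi n))).
  { split; [apply Hrho0|]. destruct Hnum as (E1 & E2 & _). rewrite E1, E2.
    replace ((2 + 2) / Rpower 1 (p - 1)) with 4
      by (unfold Rpower; rewrite ln_1, Rmult_0_r, exp_0; field).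
    apply base_plateau; auto; try lra; intros n; apply Htr. }
  (* [plat] stands behind the existential, as a premise, so that the choice function is defined on
     all pairs and [rho] can be built by plain recursion; its plateau property is proved afterwards
     by induction. *)
  assert (Hstep : forall x : nat * (nat -> R), exists y : (nat -> R) * (nat -> R) * (nat -> R),
    plat (fst x) (snd x) ->
    concentrates p f lam m v (delta (S (fst x))) (a (S (fst x))) (snd x)
      (fst (fst y)) (snd (fst y)) (snd y) /\
    plat (S (fst x)) (snd (fst y))).
  { intros [k rp]. cbn [fst snd].
    destruct (classic (plat k rp)) as [[Hrp Hpl]|Hno];
      [|exists (rp, rp, rp); intros Hpl; contradiction].
    destruct (concentration_numbers_step p a delta k ltac:(lra) Hnum) as (N1 & N2 & N3 & N4 & N5).
    destruct (concentration_step p f lam m v _ _ _ _ rp ltac:(lra) Hf Hm (fun n => proj1 (Htr n)) Hc Hfm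
      Hrp Hpl N1 N2 N3 N4 N5) as (r & rho & rhobar & K1 & K2).
    exists (r, rho, rhobar). intros _. cbn [fst snd]. split; [exact K1|]. split; [|exact K2]. apply K1. }
  destruct (functional_choice _ Hstep) as [F HF].
  set (rho := fix rho (k : nat) : nat -> R :=
    match k with O => fun n => rho0 (psi n) | S k' => snd (fst (F (k', rho k'))) end).
  assert (Hplat : forall k, plat k (rho k)).
  { induction k as [|k IH]; [exact Hbase|]. apply (HF (k, rho k)). exact IH. }
  (* Every step yields limits along the whole sequence indexed by [psi], so this one subsequence
     serves all [k] at once. *)
  exists psi. split; [exists (fun n => n); split; [intros n; lia|reflexivity]|].
  exists (fun k => fst (fst (F (pred k, rho (pred k))))), rho, (fun k => snd (F (pred k, rho (pred k)))).
  split; [reflexivity|].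
  intros [|k] Hk; [lia|]. cbn [pred].
  destruct (HF (k, rho k) (Hplat k)) as [K _]. cbn [fst snd] in K.
  destruct K as (K1 & K2 & K3 & K4 & K5 & K6 & K7 & K8 & K9 & K10 & K11 & K12 & K13 & K14 & K15).
  assert (Ha : 0 < a (S k)) by (apply (concentration_numbers_step p a delta k ltac:(lra) Hnum)).
  do 11 (split; [assumption|]).
  split; [apply profile_solves_liouville, Ha|]. split; [apply profile_at_center, Ha|].
  split; [apply profile'_at_center, Ha|]. split; [apply profile_mass, Ha|].
  repeat (split; [assumption|]). assumption.
Qed.
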